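(* Let $n\ge2$, let $s^0=(s_1^0,\dots,s_{n-1}^0,p^0)\in\mathbb G_n$ and let $\lambda_0\in\mathbb D\setminus\{0\}$. Suppose there exists an analytic function $\psi:\mathbb D\to\mathbb G_n$ such that $\psi(0)=(0,\dots,0)$ and $\psi(\lambda_0)=s^0$. Then: (1) $$\sup_{z\in\overline{\mathbb D}}\left|\frac{n(-1)^np^0z^{n-1}+(n-1)(-1)^{n-1}s_{n-1}^0z^{n-2}+\cdots+(-s_1^0)}{n-(n-1)s_1^0z+\cdots+(-1)^{n-1}s_{n-1}^0z^{n-1}}\right|\le|\lambda_0|,$$ where the numerator is $\sum_{k=1}^nk(-1)^ks_k^0z^{k-1}$ and the denominator is $\sum_{k=0}^{n-1}(n-k)(-1)^ks_k^0z^k$, with $s_0^0=1$, $s_n^0=p^0$. (2) All of the following conditions (C2)–(C11) hold, where $y^0=(y_1^0,\dots,y_{n-1}^0,q^0):=s^0$ (that is, $y_j^0=s_j^0$ and $q^0=p^0$). (C2) $\max_{1\le j\le n-1}\|\Phi_j(\cdot,y^0)\|_{H^\infty}\le|\lambda_0|$. (C3) For each $j=1,\dots,[\frac n2]$: $\|\Phi_j(\cdot,y^0)\|_{H^\infty}\le|\lambda_0|$ if $|y_{n-j}^0|\le|y_j^0|$, and $\|\Phi_{n-j}(\cdot,y^0)\|_{H^\infty}\le|\lambda_0|$ if $|y_j^0|\le|y_{n-j}^0|$. (C4) If $n$ is odd: the point $\tilde y=(\tilde y_1,\dots,\tilde y_{n-1},\tilde q)$ belongs to $\widetilde\Gamma_n$,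 where $\tilde q=q^0/\lambda_0$ and, for each $j=1,\dots,[\frac n2]$, $\tilde y_j=y_j^0/\lambda_0$ and $\tilde y_{n-j}=y_{n-j}^0$ when $|y_{n-j}^0|\le|y_j^0|$, while $\tilde y_j=y_j^0$ and $\tilde y_{n-j}=y_{n-j}^0/\lambda_0$ otherwise. If $n$ is even: the point $\hat y=(\hat y_1,\dots,\hat y_n,\hat q)\in\mathbb C^{n+1}$ belongs to $\widetilde\Gamma_{n+1}$, where $\hat q=q^0/\lambda_0$, $\hat y_{n/2}=\frac{n+1}{\frac n2+1}\frac{y_{n/2}^0}{\lambda_0}$, $\hat y_{n/2+1}=\frac{n+1}{\frac n2+1}y_{n/2}^0$, and, for each $j=1,\dots,\frac n2-1$, $\hat y_j=\frac{n+1}{n+1-j}\tilde y_j$ and $\hat y_{n+1-j}=\frac{n+1}{n+1-j}\tilde y_{n-j}$, with $\tilde y_j=y_j^0/\lambda_0$, $\tilde y_{n-j}=y_{n-j}^0$ when $|y_{n-j}^0|\le|y_j^0|$, and $\tilde y_j=y_j^0$, $\tilde y_{n-j}=y_{n-j}^0/\lambda_0$ otherwise. (C5) There exist functions $F_1,\dots,F_{[\frac n2]}$ in the Schur class (of type $2\times 2$) such that $F_j(0)=\begin{bmatrix}0&*\\0&0\end{bmatrix}$ and $F_j(\lambda_0)=B_j$ for $j=1,\dots,[\frac n2]$, where $\det B_1=\cdots=\det B_{[\frac n2]}=q^0$, $y_j^0=\binom nj[B_j]_{11}$ and $y_{n-j}^0=\binom nj[B_j]_{22}$. (C6) For each $j=1,\dots,[\frac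 n2]$: $$\frac{\binom nj\left|y_j^0-\bar y_{n-j}^0q^0\right|+\left|y_j^0y_{n-j}^0-\binom nj^2q^0\right|}{\binom nj^2-|y_{n-j}^0|^2}\le|\lambda_0|\ \text{ if }|y_{n-j}^0|\le|y_j^0|,$$ $$\frac{\binom nj\left|y_{n-j}^0-\bar y_j^0q^0\right|+\left|y_j^0y_{n-j}^0-\binom nj^2q^0\right|}{\binom nj^2-|y_j^0|^2}\le|\lambda_0|\ \text{ if }|y_j^0|\le|y_{n-j}^0|.$$ (C7) For each $j=1,\dots,[\frac n2]$: $\binom nj\lambda_0-y_j^0z-y_{n-j}^0\lambda_0w+\binom njq^0zw\ne0$ for all $z,w\in\mathbb D$ if $|y_{n-j}^0|\le|y_j^0|$; and $\binom nj\lambda_0-y_{n-j}^0z-y_j^0\lambda_0w+\binom njq^0zw\ne0$ for all $z,w\in\mathbb D$ if $|y_j^0|\le|y_{n-j}^0|$. (C8) For each $j=1,\dots,[\frac n2]$: $$|y_j^0|^2-|\lambda_0|^2|y_{n-j}^0|^2+\tbinom nj^2|q^0|^2-\tbinom nj^2|\lambda_0|^2+2\tbinom nj\left||\lambda_0|^2y_{n-j}^0-\bar y_j^0q^0\right|\le0\ \text{ if }|y_{n-j}^0|\le|y_j^0|,$$ $$|y_{n-j}^0|^2-|\lambda_0|^2|y_j^0|^2+\tbinom nj^2|q^0|^2-\tbinom nj^2|\lambda_0|^2+2\tbinom nj\left||\lambda_0|^2y_j^0-\bar y_{n-j}^0q^0\right|\le0\ \text{ if }|y_j^0|\le|y_{n-j}^0|.$$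 (C9) $|q^0|\le|\lambda_0|$ and for each $j=1,\dots,[\frac n2]$: $$|y_j^0|^2+|\lambda_0|^2|y_{n-j}^0|^2-\tbinom nj^2|q^0|^2+2|\lambda_0|\left|y_j^0y_{n-j}^0-\tbinom nj^2q^0\right|\le\tbinom nj^2|\lambda_0|^2\ \text{ if }|y_{n-j}^0|\le|y_j^0|,$$ $$|y_{n-j}^0|^2+|\lambda_0|^2|y_j^0|^2-\tbinom nj^2|q^0|^2+2|\lambda_0|\left|y_j^0y_{n-j}^0-\tbinom nj^2q^0\right|\le\tbinom nj^2|\lambda_0|^2\ \text{ if }|y_j^0|\le|y_{n-j}^0|.$$ (C10) For each $j=1,\dots,[\frac n2]$: $$\left||\lambda_0|^2y_{n-j}^0-\bar y_j^0q^0\right|+|\lambda_0|\left|y_j^0-\bar y_{n-j}^0q^0\right|+\tbinom nj|q^0|^2\le\tbinom nj|\lambda_0|^2\ \text{ if }|y_{n-j}^0|\le|y_j^0|,$$ $$\left||\lambda_0|^2y_j^0-\bar y_{n-j}^0q^0\right|+|\lambda_0|\left|y_{n-j}^0-\bar y_j^0q^0\right|+\tbinom nj|q^0|^2\le\tbinom nj|\lambda_0|^2\ \text{ if }|y_j^0|\le|y_{n-j}^0|.$$ (C11) $|q^0|\le|\lambda_0|$ and: if $n$ is odd, there exists $(\beta_1,\dots,\beta_{n-1})\in\mathbb C^{n-1}$ such that for each $j=1,\dots,[\frac n2]$ one has $|\beta_j|+|\beta_{n-j}|\le\binom nj$ and $$\begin{cases}y_j^0=\beta_j\lambda_0+\bar\beta_{n-j}q^0\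 \text{ and }\ y_{n-j}^0\lambda_0=\beta_{n-j}\lambda_0+\bar\beta_jq^0&\text{if }|y_{n-j}^0|\le|y_j^0|,\\ y_j^0\lambda_0=\beta_j\lambda_0+\bar\beta_{n-j}q^0\ \text{ and }\ y_{n-j}^0=\beta_{n-j}\lambda_0+\bar\beta_jq^0&\text{if }|y_j^0|<|y_{n-j}^0|;\end{cases}$$ if $n$ is even, there exists $(\beta_1,\dots,\beta_n)\in\mathbb C^n$ such that for each $j=1,\dots,\frac n2$ one has $|\beta_j|+|\beta_{n+1-j}|\le\binom nj$ and $$\begin{cases}y_j^0=\beta_j\lambda_0+\bar\beta_{n+1-j}q^0\ \text{ and }\ y_{n-j}^0\lambda_0=\beta_{n+1-j}\lambda_0+\bar\beta_jq^0&\text{if }|y_{n-j}^0|\le|y_j^0|,\\ y_j^0\lambda_0=\beta_j\lambda_0+\bar\beta_{n+1-j}q^0\ \text{ and }\ y_{n-j}^0=\beta_{n+1-j}\lambda_0+\bar\beta_jq^0&\text{if }|y_j^0|<|y_{n-j}^0|.\end{cases}$$ Also, for $n=2$, for any $s^0\in\mathbb G_2$ and $\lambda_0\in\mathbb D\setminus\{0\}$, each of the conditions (C2)–(C11) is equivalent to the existence of an analytic function $\psi:\mathbb D\to\mathbb G_2$ with $\psi(0)=(0,0)$ and $\psi(\lambda_0)=s^0$.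
   Context: $\mathbb D$ is the open unit disc in $\mathbb C$ and $\overline{\mathbb D}$ its closure; $[x]$ denotes the integer part of $x$; $[B]_{ik}$ denotes the $(i,k)$ entry of a matrix $B$. The symmetrized polydisc is $\mathbb G_n=\pi_n(\mathbb D^n)$, where $\pi_n(z_1,\dots,z_n)=\left(\sum_iz_i,\sum_{i<j}z_iz_j,\dots,\prod_iz_i\right)$ is the symmetrization map, whose components are the elementary symmetric polynomials. The extended symmetrized polydisc $\widetilde{\mathbb G}_n$ is the set of all $(y_1,\dots,y_{n-1},q)\in\mathbb C^n$ with $|q|<1$ for which there exist $\beta_1,\dots,\beta_{n-1}\in\mathbb C$ with $y_j=\beta_j+\bar\beta_{n-j}q$ and $|\beta_j|+|\beta_{n-j}|<\binom nj$ for $j=1,\dots,n-1$. $\widetilde\Gamma_n$ is its closure in $\mathbb C^n$; equivalently, it is given by the same description with $|q|\le1$ and $|\beta_j|+|\beta_{n-j}|\le\binom nj$. For $y=(y_1,\dots,y_{n-1},q)\in\mathbb C^n$, $z\in\mathbb C$ and $1\le j\le n-1$, $$\Phi_j(z,y)=\begin{cases}\dfrac{\binom njqz-y_j}{y_{n-j}z-\binom nj}&\text{if }y_{n-j}z\ne\binom nj\text{ and }y_jy_{n-j}\ne\binom nj^2q,\\[2mm] \dfrac{y_j}{\binom nj}&\text{if }y_jy_{n-j}=\binom nj^2q,\end{cases}$$ and $\|\Phi_j(\cdot,y)\|_{H^\infty}=\sup_{z\in\mathbb D}|\Phi_j(z,y)|$. The Schur class (of type $2\times2$) is the set of analytic functions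 $F$ on $\mathbb D$ with values in $\mathbb C^{2\times2}$ such that $\|F(\lambda)\|\le1$ (operator norm) for all $\lambda\in\mathbb D$. The symbol $*$ denotes an unspecified entry. *)

(* Defs.v *)
From HB Require Import structures.
From mathcomp Require Import all_boot all_order all_algebra.
From mathcomp Require Import all_classical all_reals all_analysis.
From mathcomp Require Import complex.

Set Implicit Arguments.
Unset Strict Implicit.
Unset Printing Implicit Defensive.

Import Order.TTheory GRing.Theory Num.Theory.
Import numFieldNormedType.Exports.

Local Open Scope classical_set_scope.
Local Open Scope ring_scope.
Local Open Scope complex_scope.

(* The complex plane is R[i] for R : realType. MathComp-Analysis
   equips the alias R[i]^o (convertible to R[i]), not R[i] itself, with its
   topology and normed module structure, so ^o appears wherever limits do. *)

(* Modulus with values in R (the norm `|z| of R[i] has values in R[i]). *)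
Notation cmod := (@ComplexField.Normc.normc _).

Section Defs.
Variable R : realType.
Local Notation C := R[i].

Definition disc : set C := [set z | cmod z < 1].
Definition cdisc : set C := [set z | cmod z <= 1].

(* Extended-real valued, hence +oo (not a junk value) if f is unbounded on D. *)
Definition supnorm (D : set C) (f : C -> C) : \bar R :=
  ereal_sup [set (cmod (f z))%:E | z in D].

Definition Hinf (f : C -> C) : \bar R := supnorm disc f.

(* Complex differentiability at each point of the disc: the scalars of
   [derivable] are those of the normed module V, i.e. complex numbers. The
   values of f outside the disc are irrelevant. *)
Definition analytic (V : normedModType C) (f : C^o -> V) : Prop :=
  forall z : C^o, disc z -> derivable f z 1.

(* One-based coordinates of a point of C^n, with the convention y_0 = 1
   (used for s_0 = 1); indices above n are never used. *)
Definition crd (n : nat) (y : 'rV[C]_n) (k : nat) : C :=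
  if k is i.+1 then oapp (fun i : 'I_n => y ord0 i) 0 (insub i) else 1.

Definition esym (n : nat) (z : 'rV[C]_n) (k : nat) : C :=
  \sum_(I : {set 'I_n} | #|I| == k) \prod_(i in I) z ord0 i.

Definition sympi (n : nat) (z : 'rV[C]_n) : 'rV[C]_n :=
  \row_(k < n) esym z k.+1.

Definition polydisc (n : nat) : set 'rV[C]_n :=
  [set z | forall i, disc (z ord0 i)].

Definition symG (n : nat) : set 'rV[C]_n := @sympi n @` @polydisc n.

(* A point (y_1, ..., y_(n-1), q) is y : 'rV_n, so that q = crd y n. *)
Definition extG (n : nat) : set 'rV[C]_n :=
  [set y | cmod (crd y n) < 1 /\
    exists b : 'rV[C]_n.-1, forall j : nat, (1 <= j <= n.-1)%N ->
      crd y j = crd b j + (crd b (n - j))^* * crd y n /\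
      cmod (crd b j) + cmod (crd b (n - j)) < 'C(n, j)%:R].

Definition extGamma (n : nat) : set 'rV[C]_n :=
  closure (@extG n : set 'rV[C^o]_n).

Definition Phi (n j : nat) (z : C) (y : 'rV[C]_n) : C :=
  if crd y j * crd y (n - j) == 'C(n, j)%:R ^+ 2 * crd y n
  then crd y j / 'C(n, j)%:R
  else ('C(n, j)%:R * crd y n * z - crd y j)
       / (crd y (n - j) * z - 'C(n, j)%:R).

Definition l2norm (m : nat) (v : 'cV[C]_m) : R :=
  Num.sqrt (\sum_i cmod (v i ord0) ^+ 2).

Definition opnorm (m : nat) (A : 'M[C]_m) : \bar R :=
  ereal_sup [set (l2norm (A *m v))%:E | v in [set v | l2norm v <= 1]].

Definition schur (F : C -> 'M[C]_2) : Prop :=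
  analytic (F : C^o -> 'M[C^o]_2) /\
  forall z, disc z -> (opnorm (F z) <= 1%:E)%E.

Section Conditions.
Variables (n : nat) (y0 : 'rV[C]_n) (l0 : C).

Definition interpolates : Prop :=
  exists psi : C -> 'rV[C]_n,
    [/\ analytic (psi : C^o -> 'rV[C^o]_n),
        (forall z, disc z -> @symG n (psi z)),
        psi 0 = 0
      & psi l0 = y0].

Local Notation y j := (crd y0 j).
Local Notation q := (crd y0 n).
Local Notation binj j := ('C(n, j)%:R).

Definition ratio_bound : Prop :=
  let num z := \sum_(1 <= k < n.+1) k%:R * (-1) ^+ k * y k * z ^+ k.-1 in
  let den z := \sum_(0 <= k < n) (n - k)%:R * (-1) ^+ k * y k * z ^+ k in
  (supnorm cdisc (fun z => (num z / den z)%R) <= (cmod l0)%:E)%E.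

Definition condC2 : Prop :=
  (\big[maxe/-oo]_(1 <= j < n) Hinf (fun z => Phi j z y0) <= (cmod l0)%:E)%E.

Definition condC3 : Prop :=
  forall j : nat, (1 <= j <= n./2)%N ->
    (cmod (y (n - j)) <= cmod (y j) ->
       (Hinf (fun z => Phi j z y0) <= (cmod l0)%:E)%E) /\
    (cmod (y j) <= cmod (y (n - j)) ->
       (Hinf (fun z => Phi (n - j) z y0) <= (cmod l0)%:E)%E).

(* tilde y_k for 1 <= k <= n-1. The first branch is k = j and the second one
   k = n - j, where 1 <= j <= n/2; for even n the middle index k = n/2 is
   never used. *)
Definition ytilde (k : nat) : C :=
  if (k <= n./2)%N
  then if cmod (y (n - k)) <= cmod (y k) then y k / l0 else y k
  else if cmod (y k) <= cmod (y (n - k)) then y k else y k / l0.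

Definition pt_tilde : 'rV[C]_n :=
  \row_(i < n) (if i.+1 == n then q / l0 else ytilde i.+1).

Definition yhat (k : nat) : C :=
  if k == n./2 then n.+1%:R / (n./2).+1%:R * (y n./2 / l0)
  else if k == (n./2).+1 then n.+1%:R / (n./2).+1%:R * y n./2
  else if (k < n./2)%N then n.+1%:R / (n.+1 - k)%:R * ytilde k
  else (* k = n + 1 - j with 1 <= j <= n/2 - 1 *)
    let j := (n.+1 - k)%N in n.+1%:R / (n.+1 - j)%:R * ytilde (n - j).

Definition pt_hat : 'rV[C]_n.+1 :=
  \row_(i < n.+1) (if i.+1 == n.+1 then q / l0 else yhat i.+1).

Definition condC4 : Prop :=
  (odd n -> @extGamma n pt_tilde) /\ (~~ odd n -> @extGamma n.+1 pt_hat).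

Definition condC5 : Prop :=
  exists (F : nat -> C -> 'M[C]_2) (B : nat -> 'M[C]_2),
    forall j : nat, (1 <= j <= n./2)%N ->
      [/\ schur (F j),
          [/\ F j 0 0 0 = 0, F j 0 1 0 = 0 & F j 0 1 1 = 0],
          F j l0 = B j,
          \det (B j) = q
        & y j = binj j * B j 0 0 /\ y (n - j) = binj j * B j 1 1].

Definition condC6 : Prop :=
  forall j : nat, (1 <= j <= n./2)%N ->
    (cmod (y (n - j)) <= cmod (y j) ->
       (binj j * cmod (y j - (y (n - j))^* * q)
        + cmod (y j * y (n - j) - binj j ^+ 2 * q))
       / (binj j ^+ 2 - cmod (y (n - j)) ^+ 2) <= cmod l0) /\
    (cmod (y j) <= cmod (y (n - j)) ->
       (binj j * cmod (y (n - j) - (y j)^* * q)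
        + cmod (y j * y (n - j) - binj j ^+ 2 * q))
       / (binj j ^+ 2 - cmod (y j) ^+ 2) <= cmod l0).

Definition condC7 : Prop :=
  forall j : nat, (1 <= j <= n./2)%N ->
    (cmod (y (n - j)) <= cmod (y j) ->
       forall z w, disc z -> disc w ->
       binj j * l0 - y j * z - y (n - j) * l0 * w + binj j * q * z * w != 0) /\
    (cmod (y j) <= cmod (y (n - j)) ->
       forall z w, disc z -> disc w ->
       binj j * l0 - y (n - j) * z - y j * l0 * w + binj j * q * z * w != 0).

Definition condC8 : Prop :=
  forall j : nat, (1 <= j <= n./2)%N ->
    (cmod (y (n - j)) <= cmod (y j) ->
       cmod (y j) ^+ 2 - cmod l0 ^+ 2 * cmod (y (n - j)) ^+ 2
       + binj j ^+ 2 * cmod q ^+ 2 - binj j ^+ 2 * cmod l0 ^+ 2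
       + 2 * binj j * cmod ((cmod l0 ^+ 2)%:C * y (n - j) - (y j)^* * q)
       <= 0) /\
    (cmod (y j) <= cmod (y (n - j)) ->
       cmod (y (n - j)) ^+ 2 - cmod l0 ^+ 2 * cmod (y j) ^+ 2
       + binj j ^+ 2 * cmod q ^+ 2 - binj j ^+ 2 * cmod l0 ^+ 2
       + 2 * binj j * cmod ((cmod l0 ^+ 2)%:C * y j - (y (n - j))^* * q)
       <= 0).

Definition condC9 : Prop :=
  cmod q <= cmod l0 /\
  forall j : nat, (1 <= j <= n./2)%N ->
    (cmod (y (n - j)) <= cmod (y j) ->
       cmod (y j) ^+ 2 + cmod l0 ^+ 2 * cmod (y (n - j)) ^+ 2
       - binj j ^+ 2 * cmod q ^+ 2
       + 2 * cmod l0 * cmod (y j * y (n - j) - binj j ^+ 2 * q)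
       <= binj j ^+ 2 * cmod l0 ^+ 2) /\
    (cmod (y j) <= cmod (y (n - j)) ->
       cmod (y (n - j)) ^+ 2 + cmod l0 ^+ 2 * cmod (y j) ^+ 2
       - binj j ^+ 2 * cmod q ^+ 2
       + 2 * cmod l0 * cmod (y j * y (n - j) - binj j ^+ 2 * q)
       <= binj j ^+ 2 * cmod l0 ^+ 2).

Definition condC10 : Prop :=
  forall j : nat, (1 <= j <= n./2)%N ->
    (cmod (y (n - j)) <= cmod (y j) ->
       cmod ((cmod l0 ^+ 2)%:C * y (n - j) - (y j)^* * q)
       + cmod l0 * cmod (y j - (y (n - j))^* * q)
       + binj j * cmod q ^+ 2 <= binj j * cmod l0 ^+ 2) /\
    (cmod (y j) <= cmod (y (n - j)) ->
       cmod ((cmod l0 ^+ 2)%:C * y j - (y (n - j))^* * q)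
       + cmod l0 * cmod (y (n - j) - (y j)^* * q)
       + binj j * cmod q ^+ 2 <= binj j * cmod l0 ^+ 2).

Definition condC11 : Prop :=
  [/\ cmod q <= cmod l0,
      odd n ->
      exists b : 'rV[C]_n.-1, forall j : nat, (1 <= j <= n./2)%N ->
        [/\ cmod (crd b j) + cmod (crd b (n - j)) <= binj j,
            cmod (y (n - j)) <= cmod (y j) ->
              y j = crd b j * l0 + (crd b (n - j))^* * q /\
              y (n - j) * l0 = crd b (n - j) * l0 + (crd b j)^* * q
          & cmod (y j) < cmod (y (n - j)) ->
              y j * l0 = crd b j * l0 + (crd b (n - j))^* * q /\
              y (n - j) = crd b (n - j) * l0 + (crd b j)^* * q]
    & ~~ odd n ->
      exists b : 'rV[C]_n, forall j : nat, (1 <= j <= n./2)%N ->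
        [/\ cmod (crd b j) + cmod (crd b (n.+1 - j)) <= binj j,
            cmod (y (n - j)) <= cmod (y j) ->
              y j = crd b j * l0 + (crd b (n.+1 - j))^* * q /\
              y (n - j) * l0 = crd b (n.+1 - j) * l0 + (crd b j)^* * q
          & cmod (y j) < cmod (y (n - j)) ->
              y j * l0 = crd b j * l0 + (crd b (n.+1 - j))^* * q /\
              y (n - j) = crd b (n.+1 - j) * l0 + (crd b j)^* * q]].

End Conditions.
End Defs.

(* Main.v *)
(* Fix j and put x = (y_j / c, y_(n-j) / c, q) with c = 'C(n, j). For y in G_n this
   point is the mean, over the j-subsets I, of the points (a, b, a b), where a and b
   are the products of the z_i over I and over its complement; all these points have
   the same third coordinate, and the slices of the closed tetrablock with fixed third
   coordinate are convex, so x lies in the tetrablock. Hence for |z| < 1 the function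
   (x3 z - x1) / (x2 z - 1) maps an analytic disc through 0 in G_n to an analytic
   function bounded by 1 which vanishes at 0, and the Schwarz lemma puts the point
   (x1 / l0, x2, x3 / l0) in the closed tetrablock; C2, C3 and C6-C11 all express this
   membership. The ratio bound is the Schwarz lemma for the logarithmic-derivative
   quotient, which is bounded by 1 on G_n.
   Conversely, write (x1 / l0, x2, x3 / l0) = (b1 + b2^* w, b2 + b1^* w, w) with
   |b1| + |b2| <= 1. If |x2| <= |x1|, one can solve the scalar two-point problem
   P(0) = - b2 / b1^*, P(l0) = w by a Moebius map P, and the unitary factorization of
   (b1, b2) turns l |-> (l (b1 + b2^* P), b2 + b1^* P, l P) into a Schur function, which
   gives C5. For n = 2 the first two coordinates agree and give the map into G_2. *)
Require Import Defs.
From HB Require Import structures.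
From mathcomp Require Import all_boot all_order all_algebra.
From mathcomp Require Import all_classical all_reals all_analysis.
From mathcomp Require Import complex.
From mathcomp Require Import ring lra zify.

Set Implicit Arguments.
Unset Strict Implicit.
Unset Printing Implicit Defensive.

Import Order.TTheory GRing.Theory Num.Theory.
Import numFieldNormedType.Exports.

Local Open Scope classical_set_scope.
Local Open Scope ring_scope.
Local Open Scope complex_scope.

(** * Goursat's theorem and the Schwarz lemma *)

Section Modulus.
Variable R : realType.
Local Notation C := R[i].
Implicit Types (x y z w : C) (a b : R).

(** Goursat's theorem on squares is the only integration used: there is no Cauchy formula and no
    power series. Singularities are removed by an exponent, since [a ^+ k.+2 / (w - z0) ^+ k.+1]
    with [a z0 = 0] is differentiable at [z0] too; in the Schwarz lemma the surplus power is
    outweighed by a large [k]. Squares reach the disc through the Cayley map. The forms of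
    tetrablock membership are all compared with one of them, [hub]. Identities between squared
    moduli turn each comparison into real algebra in which only signs are delicate, and [|x2| < 1]
    settles them. This bound is available because [|y_(n-j)| < 'C(n, j)] on G_n and the second
    coordinate is not divided by [l0]. Each form then serves where it is strong: C10 averages over
    subsets, C3 is the language of the Schwarz lemma, C11 starts the construction of maps. Every [j]
    is interpolated separately; for [n = 2], where [j = 1] is the sole index, this yields a map into
    G_2. *)

Lemma normc_cmod z : `|z| = (cmod z)%:C.
Proof. by rewrite normc_def; case: z. Qed.

Lemma cmod_ge0 z : 0 <= cmod z.
Proof. by case: z => a b; exact: sqrtr_ge0. Qed.

Lemma cmodD x y : cmod (x + y) <= cmod x + cmod y.
Proof. exact: (@le_normcD R). Qed.

Lemma cmodM x y : cmod (x * y) = cmod x * cmod y.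
Proof. exact: ComplexField.Normc.normcM. Qed.

Lemma cmodV x : cmod x^-1 = (cmod x)^-1.
Proof. exact: ComplexField.Normc.normcV. Qed.

Lemma cmodN x : cmod (- x) = cmod x.
Proof. exact: (@normcN R). Qed.

Lemma cmodB x y : cmod (x - y) <= cmod x + cmod y.
Proof. by rewrite -(cmodN y); exact: cmodD. Qed.

Lemma cmodC x y : cmod (x - y) = cmod (y - x).
Proof. by rewrite -cmodN opprB. Qed.

Lemma cmod0 : cmod (0 : C) = 0.
Proof. exact: ComplexField.Normc.normc0. Qed.

Lemma cmod1 : cmod (1 : C) = 1.
Proof. exact: ComplexField.Normc.normc1. Qed.

Lemma cmodX x n : cmod (x ^+ n) = cmod x ^+ n.
Proof. by elim: n => [|n IH]; rewrite ?cmod1 // !exprS cmodM IH. Qed.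

Lemma cmod_eq0 x : (cmod x == 0) = (x == 0).
Proof.
apply/eqP/eqP => [|->]; last exact: cmod0.
exact: ComplexField.Normc.eq0_normc.
Qed.

Lemma cmod_gt0 x : (0 < cmod x) = (x != 0).
Proof. by rewrite lt_neqAle cmod_ge0 andbT eq_sym cmod_eq0. Qed.

Lemma cmodJ x : cmod (Num.conj x) = cmod x.
Proof. by case: x => a b /=; rewrite sqrrN. Qed.

Lemma cmod_real a : cmod a%:C = `|a|.
Proof. by rewrite /= expr0n addr0 sqrtr_sqr. Qed.

Lemma cmod_nat n : cmod (n%:R : C) = n%:R.
Proof.
by rewrite -(ger0_norm (ler0n R n)) -cmod_real rmorph_nat.
Qed.

Lemma sqr_cmod x : cmod x ^+ 2 = complex.Re x ^+ 2 + complex.Im x ^+ 2.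
Proof. by case: x => a b /=; rewrite sqr_sqrtr // addr_ge0 ?sqr_ge0. Qed.

Lemma sqr_cmodE x : (cmod x ^+ 2)%:C = x * x^*.
Proof. by rewrite sqr_cmod; case: x => a b /=; simpc; congr (_ +i* _); ring. Qed.

Lemma ler_Re_cmod x : `|complex.Re x| <= cmod x.
Proof.
rewrite -ler_sqr ?nnegrE ?cmod_ge0 ?normr_ge0 // real_normK ?num_real //.
by rewrite sqr_cmod lerDl sqr_ge0.
Qed.

Lemma ler_Im_cmod x : `|complex.Im x| <= cmod x.
Proof.
rewrite -ler_sqr ?nnegrE ?cmod_ge0 ?normr_ge0 // real_normK ?num_real //.
by rewrite sqr_cmod lerDr sqr_ge0.
Qed.

Lemma cmod_sum (I : Type) (r : seq I) (P : pred I) (F : I -> C) :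
  cmod (\sum_(i <- r | P i) F i) <= \sum_(i <- r | P i) cmod (F i).
Proof.
elim/big_rec2 : _ => [|i u v _ uv]; first by rewrite cmod0.
by apply: (le_trans (cmodD _ _)); rewrite lerD2l.
Qed.

Lemma cmod_prod (I : Type) (r : seq I) (P : pred I) (F : I -> C) :
  cmod (\prod_(i <- r | P i) F i) = \prod_(i <- r | P i) cmod (F i).
Proof.
elim/big_rec2 : _ => [|i u v _ uv]; first by rewrite cmod1.
by rewrite cmodM uv.
Qed.

Lemma cmodD_ge x y : cmod x - cmod y <= cmod (x + y).
Proof. by rewrite lerBlDr -{1}(addrK y x); apply: (le_trans (cmodB _ _)). Qed.

Lemma cmodB_ge x y : cmod x - cmod y <= cmod (x - y).
Proof. by rewrite -(cmodN y); exact: cmodD_ge. Qed.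

Lemma cmod_le_ReIm x : cmod x <= `|complex.Re x| + `|complex.Im x|.
Proof.
rewrite -ler_sqr ?nnegrE ?cmod_ge0 ?addr_ge0 ?normr_ge0 // sqr_cmod sqrrD.
rewrite !real_normK ?num_real //.
by have := mulr_ge0 (normr_ge0 (complex.Re x)) (normr_ge0 (complex.Im x)); lra.
Qed.

End Modulus.

(** * Integrals of continuous real functions over a segment *)

Section Integral.
Variable R : realType.
Local Notation mu := (@lebesgue_measure R).
Implicit Types (f g : R -> R) (a b c k : R).

(** Continuity is two-sided even at the endpoints: the integrands come from functions continuous in
    a full complex neighbourhood of each side. *)
Definition cont_on (a b : R) (f : R -> R) : Prop :=
  forall t, a <= t <= b -> {for t, continuous f}.

Definition intg (a b : R) (f : R -> R) : R := \int[mu]_(t in `[a, b]) f t.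

Lemma cont_onW a b a' b' f : a <= a' -> b' <= b -> cont_on a b f -> cont_on a' b' f.
Proof.
by move=> aa bb cf t /andP[at' tb]; apply: cf; rewrite (le_trans aa)//= (le_trans tb).
Qed.

Lemma cont_on_integrable a b f : cont_on a b f -> mu.-integrable `[a, b] (EFin \o f).
Proof.
move=> cf; apply: continuous_compact_integrable; first exact: segment_compact.
by apply: continuous_in_subspaceT => t; rewrite inE /= in_itv /=; exact: cf.
Qed.

Lemma intg_cst a b k : a <= b -> intg a b (fun=> k) = k * (b - a).
Proof.
move=> ab; rewrite /intg Rintegral_cst //= lebesgue_measure_itv /= lte_fin.
by case: ltgtP ab => //= ->; rewrite subrr mulr0.
Qed.

Lemma intgB a b f g : cont_on a b f -> cont_on a b g ->
  intg a b (fun t => f t - g t) = intg a b f - intg a b g.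
Proof. by move=> cf cg; apply: RintegralB => //; exact: cont_on_integrable. Qed.

Lemma intg_split a b c f : a <= b -> b <= c -> cont_on a c f ->
  intg a c f = intg a b f + intg b c f.
Proof.
move=> ab bc cf; apply/eqP; rewrite addrC -subr_eq; apply/eqP.
rewrite /intg Rintegral_itvB ?bnd_simp //; last exact: cont_on_integrable.
rewrite Rintegral_itv_obnd_cbnd //.
apply: integrableS (cont_on_integrable (cont_onW ab (lexx c) cf)) => // t /=.
by rewrite !in_itv /= => /andP[/ltW -> ->].
Qed.

Lemma intg_le a b f g : cont_on a b f -> cont_on a b g ->
  (forall t, a <= t <= b -> f t <= g t) -> intg a b f <= intg a b g.
Proof.
by move=> cf cg fg; apply: le_Rintegral => //; exact: cont_on_integrable.
Qed.

Lemma cont_on_cst a b k : cont_on a b (fun=> k).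
Proof. by move=> t _; exact: cst_continuous. Qed.

Lemma intg_ge a b f k : a <= b -> cont_on a b f ->
  (forall t, a <= t <= b -> k <= f t) -> k * (b - a) <= intg a b f.
Proof.
by move=> ab cf kf; rewrite -intg_cst //; apply: intg_le => //; exact: cont_on_cst.
Qed.

Lemma intg_norm a b f k : a <= b -> cont_on a b f ->
  (forall t, a <= t <= b -> `|f t| <= k) -> `|intg a b f| <= k * (b - a).
Proof.
move=> ab cf kf; rewrite ler_norml -mulNr; apply/andP; split.
  by apply: intg_ge => // t /kf; rewrite ler_norml => /andP[].
rewrite -intg_cst //; apply: intg_le => //; first exact: cont_on_cst.
by move=> t /kf; rewrite ler_norml => /andP[].
Qed.

Lemma eq_intg a b f g : (forall t, a <= t <= b -> f t = g t) -> intg a b f = intg a b g.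
Proof.
move=> fg; rewrite /intg; apply: eq_Rintegral => t; rewrite inE /= in_itv /=.
exact: fg.
Qed.

End Integral.

(** * Goursat's theorem for squares *)

Section Goursat.
Variable R : realType.
Local Notation C := R[i].
Implicit Types (f g : C -> C) (z w d : C) (x y s e r : R).

(** Differentiability with real epsilons and without a quotient, so that [w = z] needs no exclusion;
    [derivable_cdiff] identifies it with [derivable]. *)
Definition cdiff f z := exists d, forall e, 0 < e ->
  exists2 r, 0 < r & forall w, cmod (w - z) < r ->
    cmod (f w - f z - d * (w - z)) <= e * cmod (w - z).

Definition ccont f z := forall e, 0 < e ->
  exists2 r, 0 < r & forall w, cmod (w - z) < r -> cmod (f w - f z) < e.

Lemma cdiff_ccont f z : cdiff f z -> ccont f z.
Proof.
move=> [d fd] e e0; have [r r0 fr] := fd 1 ltr01.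
have d0 := cmod_ge0 d.
have k0 : 0 < cmod d + 1 by lra.
exists (Num.min r (e / (cmod d + 1))) => [|w]; first by rewrite lt_min r0 divr_gt0.
rewrite lt_min ltr_pdivlMr // => /andP[wr we].
have := cmodD (f w - f z - d * (w - z)) (d * (w - z)).
by rewrite subrK cmodM; have := fr w wr; lra.
Qed.

Lemma ccont_affine (a b : C) z : ccont (fun w => a + b * w) z.
Proof.
apply: cdiff_ccont; exists b => e e0; exists 1 => // w _.
have -> : a + b * w - (a + b * z) - b * (w - z) = 0 by ring.
by rewrite cmod0 mulr_ge0 ?cmod_ge0 // ltW.
Qed.

Lemma ccontB f g z : ccont f z -> ccont g z -> ccont (fun w => f w - g w) z.
Proof.
move=> cf cg e e0; have e20 : 0 < e / 2 by lra.
have [r r0 fr] := cf _ e20; have [r' r'0 gr] := cg _ e20.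
exists (Num.min r r') => [|w]; first by rewrite lt_min r0.
rewrite lt_min => /andP[/fr fw /gr gw].
have -> : f w - g w - (f z - g z) = (f w - f z) - (g w - g z) by ring.
by apply: (le_lt_trans (cmodB _ _)); lra.
Qed.

(** One statement for all sides of a square: [u] runs along a horizontal or vertical line and [p] is
    the real or imaginary part. *)
Lemma ccont_path (u : R -> C) (p : C -> R) f (a b : R) :
  (forall t t' : R, cmod (u t' - u t) = `|t' - t|) ->
  (forall z w, `|p z - p w| <= cmod (z - w)) ->
  (forall t, a <= t <= b -> ccont f (u t)) ->
  cont_on a b (fun t => p (f (u t))).
Proof.
move=> u1 p1 cf t tab; apply/cvgrPdist_lt => e e0.
have [r r0 fr] := cf _ tab _ e0.
near=> t'; rewrite distrC; apply: (le_lt_trans (p1 _ _)).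
apply: fr; rewrite u1 distrC.
by near: t'; apply: (@cvgr_dist_lt _ _ _ (nbhs t) _ id) => //; exact: cvg_id.
Unshelve. all: by end_near.
Qed.

Lemma cmod_horizontal y (t t' : R) : cmod ((t' +i* y) - (t +i* y) : C) = `|t' - t|.
Proof. by rewrite /= subrr expr0n /= addr0 sqrtr_sqr. Qed.

Lemma cmod_vertical x (t t' : R) : cmod ((x +i* t') - (x +i* t) : C) = `|t' - t|.
Proof.
by rewrite /= subrr expr0n /= add0r sqrtr_sqr.
Qed.

Lemma lip_Re z w : `|complex.Re z - complex.Re w| <= cmod (z - w).
Proof. by apply: le_trans (ler_Re_cmod _); case: z => ? ?; case: w. Qed.

Lemma lip_Im z w : `|complex.Im z - complex.Im w| <= cmod (z - w).
Proof. by apply: le_trans (ler_Im_cmod _); case: z => ? ?; case: w. Qed.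

Definition in_sq x y s w :=
  (x <= complex.Re w <= x + s) && (y <= complex.Im w <= y + s).

(* The imaginary part of the contour integral of f along the boundary of the
   square; applied to all multiples of f it captures the whole integral. *)
Definition oint f x y s : R :=
  intg x (x + s) (fun t => complex.Im (f (t +i* y)))
  - intg x (x + s) (fun t => complex.Im (f (t +i* (y + s))))
  + intg y (y + s) (fun t => complex.Re (f ((x + s) +i* t)))
  - intg y (y + s) (fun t => complex.Re (f (x +i* t))).

Definition on_sq x y s w :=
  in_sq x y s w && [|| complex.Re w == x, complex.Re w == x + s,
                       complex.Im w == y | complex.Im w == y + s].

Lemma cont_bottom f x y s : 0 <= s -> (forall w, on_sq x y s w -> ccont f w) ->
  cont_on x (x + s) (fun t => complex.Im (f (t +i* y))).
Proof.
move=> s0 cf; apply: (ccont_path (u := fun t => t +i* y)).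
- exact: cmod_horizontal.
- exact: lip_Im.
- by move=> t tx; apply: cf; rewrite /on_sq /in_sq /= tx lexx lerDl s0 eqxx !orbT.
Qed.

Lemma cont_top f x y s : 0 <= s -> (forall w, on_sq x y s w -> ccont f w) ->
  cont_on x (x + s) (fun t => complex.Im (f (t +i* (y + s)))).
Proof.
move=> s0 cf; apply: (ccont_path (u := fun t => t +i* (y + s))).
- exact: cmod_horizontal.
- exact: lip_Im.
- by move=> t tx; apply: cf; rewrite /on_sq /in_sq /= tx lexx lerDl s0 eqxx !orbT.
Qed.

Lemma cont_right f x y s : 0 <= s -> (forall w, on_sq x y s w -> ccont f w) ->
  cont_on y (y + s) (fun t => complex.Re (f ((x + s) +i* t))).
Proof.
move=> s0 cf; apply: (ccont_path (u := fun t => (x + s) +i* t)).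
- exact: cmod_vertical.
- exact: lip_Re.
- by move=> t tx; apply: cf; rewrite /on_sq /in_sq /= tx lexx lerDl s0 eqxx !orbT.
Qed.

Lemma cont_left f x y s : 0 <= s -> (forall w, on_sq x y s w -> ccont f w) ->
  cont_on y (y + s) (fun t => complex.Re (f (x +i* t))).
Proof.
move=> s0 cf; apply: (ccont_path (u := fun t => x +i* t)).
- exact: cmod_vertical.
- exact: lip_Re.
- by move=> t tx; apply: cf; rewrite /on_sq /in_sq /= tx lexx lerDl s0 eqxx.
Qed.

Lemma ointB f g x y s : 0 <= s ->
  (forall w, on_sq x y s w -> ccont f w) -> (forall w, on_sq x y s w -> ccont g w) ->
  oint (fun w => f w - g w) x y s = oint f x y s - oint g x y s.
Proof.
move=> s0 cf cg; rewrite /oint.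
have ReB (u v : C) : complex.Re (u - v) = complex.Re u - complex.Re v.
  by case: u => ? ?; case: v.
have ImB (u v : C) : complex.Im (u - v) = complex.Im u - complex.Im v.
  by case: u => ? ?; case: v.
under eq_intg do rewrite ImB.
under [X in _ - X + _ - _]eq_intg do rewrite ImB.
under [X in _ - _ + X - _]eq_intg do rewrite ReB.
under [X in _ - _ + _ - X]eq_intg do rewrite ReB.
rewrite (intgB (cont_bottom s0 cf) (cont_bottom s0 cg)).
rewrite (intgB (cont_top s0 cf) (cont_top s0 cg)).
rewrite (intgB (cont_right s0 cf) (cont_right s0 cg)).
by rewrite (intgB (cont_left s0 cf) (cont_left s0 cg)); lra.
Qed.

(** The first-order part of [f] at a point contributes nothing: the integrand is [- Re b * s] for
    bottom minus top and [Re b * s] for right minus left. *)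
Lemma oint_affine (a b : C) x y s : 0 <= s -> oint (fun w => a + b * w) x y s = 0.
Proof.
move=> s0; rewrite /oint; have cab w : on_sq x y s w -> ccont (fun w => a + b * w) w.
  by move=> _; exact: ccont_affine.
rewrite -(intgB (cont_bottom s0 cab) (cont_top s0 cab)) -addrA.
rewrite -(intgB (cont_right s0 cab) (cont_left s0 cab)).
have xs : x <= x + s by lra.
have ys : y <= y + s by lra.
rewrite (eq_intg (g := fun=> - complex.Re b * s)); last first.
  by move=> t _; case: a {cab} => a1 a2; case: b => b1 b2 /=; ring.
rewrite intg_cst //.
rewrite (eq_intg (g := fun=> complex.Re b * s)); last first.
  by move=> t _; case: a {cab} => a1 a2; case: b => b1 b2 /=; ring.
by rewrite intg_cst //; ring.
Qed.

Lemma oint_le f x y s M : 0 <= s -> (forall w, on_sq x y s w -> ccont f w) ->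
  (forall w, on_sq x y s w -> cmod (f w) <= M) -> `|oint f x y s| <= 4 * M * s.
Proof.
move=> s0 cf fM.
have bnd a (h : R -> R) : cont_on a (a + s) h ->
    (forall t, a <= t <= a + s -> `|h t| <= M) -> `|intg a (a + s) h| <= M * s.
  move=> ch hM; rewrite [X in _ * X](_ : s = a + s - a); last by ring.
  by apply: intg_norm => //; rewrite lerDl.
rewrite /oint.
set i1 := intg _ _ _; set i2 := intg _ _ _; set i3 := intg _ _ _; set i4 := intg _ _ _.
have b1 : `|i1| <= M * s.
  apply: bnd (cont_bottom s0 cf) _ => t tx.
  apply: le_trans (ler_Im_cmod _) (fM _ _).
  by rewrite /on_sq /in_sq /= tx lexx lerDl s0 eqxx !orbT.
have b2 : `|i2| <= M * s.
  apply: bnd (cont_top s0 cf) _ => t tx.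
  apply: le_trans (ler_Im_cmod _) (fM _ _).
  by rewrite /on_sq /in_sq /= tx lexx lerDl s0 eqxx !orbT.
have b3 : `|i3| <= M * s.
  apply: bnd (cont_right s0 cf) _ => t tx.
  apply: le_trans (ler_Re_cmod _) (fM _ _).
  by rewrite /on_sq /in_sq /= tx lexx lerDl s0 eqxx !orbT.
have b4 : `|i4| <= M * s.
  apply: bnd (cont_left s0 cf) _ => t tx.
  apply: le_trans (ler_Re_cmod _) (fM _ _).
  by rewrite /on_sq /in_sq /= tx lexx lerDl s0 eqxx.
move: b1 b2 b3 b4; rewrite !ler_norml => /andP[? ?] /andP[? ?] /andP[? ?] /andP[? ?].
by apply/andP; split; lra.
Qed.

Lemma on_sqW x y s w : on_sq x y s w -> in_sq x y s w.
Proof. by case/andP. Qed.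

Lemma oint_split f x y s : 0 <= s -> (forall w, in_sq x y (s + s) w -> ccont f w) ->
  oint f x y (s + s) = oint f x y s + oint f (x + s) y s
                      + oint f x (y + s) s + oint f (x + s) (y + s) s.
Proof.
move=> s0 cf.
have H yy : y <= yy <= y + (s + s) ->
    intg x (x + (s + s)) (fun t => complex.Im (f (t +i* yy))) =
    intg x (x + s) (fun t => complex.Im (f (t +i* yy)))
    + intg (x + s) (x + s + s) (fun t => complex.Im (f (t +i* yy))).
  move=> yyy; rewrite addrA -intg_split //; rewrite ?lerDl //.
  apply: (ccont_path (u := fun t => t +i* yy)).
  - exact: cmod_horizontal.
  - exact: lip_Im.
  - by move=> t tx; apply: cf; rewrite /in_sq /= addrA tx yyy.
have V xx : x <= xx <= x + (s + s) ->
    intg y (y + (s + s)) (fun t => complex.Re (f (xx +i* t))) =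
    intg y (y + s) (fun t => complex.Re (f (xx +i* t)))
    + intg (y + s) (y + s + s) (fun t => complex.Re (f (xx +i* t))).
  move=> xxx; rewrite addrA -intg_split //; rewrite ?lerDl //.
  apply: (ccont_path (u := fun t => xx +i* t)).
  - exact: cmod_vertical.
  - exact: lip_Re.
  - by move=> t tx; apply: cf; rewrite /in_sq /= (addrA y) tx xxx.
(* Only the outer sides are split; each inner side occurs twice with opposite signs. *)
rewrite /oint !H ?V; try (apply/andP; split; lra).
by rewrite !addrA; ring.
Qed.

Lemma pow2_small s r : 0 < s -> 0 < r -> exists n, s / 2 ^+ n < r.
Proof.
move=> s0 r0; have sr : 0 <= s / r by rewrite ltW // divr_gt0.
exists (Num.bound (s / r)); rewrite ltr_pdivrMr ?exprn_gt0 //.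
rewrite mulrC -ltr_pdivrMr // (lt_le_trans (archi_boundP sr)) //.
by rewrite -natrX ler_nat ltnW // ltn_expl.
Qed.

Theorem goursat f x y s : 0 < s -> (forall w, in_sq x y s w -> cdiff f w) ->
  oint f x y s = 0.
Proof.
move=> s0 fd; apply: contrapT => /eqP; rewrite -normr_gt0 => I0.
pose e := `|oint f x y s| / s ^+ 2.
have e0 : 0 < e by rewrite divr_gt0 ?exprn_gt0.
(* A square is [bad] if its integral is at least [e] times its area, as for the initial one. The
   four integrals add up, so if three quarters are not bad the last one is, and [step] may take it
   by default. *)
pose bad (p : R * R) h := e * h ^+ 2 <= `|oint f p.1 p.2 h|.
pose step (p : R * R) h :=
  if bad p h then p else if bad (p.1 + h, p.2) h then (p.1 + h, p.2)
  else if bad (p.1, p.2 + h) h then (p.1, p.2 + h) else (p.1 + h, p.2 + h).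
pose h n := s / 2 ^+ n.
have h0 n : 0 < h n by rewrite divr_gt0 ?exprn_gt0.
have hS n : h n = h n.+1 + h n.+1.
  have := exprn_gt0 n (ltr0n R 2); rewrite /h exprS => p0.
  by field; lra.
pose p := fix p n := if n is m.+1 then step (p m) (h m.+1) else (x, y).
have pS n : [/\ (p n).1 <= (p n.+1).1, (p n.+1).1 <= (p n).1 + h n.+1,
    (p n).2 <= (p n.+1).2 & (p n.+1).2 <= (p n).2 + h n.+1].
  have := h0 n.+1.
  by rewrite /= /step; case: ifP => _; [|case: ifP => _; [|case: ifP => _]] => /=; split; lra.
have pin n w : in_sq (p n).1 (p n).2 (h n) w -> in_sq x y s w.
  elim: n w => [|n IH] w; first by rewrite /h expr0 ?divr1.
  move=> /andP[/andP[? ?] /andP[? ?]]; apply: IH.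
  have := hS n; have [? ? ? ?] := pS n => ?.
  by rewrite /in_sq; apply/andP; split; apply/andP; split; lra.
have pbad n : bad (p n) (h n).
  elim: n => [|n IH]; first by rewrite /bad /h expr0 divr1 /e divfK // expf_neq0 // gt_eqF.
  have /= spl := @oint_split f (p n).1 (p n).2 (h n.+1) (ltW (h0 _)).
  rewrite /= /step; case: ifPn => // b1; case: ifPn => // b2; case: ifPn => // b3.
  apply: contraT => b4; move: b1 b2 b3 b4 IH; rewrite /bad /= -!ltNge (hS n) spl; last first.
    by rewrite -(hS n) => w /pin/fd/cdiff_ccont.
  set o1 := oint _ _ _ _; set o2 := oint _ _ _ _; set o3 := oint _ _ _ _.
  set o4 := oint _ _ _ _ => b1 b2 b3 b4.
  have := ler_normD (o1 + o2 + o3) o4; have := ler_normD (o1 + o2) o3.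
  by have := ler_normD o1 o2; lra.
have mono n m : (n <= m)%N -> [/\ (p n).1 <= (p m).1, (p m).1 + h m <= (p n).1 + h n,
    (p n).2 <= (p m).2 & (p m).2 + h m <= (p n).2 + h n].
  elim: m => [|m IH]; first by rewrite leqn0 => /eqP ->.
  rewrite leq_eqVlt => /predU1P[<- //|]; rewrite ltnS => /IH[? ? ? ?].
  by have [? ? ? ?] := pS m; have := hS m; split; lra.
have cross n m : (p n).1 <= (p m).1 + h m /\ (p n).2 <= (p m).2 + h m.
  have [nm|/ltnW mn] := leqP n m.
    by have [? ? ? ?] := mono _ _ nm; have := h0 m; lra.
  by have [? ? ? ?] := mono _ _ mn; have := h0 n; lra.
(* By [cross] the corners are bounded, and their suprema give a point common to all squares. *)
pose X := sup (range (fun n => (p n).1)); pose Y := sup (range (fun n => (p n).2)).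
have supX n : (p n).1 <= X <= (p n).1 + h n.
  apply/andP; split.
    apply: ub_le_sup; last by exists n.
    by exists ((p 0%N).1 + h 0%N) => _ [m _ <-]; case: (cross m 0%N).
  apply: ge_sup; first by exists (p 0%N).1, 0%N.
  by move=> _ [m _ <-]; case: (cross m n).
have supY n : (p n).2 <= Y <= (p n).2 + h n.
  apply/andP; split.
    apply: ub_le_sup; last by exists n.
    by exists ((p 0%N).2 + h 0%N) => _ [m _ <-]; case: (cross m 0%N).
  apply: ge_sup; first by exists (p 0%N).2, 0%N.
  by move=> _ [m _ <-]; case: (cross m n).
pose z := X +i* Y.
have zin n : in_sq (p n).1 (p n).2 (h n) z by rewrite /in_sq /= supX supY.
have [d fz] := fd _ (pin _ _ (zin 0%N)).
(* With four sides of length [h n] and [|w - z| <= 2 * h n], the factor [e / 16] bounds the integral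
   by [e / 2 * h n ^+ 2], half of what [bad] demands. *)
have e160 : 0 < e / 16 by lra.
have {fz}[r r0 fz] := fz _ e160.
have [n hn] := pow2_small s0 (divr_gt0 r0 (ltr0n _ 2)); rewrite -/(h n) in hn.
pose g w := (f z - d * z) + d * w.
have cf w : on_sq (p n).1 (p n).2 (h n) w -> ccont f w.
  by move=> /on_sqW/pin/fd/cdiff_ccont.
have cg w : on_sq (p n).1 (p n).2 (h n) w -> ccont g w by move=> _; exact: ccont_affine.
have := ointB (ltW (h0 n)) cf cg; rewrite oint_affine ?(ltW (h0 n)) // subr0 => E.
have := pbad n; rewrite /bad -E => B.
have : `|oint (fun w => f w - g w) (p n).1 (p n).2 (h n)| <= 4 * (e / 16 * (2 * h n)) * h n.
  apply: oint_le => [|w won|w won]; first exact: ltW.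
    by apply: ccontB; [exact: cf|exact: cg].
  have wz : cmod (w - z) <= 2 * h n.
    apply: le_trans (cmod_le_ReIm _) _.
    move: (on_sqW won) (zin n); rewrite /in_sq; case: (w) => a b /=.
    move=> /andP[/andP[? ?] /andP[? ?]] /andP[/andP[? ?] /andP[? ?]].
    have : `|a - X| <= h n by rewrite ler_norml; apply/andP; split; lra.
    have : `|b - Y| <= h n by rewrite ler_norml; apply/andP; split; lra.
    by lra.
  rewrite /g (_ : f w - _ = f w - f z - d * (w - z)); last by ring.
  apply: le_trans (fz w _) _; first by lra.
  by apply: ler_wpM2l wz; lra.
have : 0 < e * h n ^+ 2 by rewrite mulr_gt0 ?exprn_gt0.
by lra.
Qed.

End Goursat.

(** * [cdiff] and the derivative of the normed module structure *)

Section ComplexDerivative.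
Variable R : realType.
Local Notation C := R[i].

Lemma gt0_complexE (e : C) : 0 < e -> 0 < complex.Re e /\ e = (complex.Re e)%:C.
Proof. by case: e => a b; rewrite ltcE /= => /andP[/eqP -> ->]. Qed.

Lemma cmod_lt (z : C) (e : R) : (`|z| < e%:C) = (cmod z < e).
Proof. by rewrite normc_cmod ltcR. Qed.

Lemma cmod_le (z : C) (e : R) : (`|z| <= e%:C) = (cmod z <= e).
Proof. by rewrite normc_cmod lecR. Qed.

Lemma derivable_cdiff (f : C -> C) (z : C) :
  derivable (f : C^o -> C^o) z 1 <-> cdiff f z.
Proof.
split=> [/cvg_ex[/= d fd]|[d fd]].
  exists d => e e0; have e0' : 0 < e%:C :> C by rewrite ltcR.
  move/cvgrPdist_le : fd => /(_ _ e0').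
  move=> /nbhs_ballP[r /= /gt0_complexE[r0 ->] fr].
  exists (complex.Re r) => // w wr.
  have [->|wz] := eqVneq w z; first by rewrite !subrr mulr0 subrr cmod0 mulr0.
  have wz0 : w - z != 0 by rewrite subr_eq0.
  have := fr (w - z); rewrite /ball /= sub0r normrN cmod_lt => /(_ wr wz0).
  rewrite /= cmod_le /GRing.scale /= mulr1 subrK => H.
  have -> : f w - f z - d * (w - z) = - ((w - z) * (d - (w - z)^-1 * (f w - f z))).
    by field.
  by rewrite cmodN cmodM mulrC ler_wpM2r ?cmod_ge0.
apply/cvg_ex; exists d => /=; apply/cvgrPdist_le => e /gt0_complexE[e0 ->].
have [r r0 fr] := fd _ e0.
apply/nbhs_ballP; exists r%:C => /=; first by rewrite ltcR.
move=> h; rewrite /ball /= sub0r normrN cmod_lt => hr h0.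
rewrite cmod_le /GRing.scale /= mulr1.
have := fr (h + z); rewrite addrK => /(_ hr) H.
have E : f (h + z) - f z - d * h = - ((d - h^-1 * (f (h + z) - f z)) * h) by field.
by move: H; rewrite E cmodN cmodM ler_pM2r ?cmod_gt0.
Qed.

Lemma derivable_entries m n (F : C -> 'M[C]_(m, n)) (z : C) :
  derivable (F : C^o -> 'M[C^o]_(m, n)) z 1 <->
  forall i j, cdiff (fun w => F w i j) z.
Proof.
split=> [/cvg_ex[/= d Fd] i j|Fd].
  apply/derivable_cdiff/cvg_ex; exists (d i j).
  have := cvg_comp _ _ Fd (@coord_continuous C^o m n i j d).
  by apply: cvg_trans; apply: near_eq_cvg; near=> h; rewrite /= !mxE.
have {}Fd i j : derivable (fun w : C^o => F w i j : C^o) z 1.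
  by apply/derivable_cdiff; exact: Fd.
apply/cvg_ex; exists (\matrix_(i, j) sval (cid ((cvg_ex _).1 (Fd i j)))).
apply/cvg_ballP => e e0; near=> h; split=> // i j.
rewrite !mxE /=; move: i j.
(* A single index ranging over pairs lets [filter_forall] treat all entries at once. *)
suff: forall k : 'I_m * 'I_n, ball (sval (cid ((cvg_ex _).1 (Fd k.1 k.2)))) e
    (h^-1 *: (F (h *: 1 + z) k.1 k.2 - F z k.1 k.2) : C^o) by move=> H i j; exact: (H (i, j)).
near: h; apply: filter_forall => /= k.
exact: ((cvg_ballP _ _).1 (svalP (cid ((cvg_ex _).1 (Fd k.1 k.2))))).
Unshelve. all: by end_near.
Qed.

End ComplexDerivative.

(** * Calculus of complex differentiable functions *)

Section CdiffAlgebra.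
Variable R : realType.
Local Notation C := R[i].
Implicit Types (f g : C -> C) (z w : C).

Lemma cdiff_cst (a : C) z : cdiff (fun=> a) z.
Proof. by apply/derivable_cdiff; exact: derivable_cst. Qed.

Lemma cdiff_id z : cdiff id z.
Proof. by apply/derivable_cdiff; exact: derivable_id. Qed.

Lemma cdiffD f g z : cdiff f z -> cdiff g z -> cdiff (fun w => f w + g w) z.
Proof.
move=> /derivable_cdiff df /derivable_cdiff dg; apply/derivable_cdiff.
exact: derivableD.
Qed.

Lemma cdiffN f z : cdiff f z -> cdiff (fun w => - f w) z.
Proof.
by move=> /derivable_cdiff df; apply/derivable_cdiff; exact: derivableN.
Qed.

Lemma cdiffB f g z : cdiff f z -> cdiff g z -> cdiff (fun w => f w - g w) z.
Proof. by move=> df dg; apply: cdiffD => //; exact: cdiffN. Qed.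

Lemma cdiffM f g z : cdiff f z -> cdiff g z -> cdiff (fun w => f w * g w) z.
Proof.
move=> /derivable_cdiff df /derivable_cdiff dg; apply/derivable_cdiff.
exact: (@derivableM C C^o f g z 1 df dg).
Qed.

Lemma cdiffX f n z : cdiff f z -> cdiff (fun w => f w ^+ n) z.
Proof.
move=> df; elim: n => [|n IH]; first exact: cdiff_cst.
by under eq_fun do rewrite exprS; exact: cdiffM.
Qed.

Lemma cdiffV f z : f z != 0 -> cdiff f z -> cdiff (fun w => (f w)^-1) z.
Proof.
move=> f0 /derivable_cdiff df; apply/derivable_cdiff.
exact: (@derivableV C C^o f z 1 f0 df).
Qed.

Lemma cdiff_div f g z : g z != 0 -> cdiff f z -> cdiff g z -> cdiff (fun w => f w / g w) z.
Proof. by move=> g0 df dg; apply: cdiffM => //; exact: cdiffV. Qed.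

Lemma cdiff_sum (I : Type) (r : seq I) (P : pred I) (F : I -> C -> C) z :
  (forall i, P i -> cdiff (F i) z) -> cdiff (fun w => \sum_(i <- r | P i) F i w) z.
Proof.
move=> dF; elim: r => [|i r IH].
  by under eq_fun do rewrite big_nil; exact: cdiff_cst.
under eq_fun do rewrite big_cons; case Pi: (P i) => //.
by apply: cdiffD => //; exact: dF.
Qed.

Lemma cdiff_comp f g z : cdiff g z -> cdiff f (g z) -> cdiff (fun w => f (g w)) z.
Proof.
move=> /derivable_cdiff/derivable1_diffP dg /derivable_cdiff/derivable1_diffP df.
apply/derivable_cdiff/derivable1_diffP.
exact: (@differentiable_comp C C^o C^o C^o g f z dg df).
Qed.

(* The value of the quotient at z0 is 0 because x / 0 = 0, and the difference
   quotient there is a power of that of a. *)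
Lemma cdiff_quotient (a : C -> C) (z0 z : C) k : cdiff a z -> a z0 = 0 ->
  cdiff (fun w => a w ^+ k.+2 / (w - z0) ^+ k.+1) z.
Proof.
move=> da a0; have [zz|zz0] := eqVneq z z0; last first.
  apply: cdiff_div; first by rewrite expf_neq0 // subr_eq0.
    exact: cdiffX.
  by apply/cdiffX/cdiffB; [exact: cdiff_id|exact: cdiff_cst].
rewrite -{}zz in a0 *; move: da => /derivable_cdiff/cvg_ex[/= d ad].
apply/derivable_cdiff/cvg_ex; exists (d ^+ k.+2) => /=.
have adX n : (fun h : C^o => (h^-1 *: (a (h *: 1 + z) - a z) : C^o) ^+ n) @ 0^' --> (d ^+ n : C^o).
  elim: n => [|n IH]; first by under eq_fun do rewrite expr0; exact: cvg_cst.
  by under eq_fun do rewrite exprS; rewrite exprS; exact: (@cvgM C C^o _ _ _ _ _ _ ad IH).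
apply: cvg_trans (adX k.+2); apply: near_eq_cvg; apply/nbhs_ballP; exists 1 => //= h _ h0.
rewrite /= subrr a0 !subr0 /GRing.scale /= mulr1 addrK expr0n mul0r subr0.
by rewrite exprMn exprVn (exprS h k.+1); field; rewrite expf_neq0 h0.
Qed.

End CdiffAlgebra.

(** * Maximum principle and Schwarz lemma *)

Section Schwarz.
Variable R : realType.
Local Notation C := R[i].
Implicit Types (f g : C -> C) (z w : C) (x y s e m : R).

Lemma expr_small (q e : R) : 0 <= q < 1 -> 0 < e -> exists n, q ^+ n < e.
Proof.
move=> /andP[q0 q1] e0; have qn : `|q| < 1 by rewrite ger0_norm.
have /cvgrPdist_lt/(_ _ e0)[n _ Hn] := cvg_expr qn.
exists n; have := Hn n (leqnn n).
by rewrite /= sub0r normrN ger0_norm ?exprn_ge0.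
Qed.

Lemma sqr_le (v s : R) : - s <= v -> v <= s -> v ^+ 2 <= s ^+ 2.
Proof. by move=> ? ?; nra. Qed.

(** The value is 2 pi, but its sign suffices. With [d] the distance from [w0] to the boundary, the
    integrand on each side is, up to orientation, a quantity at least [d] divided by
    [|w - w0|^2 <= 2 * s ^+ 2], so each side contributes at least [k * s]. *)
Lemma oint_inv_gt0 x y s (w0 : C) : 0 < s ->
  x < complex.Re w0 < x + s -> y < complex.Im w0 < y + s ->
  0 < oint (fun w => (w - w0)^-1) x y s.
Proof.
case: w0 => a b /= s0 /andP[xa ax] /andP[yb by_].
set f := fun w : C => _.
have cf w : on_sq x y s w -> ccont f w.
  move=> won; apply: cdiff_ccont; apply: cdiffV.
    rewrite subr_eq0; apply: contraTneq won => ->; rewrite /on_sq /=.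
    by rewrite !(gt_eqF xa, lt_eqF ax, gt_eqF yb, lt_eqF by_) andbF.
  by apply: cdiffB; [exact: cdiff_id|exact: cdiff_cst].
have fE (t u : R) : f (t +i* u) = ((t - a) / ((t - a) ^+ 2 + (u - b) ^+ 2))
    +i* (- ((u - b) / ((t - a) ^+ 2 + (u - b) ^+ 2))) by [].
pose d := Num.min (Num.min (a - x) (x + s - a)) (Num.min (b - y) (y + s - b)).
have d0 : 0 < d by rewrite !lt_min !subr_gt0 xa ax yb by_.
have [d1 d2 d3 d4] : [/\ d <= a - x, d <= x + s - a, d <= b - y & d <= y + s - b].
  by split; rewrite !ge_min lexx ?orbT.
pose k := d / (2 * s ^+ 2).
have k0 : 0 < k by rewrite divr_gt0 // mulr_gt0 ?exprn_gt0.
have key (p t u : R) : x <= t <= x + s -> y <= u <= y + s -> d <= p ->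
    0 < (t - a) ^+ 2 + (u - b) ^+ 2 -> k <= p / ((t - a) ^+ 2 + (u - b) ^+ 2).
  move=> /andP[? ?] /andP[? ?] dp q0; rewrite ler_pdivlMr //.
  have q2 : (t - a) ^+ 2 + (u - b) ^+ 2 <= 2 * s ^+ 2.
    have : (t - a) ^+ 2 <= s ^+ 2.
      by apply: sqr_le; lra.
    have : (u - b) ^+ 2 <= s ^+ 2.
      by apply: sqr_le; lra.
    by lra.
  apply: le_trans dp; apply: (le_trans (ler_wpM2l (ltW k0) q2)).
  by rewrite /k divfK // gt_eqF // mulr_gt0 ?exprn_gt0.
have pos (t u v : R) : v != 0 -> v = t - a \/ v = u - b -> 0 < (t - a) ^+ 2 + (u - b) ^+ 2.
  move=> v0 vE; have v2 : 0 < v ^+ 2 by rewrite exprn_even_gt0.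
  by have := sqr_ge0 (t - a); have := sqr_ge0 (u - b); case: vE v2 => ->; lra.
have sE (p : R) : s = p + s - p by ring.
have xs : x <= x + s by lra.
have ys : y <= y + s by lra.
rewrite /oint.
have I1 : k * s <= intg x (x + s) (fun t => complex.Im (f (t +i* y))).
  rewrite [X in _ * X](sE x); apply: intg_ge (cont_bottom (ltW s0) cf) _ => // t tx.
  rewrite fE /= -mulNr; apply: key => //; [by rewrite lexx|by lra|].
  by apply: (pos _ _ (y - b)); [rewrite subr_eq0 lt_eqF|right].
have I2 : intg x (x + s) (fun t => complex.Im (f (t +i* (y + s)))) <= - (k * s).
  rewrite -mulNr [X in _ * X](sE x) -intg_cst //.
  apply: intg_le (cont_top (ltW s0) cf) _ _ => [|t tx]; first exact: cont_on_cst.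
  rewrite fE /= lerN2; apply: key => //; [by rewrite lexx ys|].
  by apply: (pos _ _ (y + s - b)); [rewrite subr_eq0 gt_eqF|right].
have I3 : k * s <= intg y (y + s) (fun t => complex.Re (f ((x + s) +i* t))).
  rewrite [X in _ * X](sE y); apply: intg_ge (cont_right (ltW s0) cf) _ => // t tx.
  rewrite fE /=; apply: key => //; [by rewrite lexx xs|].
  by apply: (pos _ _ (x + s - a)); [rewrite subr_eq0 gt_eqF|left].
have I4 : intg y (y + s) (fun t => complex.Re (f (x +i* t))) <= - (k * s).
  rewrite -mulNr [X in _ * X](sE y) -intg_cst //.
  apply: intg_le (cont_left (ltW s0) cf) _ _ => [|t tx]; first exact: cont_on_cst.
  rewrite fE /= lerNr -mulNr; apply: key => //; [by rewrite lexx|by lra|].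
  by apply: (pos _ _ (x - a)); [rewrite subr_eq0 lt_eqF|left].
by have := mulr_gt0 k0 s0; lra.
Qed.

(* If |f(w0)| > m, normalise f(w0) = 1 and integrate (f^N - 1)^2 / (w - w0),
   which is holomorphic, around the square: as N grows, Goursat forces the
   integral of 1 / (w - w0) to vanish. *)
Lemma max_modulus_square f x y s (w0 : C) m : 0 < s ->
  x < complex.Re w0 < x + s -> y < complex.Im w0 < y + s ->
  (forall w, in_sq x y s w -> cdiff f w) ->
  (forall w, on_sq x y s w -> cmod (f w) <= m) -> cmod (f w0) <= m.
Proof.
move=> s0 xw0 yw0 df fm; rewrite leNgt; apply/negP => mf.
have m0 : 0 <= m.
  apply: le_trans (cmod_ge0 _) (fm (x +i* y) _).
  by rewrite /on_sq /in_sq /= !lexx !lerDl !ltW // eqxx.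
have A0 : 0 < cmod (f w0) by lra.
have fw0 : f w0 != 0 by rewrite -cmod_gt0.
have I0 := oint_inv_gt0 s0 xw0 yw0; set I := oint _ _ _ _ in I0.
pose v w := f w / f w0; pose q := m / cmod (f w0).
have dv w : in_sq x y s w -> cdiff v w.
  by move=> /df dfw; apply: cdiffM => //; exact: cdiff_cst.
have q1 : 0 <= q < 1 by rewrite divr_ge0 ?(ltW A0) //= ltr_pdivrMr // mul1r.
have vq w : on_sq x y s w -> cmod (v w) <= q.
  by move=> /fm fwm; rewrite cmodM cmodV ler_pM2r ?invr_gt0.
pose d := Num.min (Num.min (complex.Re w0 - x) (x + s - complex.Re w0))
                  (Num.min (complex.Im w0 - y) (y + s - complex.Im w0)).
have d0 : 0 < d.
  by case/andP: xw0 => ? ?; case/andP: yw0 => ? ?; rewrite !lt_min;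
    do ?(apply/andP; split); lra.
have dw w : on_sq x y s w -> d <= cmod (w - w0).
  move=> /andP[_ won].
  have [d1 d2 d3 d4] : [/\ d <= complex.Re w0 - x, d <= x + s - complex.Re w0,
      d <= complex.Im w0 - y & d <= y + s - complex.Im w0].
    by split; rewrite !ge_min lexx ?orbT.
  have := lip_Re w w0; have := lip_Im w w0; rewrite !ler_norml.
  by move=> /andP[? ?] /andP[? ?]; case/or4P: won => /eqP ?; lra.
(* Here 12 is 4 sides times 3, from [|2 v^N - v^(2N)| <= 3 q^N] on the boundary. *)
have [N HN] := expr_small q1 (divr_gt0 (mulr_gt0 I0 d0) (mulr_gt0 (ltr0n R 12) s0)).
pose g w := (2 * v w ^+ N - v w ^+ N ^+ 2) * (w - w0)^-1.
have cinv w : on_sq x y s w -> ccont (fun w => (w - w0)^-1) w.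
  move=> /dw dw_; apply: cdiff_ccont; apply: cdiffV.
    by rewrite -cmod_gt0; lra.
  by apply: cdiffB; [exact: cdiff_id|exact: cdiff_cst].
have cg w : on_sq x y s w -> ccont g w.
  move=> won; have /dv dvw := on_sqW won; apply: cdiff_ccont; apply: cdiffM.
    apply: cdiffB; last by do 2 apply: cdiffX.
    by apply: cdiffM; [exact: cdiff_cst|exact: cdiffX].
  apply: cdiffV; first by rewrite -cmod_gt0; have := dw _ won; lra.
  by apply: cdiffB; [exact: cdiff_id|exact: cdiff_cst].
have := ointB (ltW s0) cinv cg.
have -> : (fun w => (w - w0)^-1 - g w) =
    fun w => (v w ^+ N - 1) ^+ 2 / (w - w0) ^+ 1.
  by apply/funext => w; rewrite /g expr1; ring.
rewrite goursat //; last first.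
  move=> w /dv dvw; apply: cdiff_quotient.
    by apply: cdiffB; [exact: cdiffX|exact: cdiff_cst].
  by rewrite /v divff // expr1n subrr.
rewrite -/I => /eqP; rewrite eq_sym subr_eq0 => /eqP Ig.
have : `|oint g x y s| <= 4 * (3 * q ^+ N / d) * s.
  apply: oint_le => // [|w won]; first exact: ltW.
  rewrite cmodM cmodV; apply: ler_pM; rewrite ?invr_ge0 ?cmod_ge0 //; last first.
    by rewrite lef_pV2 ?posrE ?dw //; have := dw _ won; lra.
  apply: le_trans (cmodB _ _) _; rewrite cmodM !cmodX cmod_nat.
  have vN0 := exprn_ge0 N (cmod_ge0 (v w)).
  have : cmod (v w) ^+ N <= q ^+ N by rewrite lerXn2r ?nnegrE ?cmod_ge0 ?vq //; case/andP: q1.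
  have : cmod (v w) ^+ N <= 1.
    by apply: exprn_ile1; rewrite ?cmod_ge0 //; have := vq _ won; case/andP: q1; lra.
  by nra.
rewrite -Ig gtr0_norm // leNgt => /negP; apply.
rewrite ltr_pdivlMr in HN; last by rewrite mulr_gt0.
rewrite (_ : 4 * _ * s = q ^+ N * (12 * s) / d); last by ring.
by rewrite ltr_pdivrMr.
Qed.

(** The second part measures the distance to the unit circle: [1 - |c|^2 = 4 Im w / |w + i|^2] is
    small near the real axis and far from the origin, hence on the boundary of large squares. *)
Lemma cayley_cmod (w : C) : 0 < complex.Im w ->
  cmod ((w - 'i) / (w + 'i)) < 1 /\
  (1 - cmod ((w - 'i) / (w + 'i)) ^+ 2) * cmod (w + 'i) ^+ 2 = 4 * complex.Im w.
Proof.
move=> w0.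
have wi : 0 < cmod (w + 'i) ^+ 2.
  rewrite sqr_cmod; case: w w0 => a b /= b0.
  by rewrite ltr_wpDl ?sqr_ge0 // exprn_gt0 // addr_gt0.
have E : (1 - cmod ((w - 'i) / (w + 'i)) ^+ 2) * cmod (w + 'i) ^+ 2 = 4 * complex.Im w.
  rewrite cmodM cmodV exprMn exprVn mulrBl mul1r divfK ?gt_eqF //.
  by rewrite !sqr_cmod; case: w {w0 wi} => a b /=; ring.
split=> //; rewrite -(@expr_lt1 _ 2) ?cmod_ge0 // -subr_gt0.
by rewrite -(pmulr_lgt0 _ wi) E mulr_gt0.
Qed.

(* For f holomorphic on the disc with f(0) = 0, apply the maximum principle to
   u = f^(k+2) / z^(k+1), which has no singularity at 0 and satisfies
   |u| <= |z|^-(k+1), on squares which exhaust the upper half plane. *)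
Theorem schwarz f (z0 : C) : (forall z, disc z -> cdiff f z) ->
  (forall z, disc z -> cmod (f z) <= 1) -> f 0 = 0 -> disc z0 ->
  cmod (f z0) <= cmod z0.
Proof.
move=> df f1 f0 z01; rewrite leNgt; apply/negP => fz.
have [z00|z00] := eqVneq z0 0; first by move: fz; rewrite z00 f0 ltxx.
have Z0 : 0 < cmod z0 by rewrite cmod_gt0.
have F0 : 0 < cmod (f z0) by lra.
(* This inequality is [1 < |u z0|] in disguise. Exponent 0 is excluded because [|f z0| <= 1]. *)
have [k Hk] : exists k, (cmod z0 / cmod (f z0)) ^+ k.+1 < cmod (f z0).
  have [|n] := @expr_small (cmod z0 / cmod (f z0)) _ _ F0.
    by rewrite divr_ge0 ?cmod_ge0 //= ltr_pdivrMr // mul1r.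
  case: n => [|n Hn]; last by exists n.
  by rewrite expr0 ltNge f1.
pose u z := f z ^+ k.+2 / (z - 0) ^+ k.+1; pose M := cmod (u z0).
have M1 : 1 < M.
  rewrite /M /u subr0 cmodM cmodV !cmodX exprS -mulrA -expr_div_n.
  rewrite expr_div_n ltr_pdivrMr ?exprn_gt0 // in Hk.
  rewrite expr_div_n mulrA ltr_pdivlMr ?exprn_gt0 // mul1r.
  by [].
have du z : disc z -> cdiff u z by move=> /df dfz; exact: cdiff_quotient.
(* Then [1 - (k+1) eta = M^-1 + eta], so the bound [(1 - (k+1) eta)^-1] coming from the boundary
   lies below [M]. *)
pose eta := (1 - M^-1) / k.+2%:R.
have Mi : 0 < M^-1 < 1 by rewrite invr_gt0 invf_lt1 ?M1 //; lra.
have k2 : (0 : R) < k.+2%:R by rewrite ltr0n.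
have eta0 : 0 < eta by rewrite divr_gt0 //; lra.
have etak : k.+2%:R * eta = 1 - M^-1 by rewrite /eta mulrC divfK // gt_eqF.
pose c w := (w - 'i) / (w + 'i) : C.
pose w0 := 'i * (1 + z0) / (1 - z0) : C.
have z1 : 1 - z0 != 0 by rewrite -cmod_gt0; have := cmodB_ge 1 z0; rewrite cmod1;
  move: z01; rewrite /disc /=; lra.
have i2 : 'i ^+ 2 = -1 :> C := sqr_i R.
have i0 : 'i != 0 :> C by rewrite eq_complex /= oner_eq0 andbF.
have w0i : w0 + 'i = 'i * 2 / (1 - z0) by rewrite /w0; field.
have cw0 : c w0 = z0.
  rewrite /c w0i (_ : w0 - 'i = 'i * 2 * z0 / (1 - z0)); last by rewrite /w0; field.
  by field; rewrite z1 i0.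
have Iw0 : 0 < complex.Im w0.
  have -> : complex.Im w0 = (1 - cmod z0 ^+ 2) / cmod (1 - z0) ^+ 2.
    by rewrite !sqr_cmod /w0; case: (z0) => a b /=; ring.
  by rewrite divr_gt0 ?exprn_gt0 ?cmod_gt0 // subr_gt0 expr_lt1 ?cmod_ge0.
(* [L] and [ep] ensure [4 Im w <= eta |w + i|^2] on the boundary: on the bottom side
   [Im w = ep <= eta / 4], and on the other three [|w| >= L] with [12 <= L * eta]. *)
pose L := 12 / eta + `|complex.Re w0| + complex.Im w0 + 1.
pose ep := Num.min (eta / 4) (complex.Im w0 / 2).
have ep0 : 0 < ep by rewrite lt_min; apply/andP; split; lra.
have ep1 : ep <= eta / 4 by rewrite ge_min lexx.
have ep2 : ep <= complex.Im w0 / 2 by rewrite ge_min lexx orbT.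
have R0 := normr_ge0 (complex.Re w0).
have eta12 : 0 < 12 / eta by rewrite divr_gt0.
have L12 : 12 <= L * eta.
  rewrite -ler_pdivrMr // /L; lra.
have L0 : 1 <= L by rewrite /L; lra.
have LR : `|complex.Re w0| < L by rewrite /L; lra.
have LI : complex.Im w0 < L by rewrite /L; lra.
clearbody L ep w0.
have cD w : in_sq (- L) ep (L + L) w -> 0 < complex.Im w.
  by move=> /andP[_ /andP[? _]]; lra.
have : cmod (u (c w0)) <= (1 - k.+1%:R * eta)^-1.
  apply: (@max_modulus_square (fun w => u (c w)) (- L) ep (L + L)).
  - lra.
  - by move: LR; rewrite ltr_norml => /andP[? ?]; apply/andP; split; lra.
  - by apply/andP; split; lra.
  - move=> w /cD Iw; have [cw _] := cayley_cmod Iw; apply: cdiff_comp; last exact: du.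
    apply: cdiff_div.
    + apply/eqP => /(congr1 (@complex.Im R)); case: (w) Iw => a b /= b0 b1.
      by have := addr_gt0 b0 (@ltr01 R); rewrite b1 ltxx.
    + by apply: cdiffB; [exact: cdiff_id|exact: cdiff_cst].
    + by apply: cdiffD; [exact: cdiff_id|exact: cdiff_cst].
  - move=> w won; have Iw := cD _ (on_sqW won); have [cw E] := cayley_cmod Iw.
    have W0 : 0 < cmod (w + 'i) ^+ 2.
      by rewrite lt_neqAle sqr_ge0 andbT eq_sym; apply/eqP => W; move: E; rewrite W; lra.
    have small : 4 * complex.Im w <= eta * cmod (w + 'i) ^+ 2.
      rewrite sqr_cmod; move: won Iw; case: (w) => a b; rewrite /on_sq /in_sq /= addr0.
      move=> /andP[/andP[/andP[? ?] /andP[? ?]] won] b0.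
      have a2 := sqr_ge0 a.
      have : 4 * b <= eta * a ^+ 2 \/ 4 * b <= eta * (b + 1) ^+ 2.
        case/or4P: won => /eqP wE.
        + left; rewrite wE sqrrN.
          have : 12 * L <= eta * L ^+ 2 by nra.
          by have : b <= 3 * L; lra.
        + left; rewrite wE (_ : - L + (L + L) = L); last by ring.
          have : 12 * L <= eta * L ^+ 2 by nra.
          by have : b <= 3 * L; lra.
        + right; have : eta <= eta * (b + 1) ^+ 2 by nra.
          by rewrite wE; lra.
        + right; have bL : L <= b by lra.
          have : 12 <= b * eta by nra.
          nra.
      by have := sqr_ge0 (b + 1); nra.
    have {small} cw2 : 1 - eta <= cmod (c w) ^+ 2.
      by rewrite -(ler_pM2r W0) /c; lra.
    have cw0' : 0 < 1 - k.+1%:R * eta.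
      by have := etak; rewrite -(addn1 k.+1) natrD; lra.
    have eta1 : eta < 1.
      by move: cw0'; rewrite -(addn1 k) natrD; have := ler0n R k; nra.
    have cpos : 0 < cmod (c w).
      rewrite cmod_gt0; apply/eqP => cw00; move: cw2.
      by rewrite cw00 cmod0 expr0n /=; lra.
    rewrite /u subr0 cmodM cmodV cmodX cmodX -[leRHS]mul1r.
    apply: ler_pM; rewrite ?exprn_ge0 ?cmod_ge0 ?invr_ge0 ?exprn_ge0 ?cmod_ge0 //.
      by apply: exprn_ile1; rewrite ?cmod_ge0 ?f1.
    rewrite lef_pV2 ?posrE ?exprn_gt0 //.
    have cle : cmod (c w) ^+ 2 <= cmod (c w) by rewrite expr2 ler_piMr ?cmod_ge0 // ltW.
    have : 1 - eta <= cmod (c w) by lra.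
    (* Bernoulli's inequality, carried out with [cmod (c w)] in place of [1 - eta]. *)
    elim: (k.+1) => [|n IH cle1]; first by rewrite mul0r subr0 expr0.
    have := IH cle1; rewrite exprS -(addn1 n) natrD => H.
    have n0 := ler0n R n.
    have : (1 - eta) * (1 - n%:R * eta) <= cmod (c w) * cmod (c w) ^+ n.
      have : (1 - eta) * (1 - n%:R * eta) <= (1 - eta) * cmod (c w) ^+ n.
        by apply: ler_wpM2l => //; lra.
      have : (1 - eta) * cmod (c w) ^+ n <= cmod (c w) * cmod (c w) ^+ n.
        by apply: ler_wpM2r => //; rewrite exprn_ge0 ?cmod_ge0.
      lra.
    have : 0 <= n%:R * eta ^+ 2 by rewrite mulr_ge0 ?sqr_ge0.
    nra.
rewrite cw0 -/M leNgt => /negP; apply.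
rewrite -(invrK M) ltf_pV2 ?posrE.
- by have := etak; rewrite -(addn1 k.+1) natrD; lra.
- by have := etak; rewrite -(addn1 k.+1) natrD; lra.
- by lra.
Qed.

End Schwarz.

(** * The closed tetrablock *)

Section TetrablockReal.
Variable R : realType.
Implicit Types a b r d g h : R.

(* In terms of a point (x1, x2, x3): a, b, r are the moduli of its coordinates and
   d = |x1 x2 - x3|, g = |x2 - conj(x1) x3|, h = |x1 - conj(x2) x3|. *)
Lemma sqr_mono (u v : R) : 0 <= u -> u <= v -> u ^+ 2 <= v ^+ 2.
Proof. by move=> u0 uv; rewrite ler_sqr ?nnegrE //; lra. Qed.

(** These relations hold at every point of C^3, and the section is real algebra on them. The last
    one comes from [x3 (1 - |x2|^2) = x2 (x1 - x2^* x3) - (x1 x2 - x3)]. *)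
Record tet_data a b r d g h : Prop := TetData {
  tet_a0 : 0 <= a; tet_b0 : 0 <= b; tet_r0 : 0 <= r;
  tet_d0 : 0 <= d; tet_g0 : 0 <= g; tet_h0 : 0 <= h;
  tet_g : g ^+ 2 = (1 - a ^+ 2) * (b ^+ 2 - r ^+ 2) + d ^+ 2;
  tet_h : h ^+ 2 = (1 - b ^+ 2) * (a ^+ 2 - r ^+ 2) + d ^+ 2;
  tet_d1 : a * b - r <= d; tet_d2 : r - a * b <= d;
  tet_g1 : b - a * r <= g; tet_g2 : a * r - b <= g;
  tet_r : r * (1 - b ^+ 2) <= b * h + d }.

(** The normalized form of C9, taken as reference since it is symmetric in [a] and [b] and free of
    [g] and [h]. *)
Definition hub a b r d : Prop := r <= 1 /\ 2 * d <= 1 - a ^+ 2 - b ^+ 2 + r ^+ 2.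

Lemma sqr_leE (u v : R) : 0 <= v -> u ^+ 2 <= v ^+ 2 -> u <= v.
Proof.
move=> v0 uv; have [u0|u0] := leP 0 u; last by lra.
by rewrite -ler_sqr ?nnegrE.
Qed.

(** Inserting [|a b - r| <= d] into [hub] leaves [(a - b)^2 <= (1 - r)^2] and
    [(a + b)^2 <= (1 + r)^2]. *)
Lemma hub_triangle a b r d g h : tet_data a b r d g h -> hub a b r d ->
  [/\ a - b <= 1 - r, b - a <= 1 - r & a + b <= 1 + r].
Proof.
case=> a0 b0 r0 d0 g0 h0 _ _ d1 d2 _ _ _ [r1 K]; split.
- by apply: sqr_leE; [lra|nra].
- by apply: sqr_leE; [lra|nra].
- by apply: sqr_leE; [lra|nra].
Qed.

Lemma hub_le1 a b r d g h : tet_data a b r d g h -> hub a b r d -> a <= 1 /\ b <= 1.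
Proof. by move=> t u; have [? ? ?] := hub_triangle t u; split; lra. Qed.

(** These signs allow [hub_g] and [hub_h] to compare squares. *)
Lemma hub_sum_ge0 a b r d g h : tet_data a b r d g h -> hub a b r d ->
  0 <= 1 - a ^+ 2 + b ^+ 2 - r ^+ 2 /\ 0 <= 1 + a ^+ 2 - b ^+ 2 - r ^+ 2.
Proof.
move=> t u; have [t1 t2 t3] := hub_triangle t u; have [a1 b1] := hub_le1 t u.
case: t u => a0 b0 r0 d0 g0 h0 _ _ d1 d2 _ _ _ [r1 K].
split; [have [ab|ab] := leP a b|have [ab|ab] := leP b a].
- have : r ^+ 2 <= 1 by rewrite expr_le1.
  have : a ^+ 2 <= b ^+ 2 by apply: sqr_mono; lra.
  by lra.
- have : r ^+ 2 <= (1 - (a - b)) ^+ 2 by apply: sqr_mono; lra.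
  have : 0 <= (a - b) * (1 - a) by rewrite mulr_ge0 // ; lra.
  by lra.
- have : r ^+ 2 <= 1 by rewrite expr_le1.
  have : b ^+ 2 <= a ^+ 2 by apply: sqr_mono; lra.
  by lra.
- have : r ^+ 2 <= (1 - (b - a)) ^+ 2 by apply: sqr_mono; lra.
  have : 0 <= (b - a) * (1 - b) by rewrite mulr_ge0 // ; lra.
  by lra.
Qed.

(** By the formula for [g^2], the differences [(1 - a^2 + b^2 - r^2)^2 - 4 g^2] and
    [(1 - a^2 - b^2 + r^2)^2 - 4 d^2] are equal. *)
Lemma hub_g a b r d g h : tet_data a b r d g h -> hub a b r d ->
  2 * g <= 1 - a ^+ 2 + b ^+ 2 - r ^+ 2.
Proof.
move=> t u; have [P0 _] := hub_sum_ge0 t u; apply: sqr_leE => //.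
by case: t u => a0 b0 r0 d0 g0 h0 gE _ _ _ _ _ _ [r1 K]; rewrite exprMn gE; nra.
Qed.

Lemma hub_h a b r d g h : tet_data a b r d g h -> hub a b r d ->
  2 * h <= 1 + a ^+ 2 - b ^+ 2 - r ^+ 2.
Proof.
move=> t u; have [_ P0] := hub_sum_ge0 t u; apply: sqr_leE => //.
by case: t u => a0 b0 r0 d0 g0 h0 _ hE _ _ _ _ _ [r1 K]; rewrite exprMn hE; nra.
Qed.

(** The converse rests on the same equality of differences as [hub_g], which leaves the sign of
    [1 - a^2 - b^2 + r^2] to be determined. *)
Lemma c8_hub a b r d g h : tet_data a b r d g h -> b < 1 ->
  2 * g <= 1 - a ^+ 2 + b ^+ 2 - r ^+ 2 <-> hub a b r d.
Proof.
move=> t b1; split=> [P|]; last exact: hub_g t.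
case: t => a0 b0 r0 d0 g0 h0 gE hE d1 d2 g1 g2 _.
have Q1 : a - r <= 1 - b by apply: sqr_leE; [lra|nra].
have Q2 : r - a <= 1 - b by apply: sqr_leE; [lra|nra].
have Q3 : a + r <= 1 + b by apply: sqr_leE; [lra|nra].
have r1 : r <= 1 by lra.
split=> //.
have S : (2 * d) ^+ 2 <= (1 - a ^+ 2 - b ^+ 2 + r ^+ 2) ^+ 2.
  have : (2 * g) ^+ 2 <= (1 - a ^+ 2 + b ^+ 2 - r ^+ 2) ^+ 2 by apply: sqr_mono; lra.
  by rewrite exprMn gE; nra.
have [K0|K0] := leP 0 (1 - a ^+ 2 - b ^+ 2 + r ^+ 2); first exact: sqr_leE.
(* A negative sign gives [r < b] and [1 - r <= |a - b|], against [b < 1] if [a <= b] and against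
   [Q1] otherwise. *)
exfalso.
have S' : 2 * d <= - (1 - a ^+ 2 - b ^+ 2 + r ^+ 2) by apply: sqr_leE; lra.
have br : r < b.
  by rewrite -(@ltr_pXn2r _ 2) ?nnegrE //; lra.
have [ab|ab] := leP a b.
  have H : 1 - r <= b - a.
    by apply: sqr_leE; [lra|nra].
  have : r < a by rewrite -(@ltr_pXn2r _ 2) ?nnegrE //; nra.
  by lra.
have H : 1 - r <= a - b by apply: sqr_leE; [lra|nra].
by lra.
Qed.

(** Squaring [h <= 1 - b^2 - d] and inserting the formula for [h^2] leaves [hub] times the positive
    factor [1 - b^2]. Conversely, add [hub_h] to the bound on [2 * d]. *)
Lemma c6_hub a b r d g h : tet_data a b r d g h -> b < 1 ->
  h + d <= 1 - b ^+ 2 <-> hub a b r d.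
Proof.
move=> t b1; split=> [P|u].
  case: t => a0 b0 r0 d0 g0 h0 gE hE d1 d2 g1 g2 rE.
  have b2 : 0 < 1 - b ^+ 2 by rewrite subr_gt0 expr_lt1.
  split.
    rewrite -(ler_pM2r b2) mul1r; apply: le_trans rE (le_trans _ P).
    by rewrite lerD2r ler_piMl // ltW.
  have H : h ^+ 2 <= (1 - b ^+ 2 - d) ^+ 2 by apply: sqr_mono; lra.
  rewrite hE in H; rewrite -(ler_pM2l b2); nra.
by have h2 := hub_h t u; case: u => r1 K; lra.
Qed.

(** Squaring again, now with [h^2 = g^2 - (b^2 - a^2) (1 - r^2)]. The division by [1 - r^2] breaks
    down at [r = 1], where [g = 0] forces [a = b] instead. *)
Lemma c10_hub a b r d g h : tet_data a b r d g h -> b < 1 ->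
  g + h + r ^+ 2 <= 1 <-> hub a b r d.
Proof.
move=> t b1; split=> [P|u]; last first.
  by have := hub_g t u; have := hub_h t u; lra.
apply/(c8_hub t b1); case: t => a0 b0 r0 d0 g0 h0 gE hE d1 d2 g1 g2 rE.
have W0 : 0 <= 1 - r ^+ 2 by lra.
have H : h ^+ 2 <= (1 - r ^+ 2 - g) ^+ 2 by apply: sqr_mono; lra.
have HE : h ^+ 2 = g ^+ 2 - (b ^+ 2 - a ^+ 2) * (1 - r ^+ 2) by rewrite gE hE; ring.
have [W|W] := eqVneq (1 - r ^+ 2) 0.
  have r1 : r = 1.
    apply/eqP; rewrite eq_le; apply/andP; split; apply: sqr_leE; lra.
  rewrite r1 in g1 g2 *; have : a = b by lra.
  by move=> ->; lra.
have {}W0 : 0 < 1 - r ^+ 2 by rewrite lt_neqAle eq_sym W.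
rewrite -(ler_pM2l W0); nra.
Qed.

End TetrablockReal.

(** * Moebius functions and beta parameters of a point of C^3 *)

Section Tetrablock.
Variable R : realType.
Local Notation C := R[i].
Implicit Types (x y z w : C) (t : R).

Lemma conjcMr x t : Num.conj (x * t%:C) = x^* * t%:C.
Proof.
case: x => a b; apply/eqP; rewrite eq_complex /=.
by apply/andP; split; apply/eqP; ring.
Qed.

(** For fixed [x3] the passage from the betas to [(x1, x2)] is real-linear; this identity and
    [beta_unsolve] invert it up to the factor [1 - |x3|^2]. *)
Lemma beta_solve (b1 b2 x3 : C) :
  b2 + b1^* * x3 - (b1 + b2^* * x3)^* * x3 = b2 * (1 - cmod x3 ^+ 2)%:C.
Proof.
rewrite sqr_cmod; case: b1 b2 x3 => ? ? [? ?] [? ?].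
by apply/eqP; rewrite eq_complex /=; apply/andP; split; apply/eqP; ring.
Qed.

Lemma beta_unsolve x1 x2 x3 :
  x1 - x2^* * x3 + (x2 - x1^* * x3)^* * x3 = x1 * (1 - cmod x3 ^+ 2)%:C.
Proof.
rewrite sqr_cmod; case: x1 x2 x3 => ? ? [? ?] [? ?].
by apply/eqP; rewrite eq_complex /=; apply/andP; split; apply/eqP; ring.
Qed.

(* For |x2| < 1 this says that (x1, x2, x3) lies in the closed tetrablock. *)
Definition chub x1 x2 x3 : Prop :=
  hub (cmod x1) (cmod x2) (cmod x3) (cmod (x1 * x2 - x3)).

Lemma tet_dataP x1 x2 x3 : tet_data (cmod x1) (cmod x2) (cmod x3)
  (cmod (x1 * x2 - x3)) (cmod (x2 - x1^* * x3)) (cmod (x1 - x2^* * x3)).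
Proof.
split; rewrite ?cmod_ge0 //.
- by rewrite !sqr_cmod; case: x1 x2 x3 => ? ? [? ?] [? ?] /=; ring.
- by rewrite !sqr_cmod; case: x1 x2 x3 => ? ? [? ?] [? ?] /=; ring.
- by rewrite -cmodM; exact: cmodB_ge.
- by rewrite -cmodM cmodC; exact: cmodB_ge.
- by rewrite -(cmodJ x1) -cmodM; exact: cmodB_ge.
- by rewrite -(cmodJ x1) -cmodM cmodC; exact: cmodB_ge.
- have [b1|b1] := leP (1 - cmod x2 ^+ 2) 0.
    apply: le_trans (_ : 0 <= _); first by rewrite mulr_ge0_le0 ?cmod_ge0.
    by rewrite addr_ge0 ?mulr_ge0 ?cmod_ge0.
  have E : x3 * (1 - cmod x2 ^+ 2)%:C = x2 * (x1 - x2^* * x3) - (x1 * x2 - x3).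
    by rewrite rmorphB /= sqr_cmodE; ring.
  rewrite -[X in _ * X](ger0_norm (ltW b1)) -cmod_real -cmodM E -cmodM.
  exact: cmodB.
Qed.

Lemma mobius_sqr x1 x2 x3 z :
  cmod (x2 * z - 1) ^+ 2 - cmod (x3 * z - x1) ^+ 2 =
  1 - cmod x1 ^+ 2 + (cmod x2 ^+ 2 - cmod x3 ^+ 2) * cmod z ^+ 2
  - 2 * complex.Re (z * (x2 - x1^* * x3)).
Proof.
by rewrite !sqr_cmod; case: x1 x2 x3 z => ? ? [? ?] [? ?] [? ?] /=; ring.
Qed.

Lemma chub_mobius x1 x2 x3 z : chub x1 x2 x3 -> cmod z <= 1 ->
  cmod (x3 * z - x1) <= cmod (x2 * z - 1).
Proof.
move=> hb z1; have T := tet_dataP x1 x2 x3.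
have P := hub_g T hb; have [a1 _] := hub_le1 T hb.
apply: sqr_leE; first exact: cmod_ge0.
rewrite -subr_ge0 mobius_sqr.
have := le_trans (ler_norm _) (ler_Re_cmod (z * (x2 - x1^* * x3))); rewrite cmodM.
case: hb => r1; have := cmod_ge0 z; have := tet_d0 T; have := tet_a0 T.
move: z1 P a1; move: (cmod (x2 - _)) (cmod (_ * x2 - _)) (complex.Re _) => g d u.
move: (cmod x1) (cmod x2) (cmod x3) (cmod z) => a b r t t1 P a1 a0 d0 t0 K ut.
have A0 : 0 <= 1 - a ^+ 2 by rewrite subr_ge0 expr_le1.
(* Bounding the real part by [t * g] and [g] by [hub_g], the difference of squares is at least this
   product. *)
have : 0 <= (1 - t) * ((1 - t) * (1 - a ^+ 2) + t * (1 - a ^+ 2 - b ^+ 2 + r ^+ 2)).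
  by apply: mulr_ge0; [lra|apply: addr_ge0; apply: mulr_ge0; lra].
have : t * (2 * g) <= t * (1 - a ^+ 2 + b ^+ 2 - r ^+ 2) by rewrite ler_wpM2l.
by lra.
Qed.

(** The limit [t -> 1] made explicit: if the conclusion fails by [e], the quadratic is negative at
    [t = 1 - e / k]. *)
Lemma quad_limit (A B g : R) :
  (forall t, 0 <= t < 1 -> 0 <= A + B * t ^+ 2 - 2 * g * t) -> 2 * g <= A + B.
Proof.
move=> H; rewrite leNgt; apply/negP => lt.
pose e := 2 * g - A - B; pose k := 2 * `|g| + 3 * `|B| + e + 1.
have e0 : 0 < e by rewrite /e; lra.
have g0 := normr_ge0 g; have B0 := normr_ge0 B.
have k0 : 0 < k by rewrite /k; lra.
have d1 : 0 < e / k by rewrite divr_gt0.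
have d2 : e / k <= 1 by rewrite ler_pdivrMr // /k; lra.
have dk : e / k * k = e by rewrite divfK // gt_eqF.
have := H (1 - e / k); move: (e / k) d1 d2 dk => D D0 D1 Dk.
have -> : (0 <= 1 - D < 1) by apply/andP; split; lra.
move=> /(_ isT).
have := ler_norm g; have := ler_norm B; have := ler_norm (- B); rewrite normrN.
have : A = 2 * g - B - e by rewrite /e; ring.
move=> -> B1 B2 g1; rewrite /k in Dk.
have : D * g <= D * `|g| by rewrite ler_wpM2l // ltW.
have : - (D * B) <= D * `|B| by rewrite -mulrN ler_wpM2l // ltW.
have : D ^+ 2 * B <= D * `|B|.
  apply: le_trans (_ : D ^+ 2 * `|B| <= _); first by rewrite ler_wpM2l // sqr_ge0.
  by rewrite ler_wpM2r // expr2 ler_piMl // ltW.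
nra.
Qed.

(** Turning [z] so that [z * G] becomes nonnegative makes [mobius_sqr] a quadratic in [|z|], and its
    value at [|z| = 1] is C8. *)
Lemma mobius_chub x1 x2 x3 : cmod x2 < 1 ->
  (forall z, disc z -> cmod (x3 * z - x1) <= cmod (x2 * z - 1)) -> chub x1 x2 x3.
Proof.
move=> b1 H; have T := tet_dataP x1 x2 x3; apply/(c8_hub T b1).
pose G := x2 - x1^* * x3; rewrite -/G.
suff : 2 * cmod G <= (1 - cmod x1 ^+ 2) + (cmod x2 ^+ 2 - cmod x3 ^+ 2) by lra.
apply: quad_limit => t /andP[t0 t1].
have [z zt zG] : exists2 z, cmod z = t & complex.Re (z * G) = t * cmod G.
  have [->|G0] := eqVneq G 0.
    exists t%:C; first by rewrite cmod_real ger0_norm.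
    by rewrite mulr0 cmod0 mulr0.
  have cG : 0 < cmod G by rewrite cmod_gt0.
  exists ((t / cmod G)%:C * G^*).
    by rewrite cmodM cmod_real cmodJ ger0_norm ?divr_ge0 ?cmod_ge0 // divfK ?gt_eqF.
  rewrite -mulrA (mulrC G^*) -sqr_cmodE -rmorphM /=.
  by rewrite expr2 mulrA divfK // gt_eqF.
have := H z; rewrite /disc /= zt => /(_ t1) Hz.
have : 0 <= cmod (x2 * z - 1) ^+ 2 - cmod (x3 * z - x1) ^+ 2.
  by rewrite subr_ge0; apply: sqr_mono; rewrite ?cmod_ge0.
rewrite mobius_sqr zt zG; lra.
Qed.

(** The expression is [(1 - x2 w) - z (x1 - x3 w)], which for given [w] has a zero [z] in the disc
    exactly when [|1 - x2 w| < |x1 - x3 w|]. *)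
Lemma mobius_nonzero x1 x2 x3 : cmod x2 < 1 ->
  (forall z w, disc z -> disc w -> 1 - x1 * z - x2 * w + x3 * z * w != 0) <->
  chub x1 x2 x3.
Proof.
move=> b1; split=> [H|hb z w z1 w1].
  apply: mobius_chub => // w w1; rewrite leNgt; apply/negP => lt.
  have d0 : x1 - x3 * w != 0.
    by rewrite -cmod_gt0 cmodC; apply: le_lt_trans lt; exact: cmod_ge0.
  have := H ((1 - x2 * w) / (x1 - x3 * w)) w; rewrite /disc /= cmodM cmodV.
  rewrite (cmodC 1) (cmodC x1) ltr_pdivrMr ?mul1r => [/(_ lt w1)/eqP[]|]; last first.
    by rewrite cmodC cmod_gt0.
  by field.
have := chub_mobius hb (ltW w1); move: z1 w1; rewrite /disc /= => z1 w1 M.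
have x2w : cmod (x2 * w) < 1.
  by rewrite cmodM; apply: mulr_ilt1; rewrite ?cmod_ge0.
have p0 : 0 < cmod (x2 * w - 1).
  by rewrite cmodC; have := cmodB_ge 1 (x2 * w); rewrite cmod1; lra.
apply/eqP => E.
have {}E : 1 - x2 * w = z * (x1 - x3 * w).
  by apply/eqP; rewrite -subr_eq0 -E; apply/eqP; ring.
have := congr1 (@ComplexField.Normc.normc R) E; rewrite cmodM (cmodC 1) (cmodC x1) => F.
have : cmod z * cmod (x3 * w - x1) <= cmod z * cmod (x2 * w - 1).
  by rewrite ler_wpM2l // cmod_ge0.
by rewrite -F -subr_ge0 (_ : _ - _ = - ((1 - cmod z) * cmod (x2 * w - 1)));
  [rewrite oppr_ge0 leNgt mulr_gt0 // subr_gt0|ring].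
Qed.

(** [B] is 1 for the tetrablock and 3 for the extended symmetrized polydisc in C^3. *)
Lemma beta_bound (b1 b2 x3 y1 y2 : C) (B : R) :
  cmod x3 <= 1 -> cmod b1 + cmod b2 <= B ->
  y1 = b1 + b2^* * x3 -> y2 = b2 + b1^* * x3 ->
  cmod (y2 - y1^* * x3) + cmod (y1 - y2^* * x3) <= B * (1 - cmod x3 ^+ 2).
Proof.
move=> r1 bB y1E y2E.
have r2 : 0 <= 1 - cmod x3 ^+ 2 by rewrite subr_ge0 expr_le1 ?cmod_ge0.
have N : cmod (1 - cmod x3 ^+ 2)%:C = 1 - cmod x3 ^+ 2 :> R by rewrite cmod_real ger0_norm.
rewrite y1E y2E !beta_solve.
by rewrite !cmodM !N -mulrDl addrC; apply: ler_wpM2r.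
Qed.

Lemma beta_chub (b1 b2 x3 : C) : cmod x3 <= 1 -> cmod b1 + cmod b2 <= 1 ->
  cmod (b2 + b1^* * x3) < 1 -> chub (b1 + b2^* * x3) (b2 + b1^* * x3) x3.
Proof.
move=> r1 bb x21; apply/(c10_hub (tet_dataP _ _ _) x21).
by have := beta_bound r1 bb erefl erefl; lra.
Qed.

(** For [|x3| < 1] the betas are forced by [beta_solve]. For [|x3| = 1], C10 degenerates to
    [x1 = x2^* x3] and [x2 = x1^* x3], and the halves of [x1] and [x2] solve the system. *)
Lemma chub_beta x1 x2 x3 : cmod x2 < 1 -> chub x1 x2 x3 ->
  exists b1 b2, [/\ cmod b1 + cmod b2 <= 1, x1 = b1 + b2^* * x3,
    x2 = b2 + b1^* * x3, b1 * (1 - cmod x3 ^+ 2)%:C = x1 - x2^* * x3 &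
    b2 * (1 - cmod x3 ^+ 2)%:C = x2 - x1^* * x3].
Proof.
move=> b1 hb; have T := tet_dataP x1 x2 x3; have r1 := hb.1.
have /(c10_hub T b1) P := hb.
have [r|r] := eqVneq (cmod x3) 1.
  have g0 := tet_g0 T; have h0 := tet_h0 T; rewrite r expr1n in P.
  have G1 : x1 = x2^* * x3 by apply/eqP; rewrite -subr_eq0 -cmod_eq0; apply/eqP; lra.
  have G2 : x2 = x1^* * x3 by apply/eqP; rewrite -subr_eq0 -cmod_eq0; apply/eqP; lra.
  have half : 2^-1 + 2^-1 = 1 :> R by field.
  have sum_half x : x * 2^-1%:C + x * 2^-1%:C = x by rewrite -mulrDr -rmorphD half mulr1.
  exists (x1 * 2^-1%:C), (x2 * 2^-1%:C).
  rewrite r expr1n subrr !mulr0 -G1 -G2 !subrr !conjcMr; split=> //.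
  - rewrite !cmodM cmod_real ger0_norm ?invr_ge0 //.
    have : cmod x1 = cmod x2 by rewrite [in LHS]G1 cmodM cmodJ r mulr1.
    by lra.
  - by rewrite mulrAC -G1 sum_half.
  - by rewrite mulrAC -G2 sum_half.
have {}r : cmod x3 < 1 by rewrite lt_neqAle r.
have W0 : 0 < 1 - cmod x3 ^+ 2 by rewrite subr_gt0 expr_lt1 ?cmod_ge0.
have U1 := beta_unsolve x1 x2 x3; have U2 := beta_unsolve x2 x1 x3.
set W := (1 - cmod x3 ^+ 2) in W0 U1 U2 *.
have WK x : x * W%:C * W^-1%:C = x by rewrite -mulrA -rmorphM divff ?gt_eqF // mulr1.
have WV x : x * W^-1%:C * W%:C = x by rewrite mulrAC WK.
exists ((x1 - x2^* * x3) * W^-1%:C), ((x2 - x1^* * x3) * W^-1%:C).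
rewrite !WV !conjcMr; split=> //.
- rewrite !cmodM cmod_real gtr0_norm ?invr_gt0 // -mulrDl ler_pdivrMr // mul1r /W; lra.
- by rewrite mulrAC -mulrDl U1 WK.
- by rewrite mulrAC -mulrDl U2 WK.
Qed.

End Tetrablock.

(** * Interpolating functions, in the tetrablock and in the Schur class *)

Section Construction.
Variable R : realType.
Local Notation C := R[i].
Implicit Types (x y z w l : C).

Lemma disc_le1 z : disc z -> cmod z <= 1.
Proof. by move=> z1; exact: ltW. Qed.

(** The difference of the squared moduli is [(|b1|^2 - |b2|^2) (1 - |u|^2)]. *)
Lemma mobius_le1 (b1 b2 u : C) : cmod b2 <= cmod b1 -> cmod u <= 1 ->
  cmod (b1 * u - b2) <= cmod (Num.conj b1 - Num.conj b2 * u).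
Proof.
move=> b21 u1; apply: sqr_leE; first exact: cmod_ge0.
have : 0 <= (cmod b1 ^+ 2 - cmod b2 ^+ 2) * (1 - cmod u ^+ 2).
  by rewrite mulr_ge0 ?subr_ge0 ?expr_le1 ?sqr_mono ?cmod_ge0.
rewrite -subr_ge0 => H; rewrite -subr_ge0; congr (0 <= _) : H.
by rewrite !sqr_cmod; case: b1 b2 u {b21 u1} => ? ? [? ?] [? ?] /=; ring.
Qed.

(** The betas stay fixed and [P] varies. Asking that [b2 + b1^* P] be [rho * l] times [b1 + b2^* P],
    with [rho = x2 / x1] so that this is right at [l0], is a linear equation for [P l]; its solution
    is a Moebius function of [rho * l]. Hence the second coordinate vanishes at 0, and for [x1 = x2]
    the first two coordinates agree everywhere. *)
Lemma tetrablock_interpolation (l0 x1 x2 x3 : C) : disc l0 -> l0 != 0 ->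
  cmod x2 <= cmod x1 -> cmod x2 < 1 -> chub (x1 / l0) x2 (x3 / l0) ->
  exists (b1 b2 rho : C) (P : C -> C),
  [/\ [/\ forall l, disc l -> cdiff P l, forall l, disc l -> cmod (P l) <= 1,
          cmod b1 + cmod b2 <= 1 & x1 = x2 -> rho = 1],
      forall l, disc l -> b2 + b1^* * P l = rho * l * (b1 + b2^* * P l),
      x1 = l0 * (b1 + b2^* * P l0), x2 = b2 + b1^* * P l0 & x3 = l0 * P l0].
Proof.
move=> l01 l0n x21 x2lt hb; have m0 : 0 < cmod l0 by rewrite cmod_gt0.
(* Then [x2 = 0] as well, both betas are 0 and a constant [P] does. *)
have [x10|x10] := eqVneq x1 0.
  have x20 : x2 = 0 by apply/eqP; rewrite -cmod_eq0 eq_le cmod_ge0 andbT -(cmod0 R) -x10.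
  exists 0, 0, 1, (fun=> x3 / l0); split; rewrite ?cmod0 ?rmorph0 ?mul0r ?addr0 ?mulr0 //.
- split=> // [l _|l _]; first exact: cdiff_cst.
  by case: hb.
- by move=> l _; rewrite mulr0.
- by field.
have [b1 [b2 [bb E1 E2 W1 W2]]] := chub_beta x2lt hb.
set X1 := x1 / l0 in hb E1 E2 W1 W2; set X3 := x3 / l0 in hb E1 E2 W1 W2.
have X10 : 0 < cmod X1 by rewrite cmod_gt0 mulf_neq0 ?invr_neq0.
have x2X : cmod x2 < cmod X1.
  apply: le_lt_trans x21 _; rewrite /X1 cmodM cmodV ltr_pdivlMr //.
  by rewrite gtr_pMr ?cmod_gt0.
have r1 : cmod X3 < 1.
  rewrite lt_neqAle (hb.1) andbT; apply/eqP => r1.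
  move: W1; rewrite r1 expr1n subrr mulr0 => /esym/eqP; rewrite subr_eq0 => /eqP.
  by move=> XE; move: x2X; rewrite XE cmodM cmodJ r1 mulr1 ltxx.
have W0 : 0 < 1 - cmod X3 ^+ 2 by rewrite subr_gt0 expr_lt1 ?cmod_ge0.
(* Up to a positive factor the betas have moduli [g] and [h], and [h^2 - g^2 = (1 - |X3|^2) (|X1|^2
   - |x2|^2)], positive because [|x2| <= |x1| < |X1|]. *)
have b21 : cmod b2 < cmod b1.
  rewrite -(ltr_pM2r W0) -{1 2}(ger0_norm (ltW W0)) -!cmod_real -!cmodM W1 W2.
  have T := tet_dataP X1 x2 X3.
  rewrite -(@ltr_pXn2r _ 2) ?nnegrE ?cmod_ge0 // (tet_g T) (tet_h T) -subr_gt0.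
  have : 0 < (1 - cmod X3 ^+ 2) * (cmod X1 ^+ 2 - cmod x2 ^+ 2).
    by rewrite mulr_gt0 // subr_gt0 ltr_pXn2r ?nnegrE ?cmod_ge0.
  by move=> H; congr (0 < _) : H; ring.
pose D := (cmod b1 ^+ 2 - cmod b2 ^+ 2)%:C : C.
have DE : D = b1 * b1^* - b2 * b2^* by rewrite /D rmorphB /= !sqr_cmodE.
have D0 : D != 0.
  rewrite -cmod_eq0 cmod_real normr_eq0 subr_eq0 gt_eqF //.
  by rewrite ltr_pXn2r ?nnegrE ?cmod_ge0.
pose rho := x2 / x1.
have rho1 : cmod rho <= 1 by rewrite cmodM cmodV ler_pdivrMr ?mul1r ?cmod_gt0.
have u0 : rho * l0 = x2 / X1 by rewrite /rho /X1; field; rewrite x10 l0n.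
have rhox : x1 = x2 -> rho = 1 by move=> e; rewrite /rho -e divff.
have rhol l : disc l -> cmod (rho * l) <= 1.
  by move=> l1; rewrite (cmodM rho) mulr_ile1 ?cmod_ge0 // disc_le1.
clearbody rho.
pose den l := b1^* - b2^* * (rho * l).
have den0 l : disc l -> den l != 0.
  move=> l1; rewrite -cmod_gt0; apply: lt_le_trans (cmodB_ge _ _).
  rewrite !cmodM !cmodJ subr_gt0; apply: le_lt_trans b21.
  by rewrite ler_piMr ?cmod_ge0 // -cmodM rhol.
pose P l := (b1 * (rho * l) - b2) / den l.
have P1 l : disc l -> b1 + b2^* * P l = D / den l.
  by move=> /den0 dl; rewrite /P DE; apply: (mulIf dl); rewrite mulrDl -!mulrA mulVf //
    /den; ring.
have P2 l : disc l -> b2 + b1^* * P l = rho * l * (D / den l).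
  by move=> /den0 dl; rewrite /P DE; apply: (mulIf dl); rewrite mulrDl -!mulrA mulVf //
    /den; ring.
have Pl0 : P l0 = X3.
  apply: (mulIf (den0 _ l01)); rewrite /P divfK ?den0 //.
  have X1n : X1 != 0 by rewrite -cmod_gt0.
  have uX : rho * l0 * X1 = x2 by rewrite u0 divfK.
  rewrite /den; apply: (mulIf X1n).
  rewrite (_ : _ * X1 = b1 * (rho * l0 * X1) - b2 * X1); last by ring.
  rewrite [RHS](_ : _ = X3 * (b1^* * X1 - b2^* * (rho * l0 * X1))); last by ring.
  by rewrite uX E1 E2; ring.
exists b1, b2, rho, P; split.
- split=> // [l l1|l l1].
  + apply: cdiff_div; first exact: den0.
      apply: cdiffB; last exact: cdiff_cst.
      apply: cdiffM; first exact: cdiff_cst.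
      by apply: cdiffM; [exact: cdiff_cst|exact: cdiff_id].
    apply: cdiffB; first exact: cdiff_cst.
    apply: cdiffM; first exact: cdiff_cst.
    by apply: cdiffM; [exact: cdiff_cst|exact: cdiff_id].
  + rewrite cmodM cmodV ler_pdivrMr ?cmod_gt0 ?den0 // mul1r.
    apply: mobius_le1; first exact: ltW.
    exact: rhol.
- by move=> l l1; rewrite P1 // P2.
- by rewrite Pl0 -E1 /X1; field.
- by rewrite Pl0.
- by rewrite Pl0 /X3; field.
Qed.

Lemma polar z : exists2 u : C, cmod u = 1 & z = (cmod z)%:C * u.
Proof.
have [->|z0] := eqVneq z 0; first by exists 1; rewrite ?cmod1 // cmod0 mul0r.
have zC : (cmod z)%:C != 0 :> C by rewrite -cmod_eq0 cmod_real normr_eq0 cmod_eq0.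
exists (z / (cmod z)%:C); last by field.
by rewrite cmodM cmodV cmod_real ger0_norm ?cmod_ge0 // divff ?cmod_eq0.
Qed.

(* |b1| + |b2| <= 1 exactly says that (b1, b2) is the entrywise product of two
   unit vectors. *)
Lemma unit_factor (b1 b2 : C) : cmod b1 + cmod b2 <= 1 ->
  exists (a b : R) (c d : C), [/\ a ^+ 2 + b ^+ 2 = 1, cmod c ^+ 2 + cmod d ^+ 2 = 1,
    b1 = a%:C * c & b2 = b%:C * d].
Proof.
have [u1 n1 E1] := polar b1; have [u2 n2 E2] := polar b2.
have := cmod_ge0 b2; have := cmod_ge0 b1; rewrite {3}E1 {3}E2.
move: (cmod b1) (cmod b2) => {E1 E2} p q p0 q0 pq.
(* [A = a^2] and [B = |c|^2] must satisfy [A B = p^2] and [(1 - A) (1 - B) = q^2], so they are the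
   roots of [X^2 - T X + p^2]; the discriminant is nonnegative because [p + q <= 1]. *)
pose T := 1 + p ^+ 2 - q ^+ 2; pose S := Num.sqrt (T ^+ 2 - 4 * p ^+ 2).
have TE : T ^+ 2 - 4 * p ^+ 2 = ((1 - p) ^+ 2 - q ^+ 2) * ((1 + p) ^+ 2 - q ^+ 2).
  by rewrite /T; ring.
have S2 : S ^+ 2 = T ^+ 2 - 4 * p ^+ 2.
  by rewrite sqr_sqrtr // TE; apply: mulr_ge0; rewrite subr_ge0; apply: sqr_mono; lra.
have S0 : 0 <= S by exact: sqrtr_ge0.
have p2 := sqr_ge0 p; have q2 := sqr_ge0 q.
have q2' : q ^+ 2 <= 1 by rewrite expr_le1 //; lra.
have p2' : p ^+ 2 <= 1 by rewrite expr_le1 //; lra.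
pose A := (T + S) / 2; pose B := (T - S) / 2.
have ST : S <= T by apply: sqr_leE; [rewrite /T; lra|rewrite S2; lra].
have ST' : S <= 2 - T.
  by apply: sqr_leE; [rewrite /T; lra|rewrite S2 /T; nra].
have A0 : 0 <= A by rewrite /A; lra.
have B0 : 0 <= B by rewrite /B; lra.
have A1 : 0 <= 1 - A by rewrite /A; lra.
have B1 : 0 <= 1 - B by rewrite /B; lra.
have AB : A * B = p ^+ 2.
  have -> : A * B = (T ^+ 2 - S ^+ 2) / 4 by rewrite /A /B; field.
  by rewrite S2; field.
have AB1 : (1 - A) * (1 - B) = q ^+ 2.
  have -> : (1 - A) * (1 - B) = 1 - T + A * B by rewrite /A /B; field.
  by rewrite AB /T; ring.
exists (Num.sqrt A), (Num.sqrt (1 - A)), ((Num.sqrt B)%:C * u1),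
  ((Num.sqrt (1 - B))%:C * u2).
split.
- by rewrite !sqr_sqrtr //; ring.
- by rewrite !cmodM !cmod_real n1 n2 !mulr1 !real_normK ?num_real // !sqr_sqrtr //; ring.
- by rewrite mulrA -rmorphM -sqrtrM // AB sqrtr_sqr ger0_norm.
- by rewrite mulrA -rmorphM -sqrtrM // AB1 sqrtr_sqr ger0_norm.
Qed.

Definition mat2 (a b c d : C) : 'M[C]_2 :=
  \matrix_(i, j) if i == 0 then (if j == 0 then a else b) else (if j == 0 then c else d).

Lemma det_mx2 (M : 'M[C]_2) : \det M = M 0 0 * M 1 1 - M 0 1 * M 1 0.
Proof.
rewrite (expand_det_row _ 0) !big_ord_recl big_ord0 /cofactor !det_mx11 !mxE /=.
have o1 : lift ord0 ord0 = 1 :> 'I_2 by apply/val_inj.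
have o0 : lift (lift ord0 ord0) 0 = 0 :> 'I_2 by apply/val_inj.
by rewrite o0 !o1 addn0 add0n expr0 expr1; ring.
Qed.

Lemma l2norm_mul2 (M : 'M[C]_2) (v : 'cV[C]_2) :
  l2norm (M *m v) = Num.sqrt (cmod (M 0 0 * v 0 0 + M 0 1 * v 1 0) ^+ 2
                              + cmod (M 1 0 * v 0 0 + M 1 1 * v 1 0) ^+ 2).
Proof.
have o1 : lift ord0 ord0 = 1 :> 'I_2 by apply/val_inj.
by rewrite /l2norm !big_ord_recl !big_ord0 /= !mxE !big_ord_recl !big_ord0 /= !addr0 o1.
Qed.

Lemma l2norm2 (v : 'cV[C]_2) : l2norm v = Num.sqrt (cmod (v 0 0) ^+ 2 + cmod (v 1 0) ^+ 2).
Proof.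
have o1 : lift ord0 ord0 = 1 :> 'I_2 by apply/val_inj.
by rewrite /l2norm !big_ord_recl !big_ord0 /= addr0 o1.
Qed.

(** Contractivity without suprema or square roots. *)
Definition contr2 (M : 'M[C]_2) := forall u v,
  cmod (M 0 0 * u + M 0 1 * v) ^+ 2 + cmod (M 1 0 * u + M 1 1 * v) ^+ 2
  <= cmod u ^+ 2 + cmod v ^+ 2.

Lemma contr2_opnorm (M : 'M[C]_2) : contr2 M <-> (opnorm M <= 1%:E)%E.
Proof.
split=> [cM|oM u v].
  apply: ge_ereal_sup => _ [v /= v1 <-]; rewrite lee_fin; apply: le_trans v1.
  by rewrite l2norm_mul2 l2norm2 ler_wsqrtr.
pose s := cmod u ^+ 2 + cmod v ^+ 2.
have s_ge0 : 0 <= s by rewrite addr_ge0 ?sqr_ge0.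
have [s0|s0] := eqVneq s 0.
  have := sqr_ge0 (cmod u); have := sqr_ge0 (cmod v) => v2 u2.
  have u0 : u = 0 by apply/eqP; rewrite -cmod_eq0 -sqrf_eq0; apply/eqP; rewrite /s in s0; lra.
  have v0 : v = 0 by apply/eqP; rewrite -cmod_eq0 -sqrf_eq0; apply/eqP; rewrite /s in s0; lra.
  by rewrite u0 v0 !mulr0 !addr0.
have {}s_gt0 : 0 < s by rewrite lt_neqAle eq_sym s0.
pose k := (Num.sqrt s)^-1; have k0 : 0 < k by rewrite invr_gt0 sqrtr_gt0.
have ks : k ^+ 2 * s = 1 by rewrite /k exprVn sqr_sqrtr // mulVf.
pose V : 'cV[C]_2 := \col_i (if i == 0 then k%:C * u else k%:C * v).
have V1 : l2norm V <= 1.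
  rewrite l2norm2 !mxE /= !cmodM !cmod_real gtr0_norm // !exprMn -mulrDr -/s ks.
  by rewrite sqrtr1.
have : ((l2norm (M *m V))%:E <= 1%:E)%E.
  by apply: le_trans oM; apply: ereal_sup_ubound; exists V.
rewrite lee_fin l2norm_mul2 !mxE /= -{1}sqrtr1 ler_sqrt //.
rewrite !(mulrCA _ k%:C) -!mulrDr !cmodM !cmod_real gtr0_norm // !exprMn -mulrDr.
by rewrite -ks ler_pM2l // exprn_gt0.
Qed.

Lemma rotation_norm (a b : R) (p q : C) : a ^+ 2 + b ^+ 2 = 1 ->
  cmod (a%:C * p - b%:C * q) ^+ 2 + cmod (b%:C * p + a%:C * q) ^+ 2 =
  cmod p ^+ 2 + cmod q ^+ 2.
Proof.
move=> ab; rewrite -[RHS]mul1r -ab !sqr_cmod; case: p q => ? ? [? ?] /=; ring.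
Qed.

Lemma unitary_norm (c d p q : C) : cmod c ^+ 2 + cmod d ^+ 2 = 1 ->
  cmod (c * p + d * q) ^+ 2 + cmod (Num.conj c * q - Num.conj d * p) ^+ 2 =
  cmod p ^+ 2 + cmod q ^+ 2.
Proof.
move=> cd; rewrite -[RHS]mul1r -cd !sqr_cmod.
by case: c d p q {cd} => ? ? [? ?] [? ?] [? ?] /=; ring.
Qed.

Lemma mat2_cdiff (f g h k : C -> C) z :
  cdiff f z -> cdiff g z -> cdiff h z -> cdiff k z ->
  derivable ((fun w => mat2 (f w) (g w) (h w) (k w)) : C^o -> 'M[C^o]_2) z 1.
Proof.
move=> df dg dh dk; apply/derivable_entries => i j.
by under eq_fun do rewrite mxE; case: (i == 0); case: (j == 0).
Qed.

(* The matrix function U diag(1, P) V diag(l, 1), with U and V unitary. *)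
Lemma schur_interpolation (b1 b2 : C) (P : C -> C) :
  (forall l, disc l -> cdiff P l) -> (forall l, disc l -> cmod (P l) <= 1) ->
  cmod b1 + cmod b2 <= 1 ->
  exists f g : C -> C,
  let F l := mat2 (l * (b1 + b2^* * P l)) (f l) (l * g l) (b2 + b1^* * P l) in
  let F' l := mat2 (b2 + b1^* * P l) (f l) (l * g l) (l * (b1 + b2^* * P l)) in
  [/\ schur F, schur F', forall l, \det (F l) = l * P l & forall l, \det (F' l) = l * P l].
Proof.
move=> dP P1 bb; have [a [b [c [d [ab cd E1 E2]]]]] := unit_factor bb.
pose f l := a%:C * d - b%:C * (P l * c^*); pose g l := b%:C * c - a%:C * (P l * d^*).
exists f, g => F F'.
have c1 : Num.conj b1 = a%:C * c^* by rewrite E1 mulrC conjcMr mulrC.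
have c2 : Num.conj b2 = b%:C * d^* by rewrite E2 mulrC conjcMr mulrC.
have d11 l : disc l -> cdiff (fun l => l * (b1 + b2^* * P l)) l.
  move=> l1; apply: cdiffM; first exact: cdiff_id.
  apply: cdiffD; first exact: cdiff_cst.
  by apply: cdiffM; [exact: cdiff_cst|exact: dP].
have d22 l : disc l -> cdiff (fun l => b2 + b1^* * P l) l.
  move=> l1; apply: cdiffD; first exact: cdiff_cst.
  by apply: cdiffM; [exact: cdiff_cst|exact: dP].
have df l : disc l -> cdiff f l.
  move=> l1; apply: cdiffB; first exact: cdiff_cst.
  apply: cdiffM; first exact: cdiff_cst.
  by apply: cdiffM; [exact: dP|exact: cdiff_cst].
have dg l : disc l -> cdiff (fun l => l * g l) l.
  move=> l1; apply: cdiffM; first exact: cdiff_id.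
  apply: cdiffB; first exact: cdiff_cst.
  apply: cdiffM; first exact: cdiff_cst.
  by apply: cdiffM; [exact: dP|exact: cdiff_cst].
have key l u v : disc l ->
    cmod (l * (b1 + b2^* * P l) * u + f l * v) ^+ 2
    + cmod (l * g l * u + (b2 + b1^* * P l) * v) ^+ 2 <= cmod u ^+ 2 + cmod v ^+ 2.
  move=> l1; pose p := c * (l * u) + d * v; pose q := c^* * v - d^* * (l * u).
  have -> : l * (b1 + b2^* * P l) * u + f l * v = a%:C * p - b%:C * (P l * q).
    by rewrite /f /p /q c2 E1; ring.
  have -> : l * g l * u + (b2 + b1^* * P l) * v = b%:C * p + a%:C * (P l * q).
    by rewrite /g /p /q c1 E2; ring.
  rewrite rotation_norm //; apply: (@le_trans _ _ (cmod p ^+ 2 + cmod q ^+ 2)).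
    rewrite lerD2l; apply: sqr_mono; first exact: cmod_ge0.
    by rewrite cmodM ler_piMl ?cmod_ge0 ?P1.
  rewrite unitary_norm // lerD2r; apply: sqr_mono; first exact: cmod_ge0.
  by rewrite cmodM ler_piMl ?cmod_ge0 //; exact: disc_le1.
(* [F'] is [F] reflected in the antidiagonal, so the factors come in reverse order, with
   [diag(1, l)] outermost. *)
have key' l u v : disc l ->
    cmod ((b2 + b1^* * P l) * u + f l * v) ^+ 2
    + cmod (l * g l * u + l * (b1 + b2^* * P l) * v) ^+ 2 <= cmod u ^+ 2 + cmod v ^+ 2.
  move=> l1; have P1l := P1 _ l1.
  pose p := a%:C * v + b%:C * u; pose q := P l * (a%:C * u - b%:C * v).
  have -> : (b2 + b1^* * P l) * u + f l * v = d * p + c^* * q.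
    by rewrite /f /p /q c1 E2; ring.
  have -> : l * g l * u + l * (b1 + b2^* * P l) * v = l * (c * p - d^* * q).
    by rewrite /g /p /q c2 E1; ring.
  apply: (@le_trans _ _ (cmod p ^+ 2 + cmod q ^+ 2)).
    have <- : cmod (c * p - d^* * q) ^+ 2 + cmod (d * p + c^* * q) ^+ 2 =
              cmod p ^+ 2 + cmod q ^+ 2.
      rewrite -[RHS]mul1r -cd !sqr_cmod; move: p q => p q.
      by case: (c) (d) p q => ? ? [? ?] [? ?] [? ?] /=; ring.
    rewrite addrC lerD2r; apply: sqr_mono; first exact: cmod_ge0.
    by rewrite cmodM ler_piMl ?cmod_ge0 //; exact: disc_le1.
  have -> : cmod u ^+ 2 + cmod v ^+ 2 = cmod p ^+ 2 + cmod (a%:C * u - b%:C * v) ^+ 2.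
    by rewrite /p addrC (addrC (a%:C * v)) [RHS]addrC rotation_norm // addrC.
  rewrite lerD2l; apply: sqr_mono; first exact: cmod_ge0.
  by rewrite cmodM ler_piMl ?cmod_ge0.
have det2 (x y z w : C) : \det (mat2 x y z w) = x * w - y * z.
  by rewrite det_mx2 !mxE.
have cdC : c * c^* + d * d^* = 1 by rewrite -!sqr_cmodE -rmorphD cd.
have abC : a%:C ^+ 2 + b%:C ^+ 2 = 1 :> C by rewrite -!rmorphXn -rmorphD ab.
have detE l : l * (b1 + b2^* * P l) * (b2 + b1^* * P l) - f l * (l * g l) = l * P l.
  rewrite c1 c2 E1 E2 /f /g.
  rewrite (_ : _ - _ = l * P l * (a%:C ^+ 2 + b%:C ^+ 2) * (c * c^* + d * d^*)); last by ring.
  by rewrite abC cdC !mulr1.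
split.
- split=> z z1; first by apply: mat2_cdiff; auto.
  by apply/contr2_opnorm => u v; rewrite !mxE; exact: key.
- split=> z z1; first by apply: mat2_cdiff; auto.
  by apply/contr2_opnorm => u v; rewrite !mxE; exact: key'.
- by move=> l; rewrite det2.
- by move=> l; rewrite det2 mulrC.
Qed.

End Construction.

(** * The symmetrized polydisc *)

Section SymmetrizedPolydisc.
Local Close Scope classical_set_scope.
Variable R : realType.
Local Notation C := R[i].
Variable n : nat.
Implicit Types (z : 'rV[C]_n) (w : C) (I : {set 'I_n}).

Lemma card_subset_ord I : (#|I| <= n)%N.
Proof. by rewrite -[leqRHS](card_ord n) max_card. Qed.

Lemma esym0 z : Defs.esym z 0 = 1.
Proof.
rewrite /Defs.esym (big_pred1 finset.set0) => [|I]; first by rewrite big_set0.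
by rewrite cards_eq0.
Qed.

Lemma esym_full z : Defs.esym z n = \prod_i z ord0 i.
Proof.
rewrite /Defs.esym (big_pred1 [set: 'I_n]) => [|I].
  by apply: eq_bigl => i; rewrite inE.
apply/eqP/eqP => [In|->]; last by rewrite cardsT card_ord.
by apply/eqP; rewrite eqEcard finset.subsetT cardsT card_ord In leqnn.
Qed.

Lemma crd_sympi z k : (k <= n)%N -> crd (sympi z) k = Defs.esym z k.
Proof.
case: k => [_|k kn]; first by rewrite esym0.
by rewrite /crd insubT /= mxE.
Qed.

Definition zprod z I : C := \prod_(i in I) z ord0 i.

Lemma zprodC z I : zprod z I * zprod z (~: I) = Defs.esym z n.
Proof.
rewrite esym_full (bigID (mem I)) /=; congr (_ * _).
by apply: eq_bigl => i; rewrite inE.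
Qed.

Lemma esym_compl z j : (j <= n)%N ->
  Defs.esym z (n - j) = \sum_(I : {set 'I_n} | #|I| == j) zprod z (~: I).
Proof.
move=> jn; rewrite /Defs.esym (reindex_inj (inv_inj (@finset.setCK _))) /=.
apply: eq_bigl => I; rewrite cardsCs finset.setCK card_ord.
have In : (#|I| <= n)%N by exact: card_subset_ord.
by apply/eqP/eqP => [|->//]; move=> E; rewrite -(subKn In) E subKn.
Qed.

Lemma cmod_zprod z I : polydisc z -> cmod (zprod z I) <= 1.
Proof.
move=> zd; rewrite cmod_prod; apply: prodr_ile1 => i _.
by rewrite cmod_ge0 ltW //; exact: zd.
Qed.

Lemma cmod_zprod_lt z I : polydisc z -> (0 < #|I|)%N -> cmod (zprod z I) < 1.
Proof.
move=> zd /card_gt0P[i iI]; rewrite /zprod (bigD1 i) //= cmodM.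
apply: le_lt_trans (zd i : cmod _ < 1); rewrite ler_piMr ?cmod_ge0 //.
rewrite cmod_prod; apply: prodr_ile1 => k _.
by rewrite cmod_ge0 ltW //; exact: zd.
Qed.

Lemma sum_subsets (x : R) j :
  \sum_(I : {set 'I_n} | #|I| == j) x = 'C(n, j)%:R * x.
Proof.
have -> : \sum_(I : {set 'I_n} | #|I| == j) x
        = \sum_(I in [set I : {set 'I_n} | #|I| == j]) x.
  by apply: eq_bigl => I; rewrite inE.
by rewrite sumr_const card_draws card_ord mulr_natl.
Qed.

Lemma esym_lt z j : polydisc z -> (0 < j <= n)%N -> cmod (Defs.esym z j) < 'C(n, j)%:R.
Proof.
move=> zd /andP[j0 jn]; apply: le_lt_trans (cmod_sum _ _ _) _.
rewrite -[X in _ < X]mulr1 -sum_subsets; apply: ltr_sum => [|I /eqP Ij].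
  have : (0 < #|[set I : {set 'I_n} | #|I| == j]|)%N by rewrite card_draws card_ord bin_gt0.
  move/card_gt0P => [I]; rewrite inE => Ij.
  by apply/hasP; exists I; rewrite ?mem_index_enum.
by apply: cmod_zprod_lt; rewrite ?Ij.
Qed.

(** C10 for a point [(a, b, a b)]: with [p], [q] the moduli, the two sides differ by
    [(1 - p) (1 - q) (1 - p q)]. *)
Lemma pair_bound (a b : C) : cmod a <= 1 -> cmod b <= 1 ->
  cmod (b - a^* * (a * b)) + cmod (a - b^* * (a * b)) <= 1 - cmod (a * b) ^+ 2.
Proof.
move=> a1 b1.
have -> : b - a^* * (a * b) = b * (1 - cmod a ^+ 2)%:C.
  by rewrite rmorphB /= sqr_cmodE; ring.
have -> : a - b^* * (a * b) = a * (1 - cmod b ^+ 2)%:C.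
  by rewrite rmorphB /= sqr_cmodE; ring.
have [a2 b2] : 0 <= 1 - cmod a ^+ 2 /\ 0 <= 1 - cmod b ^+ 2.
  by rewrite !subr_ge0 !expr_le1 ?cmod_ge0.
rewrite !cmodM !cmod_real !ger0_norm //.
have := cmod_ge0 a; have := cmod_ge0 b; move: (cmod a) (cmod b) a1 b1 => p q p1 q1 q0 p0.
rewrite -subr_ge0 (_ : _ - _ = (1 - p) * (1 - q) * (1 - p * q)); last by ring.
by rewrite !mulr_ge0 ?subr_ge0 // mulr_ile1.
Qed.

(** C10 is the form that averages: for fixed [q] the expressions in its moduli are real-linear in
    the first two coordinates, so the triangle inequality over the [j]-subsets reduces it to
    [pair_bound]. *)
Lemma symG_chub (y : 'rV[C]_n) j : symG y -> (1 <= j < n)%N ->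
  [/\ chub (crd y j / 'C(n, j)%:R) (crd y (n - j) / 'C(n, j)%:R) (crd y n),
      cmod (crd y j) < 'C(n, j)%:R & cmod (crd y (n - j)) < 'C(n, j)%:R].
Proof.
move=> [z zd <-] /andP[j0 jn].
have jn' := ltnW jn; have nj : (0 < n - j <= n)%N by rewrite subn_gt0 jn leq_subr.
rewrite !crd_sympi // ?leq_subr //.
have B1 : cmod (Defs.esym z j) < 'C(n, j)%:R by apply: esym_lt; rewrite // j0.
have B2 : cmod (Defs.esym z (n - j)) < 'C(n, j)%:R by rewrite -bin_sub //; exact: esym_lt.
split=> //; set c : C := 'C(n, j)%:R.
have c0 : (0 : R) < 'C(n, j)%:R by rewrite ltr0n bin_gt0.
have cc : cmod c = 'C(n, j)%:R by rewrite cmod_nat.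
have cn : c != 0 by rewrite -cmod_gt0 cc.
have cJ : Num.conj c = c by rewrite rmorph_nat.
have x21 : cmod (Defs.esym z (n - j) / c) < 1 by rewrite cmodM cmodV cc ltr_pdivrMr // mul1r.
apply/(c10_hub (tet_dataP _ _ _) x21); set q := Defs.esym z n.
have q1 : 0 <= 1 - cmod q ^+ 2.
  by rewrite subr_ge0 expr_le1 ?cmod_ge0 // /q -(zprodC z finset.set0) cmodM mulr_ile1
    ?cmod_ge0 ?cmod_zprod.
have E1 : Defs.esym z (n - j) / c - Num.conj (Defs.esym z j / c) * q =
    (\sum_(I : {set 'I_n} | #|I| == j) (zprod z (~: I) - (zprod z I)^* * q)) / c.
  rewrite esym_compl // /Defs.esym big_split /= sumrN -mulr_suml rmorphM fmorphV /= cJ.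
  by rewrite rmorph_sum /= mulrBl; congr (_ - _); rewrite mulrAC.
have E2 : Defs.esym z j / c - Num.conj (Defs.esym z (n - j) / c) * q =
    (\sum_(I : {set 'I_n} | #|I| == j) (zprod z I - (zprod z (~: I))^* * q)) / c.
  rewrite esym_compl // /Defs.esym big_split /= sumrN -mulr_suml rmorphM fmorphV /= cJ.
  by rewrite rmorph_sum /= mulrBl; congr (_ - _); rewrite mulrAC.
rewrite E1 E2 !(cmodM _ c^-1) cmodV cc -mulrDl -lerBrDr ler_pdivrMr // mulrC -sum_subsets.
apply: le_trans (lerD (cmod_sum _ _ _) (cmod_sum _ _ _)) _; rewrite -big_split /=.
apply: ler_sum => I _; rewrite /q -(zprodC z I).
by apply: pair_bound; exact: cmod_zprod.
Qed.

Lemma prod_expand z : \prod_i (1 - (z ord0 i)%:P * 'X) =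
  \sum_(k < n.+1) ((-1) ^+ k * Defs.esym z k) *: 'X^k :> {poly C}.
Proof.
under eq_bigr do rewrite addrC -mulNr -polyCN.
rewrite bigA_distr /=.
have inI I : (#|I| < n.+1)%N by rewrite ltnS card_subset_ord.
rewrite (partition_big (fun I : {set 'I_n} => Ordinal (inI I)) predT) //=.
apply: eq_bigr => k _; rewrite /Defs.esym mulr_sumr scaler_suml.
apply: eq_big => [I|I /eqP <-] /=; first by rewrite -val_eqE.
rewrite -big_mkcond /= big_split /= prodr_const -mul_polyC; congr (_ * _).
by rewrite -rmorph_prod prodrN.
Qed.

Lemma horner_lin (c w : C) : (1 - c%:P * 'X).[w] = 1 - c * w.
Proof. by rewrite hornerD hornerN hornerM !hornerC hornerX. Qed.

Lemma deriv_lin (c : C) : (1 - c%:P * 'X)^`() = - c%:P.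
Proof.
by rewrite derivB -polyC1 derivC mul_polyC derivZ derivX sub0r alg_polyC.
Qed.

Lemma deriv_prod_lin (s : seq 'I_n) z w : (forall i, 1 - z ord0 i * w != 0) ->
  (\prod_(i <- s) (1 - (z ord0 i)%:P * 'X))^`().[w] =
  - (\prod_(i <- s) (1 - (z ord0 i)%:P * 'X)).[w]
    * \sum_(i <- s) z ord0 i / (1 - z ord0 i * w).
Proof.
move=> nz; elim: s => [|i s IH].
  by rewrite !big_nil -polyC1 derivC horner0 mulr0.
rewrite !big_cons derivM deriv_lin hornerD !hornerM hornerN hornerC horner_lin IH.
set u := (\prod_(k <- s) _).[w]; set v := \sum_(k <- s) _.
by field; exact: nz.
Qed.

(** Cauchy-Schwarz, from the nonnegativity of the variance. *)
Lemma sum_sqr_ge (T : finType) (b : T -> R) :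
  (\sum_i b i) ^+ 2 <= #|T|%:R * \sum_i b i ^+ 2.
Proof.
have [T0|T0] := posnP #|T|.
  have E (F : T -> R) : \sum_i F i = 0.
    by apply: big1 => i _; have := fintype0 i; rewrite T0 => /(_ erefl).
  by rewrite !E expr0n /= mulr0.
have N0 : (0 : R) < #|T|%:R by rewrite ltr0n.
pose M := (\sum_i b i) / #|T|%:R.
have : 0 <= \sum_i (b i - M) ^+ 2 by apply: sumr_ge0 => i _; exact: sqr_ge0.
have -> : \sum_i (b i - M) ^+ 2 = \sum_i b i ^+ 2 - (\sum_i b i) ^+ 2 / #|T|%:R.
  transitivity (\sum_i (b i ^+ 2 + - (2 * M) * b i + M ^+ 2)).
    by apply: eq_bigr => i _; ring.
  by rewrite !big_split /= -mulr_sumr sumr_const -mulr_natl /M; field; rewrite gt_eqF.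
by rewrite subr_ge0 ler_pdivrMr // mulrC.
Qed.

(* Setting b_i = z_i / (1 - z_i w), the condition |z_i| < 1 reads |b_i| < |1 + w b_i|,
   which is convex in b_i since |w| <= 1, hence is inherited by the mean of the b_i. *)
Lemma mean_bound (b : 'I_n -> C) w : (0 < n)%N -> cmod w <= 1 ->
  (forall i, cmod (b i) < cmod (1 + w * b i)) ->
  cmod (\sum_i b i) < cmod (n%:R + w * \sum_i b i).
Proof.
move=> n0 w1 bi; set B := \sum_i b i.
have w2 : 0 <= 1 - cmod w ^+ 2 by rewrite subr_ge0 expr_le1 ?cmod_ge0.
have sqrE (m : nat) u : cmod (m%:R + w * u) ^+ 2
    = m%:R ^+ 2 + 2 * m%:R * complex.Re (w * u) + cmod w ^+ 2 * cmod u ^+ 2.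
  have -> : m%:R + w * u = (m%:R)%:C + w * u by rewrite rmorph_nat.
  by rewrite !sqr_cmod; case: (w) u => ? ? [? ?] /=; ring.
have S : (1 - cmod w ^+ 2) * (\sum_i cmod (b i) ^+ 2)
    < n%:R + 2 * complex.Re (w * B).
  have -> : n%:R + 2 * complex.Re (w * B)
      = \sum_i (1 + 2 * complex.Re (w * b i)).
    rewrite big_split /= sumr_const card_ord -mulr_sumr; congr (_ + 2 * _).
    rewrite /B mulr_sumr; elim/big_rec2 : _ => // i u v _ <-.
    by case: (w * b i) => ? ?; case: v.
  rewrite mulr_sumr; apply: ltr_sum => [|i _].
    by apply/hasP; exists (Ordinal n0); rewrite ?mem_index_enum.
  have := sqrE 1%N (b i); have : cmod (b i) ^+ 2 < cmod (1 + w * b i) ^+ 2.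
    by rewrite ltr_pXn2r ?nnegrE ?cmod_ge0.
  by rewrite -[1]/(1%:R); lra.
have n0' : (0 : R) < n%:R by rewrite ltr0n.
have BS : cmod B ^+ 2 <= n%:R * \sum_i cmod (b i) ^+ 2.
  apply: le_trans (sqr_mono (cmod_ge0 _) (cmod_sum _ _ _)) _.
  by have := sum_sqr_ge (fun i => cmod (b i)); rewrite card_ord.
rewrite -(@ltr_pXn2r _ 2) ?nnegrE ?cmod_ge0 // sqrE -subr_gt0.
have := ler_wpM2l w2 BS; rewrite -(ltr_pM2l n0') in S; move: S.
by move: (\sum_i _) => Q; lra.
Qed.

Definition rnum (y : 'rV[C]_n) w : C :=
  \sum_(1 <= k < n.+1) k%:R * (-1) ^+ k * crd y k * w ^+ k.-1.
Definition rden (y : 'rV[C]_n) w : C :=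
  \sum_(0 <= k < n) (n - k)%:R * (-1) ^+ k * crd y k * w ^+ k.

(** For [p(w)] the product of the [1 - z_i w], the numerator is [p'(w)] and the denominator
    [n p(w) - w p'(w)]. As [p' = - p B] with [B] the sum of the [z_i / (1 - z_i w)], the claim is
    [mean_bound] times [|p(w)|]. *)
Lemma ratio_lt (y : 'rV[C]_n) w : (0 < n)%N -> symG y -> cmod w <= 1 ->
  cmod (rnum y w) < cmod (rden y w).
Proof.
move=> n0 [z zd <-] w1.
pose p : {poly C} := \prod_i (1 - (z ord0 i)%:P * 'X).
have pE : p = \sum_(k < n.+1) ((-1) ^+ k * Defs.esym z k) *: 'X^k by exact: prod_expand.
have nz i : 1 - z ord0 i * w != 0.
  rewrite -cmod_gt0; apply: lt_le_trans (cmodB_ge _ _).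
  rewrite cmod1 subr_gt0 cmodM; apply: le_lt_trans (zd i).
  by rewrite ler_piMr ?cmod_ge0.
have dpE : p^`() = \sum_(k < n.+1) ((-1) ^+ k * Defs.esym z k) *: ('X^(k.-1) *+ k).
  by rewrite pE raddf_sum /=; apply: eq_bigr => k _; rewrite derivZ derivXn.
have numE : rnum (sympi z) w = p^`().[w].
  rewrite dpE horner_sum big_ord_recl mulr0n scaler0 horner0 add0r.
  rewrite /rnum big_add1 big_mkord; apply: eq_bigr => k _.
  by rewrite crd_sympi // hornerZ hornerMn hornerXn -mulr_natl lift0 /=; ring.
have denE : rden (sympi z) w = n%:R * p.[w] - w * p^`().[w].
  rewrite dpE {1}pE !horner_sum !mulr_sumr -sumrB big_ord_recr /=.
  rewrite [X in _ + X](_ : _ = 0) ?addr0; last first.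
    rewrite !hornerZ hornerMn !hornerXn -mulr_natl.
    have <- : w * w ^+ n.-1 = w ^+ n by rewrite -exprS prednK.
    by ring.
  rewrite /rden big_mkord; apply: eq_bigr => k _.
  rewrite crd_sympi 1?ltnW // natrB 1?ltnW // !hornerZ hornerMn !hornerXn -mulr_natl.
  by case: (k : nat) => [|m]; rewrite ?exprS /=; ring.
have PE : p.[w] = \prod_i (1 - z ord0 i * w).
  by rewrite horner_prod; apply: eq_bigr => i _; rewrite !hornerE.
have P0 : 0 < cmod p.[w] by rewrite cmod_gt0 PE prodf_seq_neq0; apply/allP => i _; rewrite nz.
have := deriv_prod_lin (index_enum 'I_n) nz; rewrite -/p => D.
pose b i := z ord0 i / (1 - z ord0 i * w).
have := @mean_bound b w n0 w1.
rewrite denE numE D -/b => H.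
have -> : n%:R * p.[w] - w * (- p.[w] * \sum_i b i) = p.[w] * (n%:R + w * \sum_i b i).
  by ring.
rewrite !cmodM cmodN ltr_pM2l //; apply: H => i.
have -> : 1 + w * b i = (1 - z ord0 i * w)^-1 by rewrite /b; field.
by rewrite /b cmodM gtr_pMl ?cmod_gt0 ?invr_neq0 //; exact: zd.
Qed.

End SymmetrizedPolydisc.

(** * The conditions of the theorem *)

Section Scaling.
Variable R : realType.
Local Notation C := R[i].

Lemma Hinf_leP (f : C -> C) (m : R) :
  (Hinf f <= m%:E)%E <-> forall z, disc z -> cmod (f z) <= m.
Proof.
split=> [H z z1|H].
  rewrite -lee_fin; apply: le_trans H; apply: ereal_sup_ubound.
  by exists z.
by apply: ge_ereal_sup => _ [z z1 <-]; rewrite lee_fin; exact: H.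
Qed.

Lemma mobius_den (x2 z : C) : cmod x2 < 1 -> cmod z <= 1 -> x2 * z - 1 != 0.
Proof.
move=> x21 z1; rewrite -cmod_gt0 cmodC; apply: lt_le_trans (cmodB_ge _ _).
by rewrite cmod1 subr_gt0 cmodM; apply: le_lt_trans x21; rewrite ler_piMr ?cmod_ge0.
Qed.

(** In the exceptional case of [Phi] the Moebius function degenerates to the very constant
    prescribed there, so one formula covers both cases. *)
Lemma PhiE n j (y : 'rV[C]_n) (z : C) : (0 < 'C(n, j))%N ->
  cmod (crd y (n - j)) < 'C(n, j)%:R -> disc z ->
  Phi j z y = (crd y n * z - crd y j / 'C(n, j)%:R)
              / (crd y (n - j) / 'C(n, j)%:R * z - 1).
Proof.
move=> N0 y2 z1; rewrite /Phi; move: (crd y j) (crd y (n - j)) (crd y n) y2 => y1 y2 q y2N.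
set N : C := 'C(n, j)%:R.
have NR : (0 : R) < 'C(n, j)%:R by rewrite ltr0n.
have Nn : N != 0 by rewrite -cmod_gt0 cmod_nat.
have x21 : cmod (y2 / N) < 1 by rewrite cmodM cmodV cmod_nat ltr_pdivrMr // mul1r.
have d0 := mobius_den x21 (disc_le1 z1).
case: eqP => [E|_].
  have -> : q = y1 * y2 / N ^+ 2 by rewrite E mulrAC divff ?mul1r // expf_neq0.
  have -> : y1 * y2 / N ^+ 2 * z - y1 / N = y1 / N * (y2 / N * z - 1) by field.
  by rewrite mulfK.
have -> : N * q * z - y1 = N * (q * z - y1 / N) by field.
have -> : y2 * z - N = N * (y2 / N * z - 1) by field.
by rewrite invfM mulrACA divff // mul1r.
Qed.

Variables (N : nat) (l x1 x2 x3 y1 y2 q : C).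
Hypotheses (N0 : (0 < N)%N) (l0 : l != 0).
Hypotheses (E1 : y1 = N%:R * l * x1) (E2 : y2 = N%:R * x2) (E3 : q = l * x3).
Hypothesis y2N : cmod y2 < N%:R.

Let NR : (0 : R) < N%:R. Proof. by rewrite ltr0n. Qed.
Let m0 : 0 < cmod l. Proof. by rewrite cmod_gt0. Qed.
Let x21 : cmod x2 < 1.
Proof. by move: y2N; rewrite E2 cmodM cmod_nat gtr_pMr. Qed.

Lemma cmod_scaled_h : cmod (y1 - y2^* * q) = N%:R * cmod l * cmod (x1 - x2^* * x3).
Proof.
by rewrite E1 E2 E3 rmorphM rmorph_nat -(cmod_nat R N) -!cmodM; congr cmod; ring.
Qed.

Lemma cmod_scaled_d :
  cmod (y1 * y2 - N%:R ^+ 2 * q) = N%:R ^+ 2 * cmod l * cmod (x1 * x2 - x3).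
Proof.
by rewrite E1 E2 E3 -(cmod_nat R N) -cmodX -!cmodM; congr cmod; ring.
Qed.

Lemma cmod_scaled_g : cmod ((cmod l ^+ 2)%:C * y2 - y1^* * q)
  = N%:R * cmod l ^+ 2 * cmod (x2 - x1^* * x3).
Proof.
have L : cmod l ^+ 2 = cmod (l * l^*) by rewrite cmodM cmodJ expr2.
rewrite sqr_cmodE E1 E2 E3 !rmorphM rmorph_nat L -(cmod_nat R N) -!cmodM.
by congr cmod; ring.
Qed.

Let a_ : cmod y1 = N%:R * cmod l * cmod x1.
Proof. by rewrite E1 !cmodM cmod_nat. Qed.
Let b_ : cmod y2 = N%:R * cmod x2.
Proof. by rewrite E2 !cmodM cmod_nat. Qed.
Let r_ : cmod q = cmod l * cmod x3.
Proof. by rewrite E3 !cmodM. Qed.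
Let NM : 0 < N%:R ^+ 2 * cmod l ^+ 2.
Proof. by rewrite mulr_gt0 ?exprn_gt0. Qed.

Lemma scaled_c6 : (N%:R * cmod (y1 - y2^* * q) + cmod (y1 * y2 - N%:R ^+ 2 * q))
    / (N%:R ^+ 2 - cmod y2 ^+ 2) <= cmod l <-> chub x1 x2 x3.
Proof.
rewrite /chub -(c6_hub (tet_dataP x1 x2 x3) x21) cmod_scaled_h cmod_scaled_d b_.
have b2 : 0 < 1 - cmod x2 ^+ 2 by rewrite subr_gt0 expr_lt1 ?cmod_ge0.
have -> : N%:R ^+ 2 - (N%:R * cmod x2) ^+ 2 = N%:R ^+ 2 * (1 - cmod x2 ^+ 2) by ring.
rewrite ler_pdivrMr ?mulr_gt0 ?exprn_gt0 //.
set h := cmod (x1 - _); set d := cmod (x1 * x2 - _); set b := cmod x2.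
rewrite (_ : _ + _ = N%:R ^+ 2 * cmod l * (h + d)); last by ring.
rewrite (_ : cmod l * _ = N%:R ^+ 2 * cmod l * (1 - b ^+ 2)); last by ring.
by rewrite ler_pM2l // mulr_gt0 ?exprn_gt0.
Qed.

Lemma scaled_c7 : (forall z w, disc z -> disc w ->
    N%:R * l - y1 * z - y2 * l * w + N%:R * q * z * w != 0) <-> chub x1 x2 x3.
Proof.
rewrite -(mobius_nonzero x1 x3 x21).
have Nl : (N%:R * l : C) != 0 by rewrite -cmod_gt0 cmodM cmod_nat mulr_gt0.
have E z w : N%:R * l - y1 * z - y2 * l * w + N%:R * q * z * w =
    N%:R * l * (1 - x1 * z - x2 * w + x3 * z * w) by rewrite E1 E2 E3; ring.
split=> H z w z1 w1; last by rewrite E mulf_neq0 // H.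
by have := H z w z1 w1; rewrite E mulf_eq0 (negPf Nl).
Qed.

Lemma scaled_c8 :
  cmod y1 ^+ 2 - cmod l ^+ 2 * cmod y2 ^+ 2 + N%:R ^+ 2 * cmod q ^+ 2
  - N%:R ^+ 2 * cmod l ^+ 2
  + 2 * N%:R * cmod ((cmod l ^+ 2)%:C * y2 - y1^* * q) <= 0 <-> chub x1 x2 x3.
Proof.
rewrite /chub -(c8_hub (tet_dataP x1 x2 x3) x21) cmod_scaled_g a_ b_ r_.
set g := cmod (x2 - _); set a := cmod x1; set b := cmod x2; set r := cmod x3.
rewrite (_ : _ + _ = N%:R ^+ 2 * cmod l ^+ 2 * (a ^+ 2 - b ^+ 2 + r ^+ 2 - 1 + 2 * g));
  last by ring.
by rewrite (pmulr_rle0 _ NM); split; lra.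
Qed.

Lemma scaled_c9 : cmod q <= cmod l /\
  cmod y1 ^+ 2 + cmod l ^+ 2 * cmod y2 ^+ 2 - N%:R ^+ 2 * cmod q ^+ 2
  + 2 * cmod l * cmod (y1 * y2 - N%:R ^+ 2 * q) <= N%:R ^+ 2 * cmod l ^+ 2
  <-> chub x1 x2 x3.
Proof.
rewrite /chub /hub cmod_scaled_d a_ b_ r_ ger_pMr //.
set d := cmod (x1 * x2 - _); set a := cmod x1; set b := cmod x2; set r := cmod x3.
rewrite -[X in _ /\ X <= _ <-> _](_ : N%:R ^+ 2 * cmod l ^+ 2 *
    (a ^+ 2 + b ^+ 2 - r ^+ 2 + 2 * d) = _); last by ring.
by rewrite (ger_pMr _ NM); split=> -[? ?]; split=> //; lra.
Qed.

Lemma scaled_c10 : cmod ((cmod l ^+ 2)%:C * y2 - y1^* * q)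
    + cmod l * cmod (y1 - y2^* * q) + N%:R * cmod q ^+ 2 <= N%:R * cmod l ^+ 2
  <-> chub x1 x2 x3.
Proof.
rewrite /chub -(c10_hub (tet_dataP x1 x2 x3) x21) cmod_scaled_g cmod_scaled_h r_.
set g := cmod (x2 - _); set h := cmod (x1 - _); set r := cmod x3.
rewrite -[X in X <= _ <-> _](_ : N%:R * cmod l ^+ 2 * (g + h + r ^+ 2) = _); last by ring.
by rewrite ger_pMr // mulr_gt0 ?exprn_gt0.
Qed.

Lemma scaled_c11 : (cmod q <= cmod l /\ exists b1 b2 : C,
   [/\ cmod b1 + cmod b2 <= N%:R, y1 = b1 * l + b2^* * q
     & y2 * l = b2 * l + b1^* * q]) <-> chub x1 x2 x3.
Proof.
have Nn : (N%:R : C) != 0 by rewrite -cmod_gt0 cmod_nat.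
split=> [[ql [b1 [b2 [bN F1 F2]]]]|hb].
  have r1 : cmod x3 <= 1 by move: ql; rewrite r_ ger_pMr.
  have X1 : x1 = b1 / N%:R + (b2 / N%:R)^* * x3.
    apply: (mulfI (mulf_neq0 Nn l0)); rewrite -E1 F1 E3 rmorphM fmorphV /= rmorph_nat.
    by field.
  have X2 : x2 = b2 / N%:R + (b1 / N%:R)^* * x3.
    apply: (mulfI (mulf_neq0 Nn l0)).
    rewrite -[LHS](_ : y2 * l = _); last by rewrite E2; ring.
    by rewrite F2 E3 rmorphM fmorphV /= rmorph_nat; field.
  rewrite X1 X2; apply: beta_chub => //; last by rewrite -X2.
  by rewrite !cmodM !cmodV !cmod_nat -mulrDl ler_pdivrMr // mul1r.
have [b1 [b2 [bb X1 X2 _ _]]] := chub_beta x21 hb.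
split; first by rewrite r_ ger_pMr //; case: hb.
exists (N%:R * b1), (N%:R * b2); split.
- by rewrite !cmodM !cmod_nat -mulrDr ger_pMr.
- by rewrite E1 E3 X1 rmorphM rmorph_nat; ring.
- by rewrite E2 E3 X2 rmorphM rmorph_nat; ring.
Qed.

End Scaling.

(** * The closure of the extended symmetrized polydisc *)

Section Closure.
Variable R : realType.
Local Notation C := R[i].

Lemma crd_row n (F : nat -> C) k : (0 < k <= n)%N -> crd (\row_(i < n) F i.+1) k = F k.
Proof. by case: k => // k kn; rewrite /crd insubT /= mxE. Qed.

Lemma crd_ord n (y : 'rV[C]_n) (i : 'I_n) : y ord0 i = crd y i.+1.
Proof. by rewrite /crd insubT ?ltn_ord // => ?; rewrite /=; congr (y _ _); apply/val_inj. Qed.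

Lemma closure_rowP n (S : set 'rV[C]_n) (y : 'rV[C]_n) :
  closure (S : set 'rV[C^o]_n) y <->
  forall e : R, 0 < e -> exists2 x, S x & forall k, (0 < k <= n)%N -> cmod (crd y k - crd x k) < e.
Proof.
split=> [cy e e0|H B /nbhs_ballP[e /= /gt0_complexE[e0 ->] eB]].
  have : nbhs (y : 'rV[C^o]_n) (ball (y : 'rV[C^o]_n) e%:C).
    by apply: nbhsx_ballx; rewrite ltcR.
  move=> /cy[x [Sx [_ yx]]]; exists x => // k /andP[k0 kn].
  case: k k0 kn => // k _ kn; have := yx ord0 (Ordinal kn).
  by rewrite /ball /= cmod_lt !crd_ord.
have [x Sx yx] := H _ e0; exists x; split=> //; apply: eB; split; first by rewrite ltcR.
move=> i j; rewrite /ball /= cmod_lt (ord1 i) !crd_ord; apply: yx.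
by rewrite /= ltn_ord.
Qed.

(** Multiplying the betas and [q] by [t = 1 - d] makes all inequalities strict and moves coordinate
    [k < n] by [d |b_k + (2 - d) b_(n-k)^* q| <= 3 K d]. *)
Lemma extGamma_beta n (y : 'rV[C]_n) (b : nat -> C) : (0 < n)%N ->
  cmod (crd y n) <= 1 ->
  (forall j, (0 < j < n)%N -> crd y j = b j + (b (n - j)%N)^* * crd y n /\
     cmod (b j) + cmod (b (n - j)%N) <= 'C(n, j)%:R) ->
  extGamma y.
Proof.
move=> n0 q1 yb; apply/closure_rowP => e e0; set q := crd y n in q1 yb *.
pose K := \sum_(j < n.+1) cmod (b j).
have bK j : (j <= n)%N -> cmod (b j) <= K.
  rewrite -ltnS => jn; rewrite /K (bigD1 (Ordinal jn)) //= lerDl.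
  by apply: sumr_ge0 => i _; exact: cmod_ge0.
have K0 : 0 <= K := le_trans (cmod_ge0 _) (bK 0%N (leq0n n)).
pose d := Num.min (2^-1) (e / (2 * (3 * K + 1))).
have k1 : 0 < 2 * (3 * K + 1) by lra.
have d0 : 0 < d by rewrite lt_min invr_gt0 ltr0n divr_gt0.
have d1 : d <= 2^-1 by rewrite ge_min lexx.
have de : d * (3 * K + 1) < e.
  have : d <= e / (2 * (3 * K + 1)) by rewrite ge_min lexx orbT.
  by rewrite ler_pdivlMr //; lra.
clearbody d; pose t := 1 - d.
have t0 : 0 < t by rewrite /t; lra.
have t1 : t < 1 by rewrite /t; lra.
pose F k : C := if k == n then t%:C * q
  else t%:C * b k + (t%:C * b (n - k)%N)^* * (t%:C * q).
have tJ (u : C) : Num.conj (t%:C * u) = t%:C * u^* by rewrite mulrC conjcMr mulrC.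
have ct (u : C) : cmod (t%:C * u) = t * cmod u by rewrite cmodM cmod_real gtr0_norm.
exists (\row_(i < n) F i.+1).
  rewrite /extG /=; split.
    rewrite crd_row ?n0 ?leqnn // /F eqxx ct.
    by apply: le_lt_trans t1; rewrite ger_pMr.
  exists (\row_(i < n.-1) (t%:C * b i.+1)) => j /andP[j0 jn].
  have jn' : (j < n)%N by rewrite -(prednK n0) ltnS.
  have nj : (0 < n - j <= n.-1)%N.
    by rewrite subn_gt0 jn' -ltnS prednK // ltn_subrL j0 n0.
  rewrite !(crd_row (fun k => t%:C * b k)) ?j0 ?jn // !(crd_row F) ?j0 ?n0 ?leqnn ?(ltnW jn') //.
  rewrite /F eqxx ltn_eqF //; split => //; rewrite !ct -mulrDr.
  have [|_ bj] := yb j; first by rewrite j0.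
  apply: le_lt_trans (ler_wpM2l (ltW t0) bj) _.
  by rewrite gtr_pMl // ltr0n bin_gt0 ltnW.
move=> k /andP[k0 kn]; rewrite crd_row ?k0 // /F.
have q0 := cmod_ge0 q.
have dC : t%:C = 1 - d%:C :> C by rewrite /t rmorphB.
case: eqP => [->|/eqP kn'].
  rewrite -/q (_ : q - _ = d%:C * q); last by rewrite dC; ring.
  rewrite cmodM cmod_real gtr0_norm //; nra.
have kn2 : (k < n)%N by rewrite ltn_neqAle kn'.
have [|-> _] := yb k; first by rewrite k0.
rewrite tJ (_ : _ - _ = d%:C * (b k + (2 - d%:C) * (b (n - k)%N)^* * q)); last first.
  by rewrite dC; ring.
rewrite cmodM cmod_real gtr0_norm //; apply: le_lt_trans de.
rewrite ler_pM2l //; apply: le_trans (cmodD _ _) _.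
have D2 : cmod (2 - d%:C) = 2 - d.
  have -> : 2 - d%:C = (2 - d)%:C :> C by rewrite rmorphB rmorph_nat.
  by rewrite cmod_real gtr0_norm //; lra.
rewrite !cmodM cmodJ D2.
have := bK k kn; have := bK (n - k)%N (leq_subr _ _).
have := cmod_ge0 (b (n - k)%N); move: (cmod (b (n - k)%N)) (cmod (b k)) (cmod q) q0 q1.
move=> u v p p0 p1 u0 uK vK.
have : (2 - d) * u * p <= 2 * K.
  apply: le_trans (_ : (2 - d) * u * 1 <= _); first by apply: ler_wpM2l => //; nra.
  nra.
by lra.
Qed.

(** [beta_bound] holds on [extG] and is a closed condition, so it survives in the closure; no betas
    have to be found at the limit point. *)
Lemma extGamma3_bound (y : 'rV[C]_3) : extGamma y ->
  cmod (crd y 2 - (crd y 1)^* * crd y 3) + cmod (crd y 1 - (crd y 2)^* * crd y 3)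
  <= 3 * (1 - cmod (crd y 3) ^+ 2).
Proof.
move=> /closure_rowP H; set y1 := crd y 1; set y2 := crd y 2; set q := crd y 3.
rewrite leNgt; apply/negP => lt.
set L := _ + cmod _ in lt; pose eta := L - 3 * (1 - cmod q ^+ 2).
have eta0 : 0 < eta by rewrite /eta; lra.
pose M := cmod y1 + cmod y2 + cmod q + 1.
have [a0 b0 c0] := And3 (cmod_ge0 y1) (cmod_ge0 y2) (cmod_ge0 q).
have M1 : 1 <= M by rewrite /M; lra.
(* Two errors [2 d + M d] and three times [3 d] from the square of [|q|] add up to at most [15 d M],
   less than [eta]. *)
pose d := Num.min 1 (eta / (20 * M)).
have d0 : 0 < d by rewrite lt_min ltr01 divr_gt0 //; lra.
have d1 : d <= 1 by rewrite ge_min lexx.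
have dM : d * (20 * M) <= eta by rewrite -ler_pdivlMr ?ge_min ?lexx ?orbT //; lra.
have [x [q'1 [b xb]] yx] := H _ d0.
have [|F1 B1] := xb 1%N; first by [].
have [|F2 B2] := xb 2%N; first by [].
have D1 := yx 1%N isT; have D2 := yx 2%N isT; have D3 := yx 3%N isT.
have := @beta_bound _ (crd b 1) (crd b 2) (crd x 3) (crd x 1) (crd x 2) 3 (ltW q'1).
move=> /(_ (ltW B1) F1 F2).
rewrite -/y1 in D1; rewrite -/y2 in D2; rewrite -/q in D3.
move: (crd x 1) (crd x 2) (crd x 3) D1 D2 D3 q'1 => x1 x2 p D1 D2 D3 q'1 {F1 F2 B1 B2 xb yx} BB.
have err (u v u' v' : C) : cmod (u - u') < d -> cmod (v - v') < d ->
    cmod v <= M -> cmod (u - v^* * q) <= cmod (u' - v'^* * p) + (d + d * 1 + M * d).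
  move=> uu vv vM.
  have -> : u - v^* * q = (u' - v'^* * p) + ((u - u') - (v - v')^* * p - v^* * (q - p)).
    by rewrite rmorphB; ring.
  apply: le_trans (cmodD _ _) _; rewrite lerD2l.
  apply: le_trans (cmodB _ _) _; apply: lerD.
    apply: le_trans (cmodB _ _) _; apply: lerD; first exact: ltW.
    by rewrite cmodM cmodJ; apply: ler_pM; rewrite ?cmod_ge0 //; exact: ltW.
  by rewrite cmodM cmodJ; apply: ler_pM; rewrite ?cmod_ge0 //; exact: ltW.
have e1 := err _ _ _ _ D1 D2; have e2 := err _ _ _ _ D2 D1.
have q2 : cmod q ^+ 2 <= cmod p ^+ 2 + 3 * d.
  have qp : cmod q <= cmod p + d by have := cmodB_ge q p; lra.
  apply: le_trans (sqr_mono c0 qp) _.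
  have pd : 0 <= (1 - cmod p) * d by rewrite mulr_ge0 ?subr_ge0 // ltW.
  have dd : 0 <= (1 - d) * d by rewrite mulr_ge0 ?subr_ge0 // ltW.
  lra.
have y1M : cmod y1 <= M by rewrite /M; lra.
have y2M : cmod y2 <= M by rewrite /M; lra.
have := e1 y2M; have := e2 y1M.
have dM1 : d <= d * M by rewrite ler_peMr // ltW.
have dM0 : 0 < d * M by rewrite mulr_gt0 //; lra.
rewrite -/y1 -/y2 -/q /eta /L in dM *; lra.
Qed.

End Closure.

(** * Equivalence of C3 and C6 to C10, and the betas of C11 *)

Section Conditions.
Variable R : realType.
Local Notation C := R[i].

Lemma crd0 n k : (0 < k)%N -> crd (0 : 'rV[C]_n) k = 0.
Proof. by case: k => // k _; rewrite /crd; case: insub => //= i; rewrite mxE. Qed.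

Lemma cdiff_crd n (psi : C -> 'rV[C]_n) (k : nat) (z : C) :
  derivable (psi : C^o -> 'rV[C^o]_n) z 1 -> cdiff (fun w => crd (psi w) k) z.
Proof.
move=> /derivable_entries dpsi; case: k => [|k]; first exact: cdiff_cst.
by rewrite /crd; case: insub => [i|] /=; [exact: dpsi|exact: cdiff_cst].
Qed.

Definition pchub n (y : 'rV[C]_n) (l : C) (j : nat) : Prop :=
  chub (crd y j / 'C(n, j)%:R / l) (crd y (n - j) / 'C(n, j)%:R) (crd y n / l).

Section Point.
Variables (n : nat) (y : 'rV[C]_n) (l0 : C).
Hypotheses (n2 : (2 <= n)%N) (yG : symG y) (l01 : disc l0) (l0n : l0 != 0).

Let m0 : 0 < cmod l0. Proof. by rewrite cmod_gt0. Qed.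

Let half_range j : (1 <= j <= n./2)%N -> (1 <= j < n)%N.
Proof.
move=> /andP[-> jn] /=; apply: leq_ltn_trans jn _.
by rewrite -divn2 ltn_Pdiv // (leq_trans _ n2).
Qed.

Lemma sub_range j : (1 <= j < n)%N -> (1 <= n - j < n)%N.
Proof.
by move=> /andP[j0 jn]; rewrite subn_gt0 jn ltn_subrL j0 (leq_trans _ n2).
Qed.

Lemma bin_compl j : (1 <= j < n)%N -> 'C(n, n - j) = 'C(n, j).
Proof. by move=> /andP[_ jn]; rewrite bin_sub // ltnW. Qed.

Let N0 j : (1 <= j < n)%N -> (0 < 'C(n, j))%N.
Proof. by move=> /andP[_ jn]; rewrite bin_gt0 ltnW. Qed.

Let Nn j : (1 <= j < n)%N -> ('C(n, j)%:R : C) != 0.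
Proof. by move=> /N0; rewrite pnatr_eq0 -lt0n. Qed.

Lemma pchub_compl j : (1 <= j < n)%N -> pchub y l0 (n - j) <->
  chub (crd y (n - j) / 'C(n, j)%:R / l0) (crd y j / 'C(n, j)%:R) (crd y n / l0).
Proof. by move=> jn; rewrite /pchub bin_compl // subKn //; case/andP: jn => _ /ltnW. Qed.

Let E1 j (jn : (1 <= j < n)%N) u :
  u = 'C(n, j)%:R * l0 * (u / 'C(n, j)%:R / l0).
Proof. by field; rewrite ?l0n ?Nn. Qed.
Let E2 j (jn : (1 <= j < n)%N) u : u = 'C(n, j)%:R * (u / 'C(n, j)%:R) :> C.
Proof. by field; rewrite ?l0n ?Nn. Qed.
Let E3 : crd y n = l0 * (crd y n / l0). Proof. by field. Qed.
Let yb j (jn : (1 <= j < n)%N) : cmod (crd y (n - j)) < 'C(n, j)%:R.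
Proof. by case: (symG_chub yG jn). Qed.
Let ya j (jn : (1 <= j < n)%N) : cmod (crd y j) < 'C(n, j)%:R.
Proof. by case: (symG_chub yG jn). Qed.

Lemma Phi_pchub j : (1 <= j < n)%N ->
  (Hinf (fun z => Phi j z y) <= (cmod l0)%:E)%E <-> pchub y l0 j.
Proof.
move=> jn; have x21 : cmod (crd y (n - j) / 'C(n, j)%:R) < 1.
  by rewrite cmodM cmodV cmod_nat ltr_pdivrMr ?mul1r ?yb // ltr0n N0.
rewrite Hinf_leP; split=> [H|hb z z1].
  apply: mobius_chub => // z z1; have := H z z1; rewrite PhiE ?N0 ?yb // cmodM cmodV.
  rewrite ler_pdivrMr ?cmod_gt0 ?mobius_den ?disc_le1 // => Hz.
  rewrite -(ler_pM2l m0); apply: le_trans Hz; rewrite -cmodM.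
  by rewrite le_eqVlt; apply/orP; left; apply/eqP; congr cmod; field; rewrite ?l0n ?Nn.
rewrite PhiE ?N0 ?yb // cmodM cmodV.
rewrite ler_pdivrMr ?cmod_gt0 ?mobius_den ?disc_le1 //.
have := chub_mobius hb (disc_le1 z1); rewrite -(ler_pM2l m0) -cmodM; apply: le_trans.
by rewrite le_eqVlt; apply/orP; left; apply/eqP; congr cmod; field; rewrite ?l0n ?Nn.
Qed.

(** The common target of the equivalences: of C3 and C6 to C10 in every dimension, of all conditions
    for [n = 2]. *)
Definition both_pchub : Prop := forall j : nat, (1 <= j <= n./2)%N ->
  (cmod (crd y (n - j)) <= cmod (crd y j) -> pchub y l0 j) /\
  (cmod (crd y j) <= cmod (crd y (n - j)) -> pchub y l0 (n - j)).

Lemma both_pchub_iff (P Q : nat -> Prop) :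
  (forall j, (1 <= j < n)%N -> P j <-> pchub y l0 j) ->
  (forall j, (1 <= j < n)%N -> Q j <-> pchub y l0 (n - j)) ->
  (forall j : nat, (1 <= j <= n./2)%N ->
    (cmod (crd y (n - j)) <= cmod (crd y j) -> P j) /\
    (cmod (crd y j) <= cmod (crd y (n - j)) -> Q j)) <-> both_pchub.
Proof.
move=> HP HQ; split=> H j jn; have jn' := half_range jn; have [h1 h2] := H j jn.
  by split=> h; [apply/(HP _ jn')/h1|apply/(HQ _ jn')/h2].
by split=> h; [apply/(HP _ jn')/h1|apply/(HQ _ jn')/h2].
Qed.

Lemma condC3_iff : condC3 y l0 <-> both_pchub.
Proof.
apply: both_pchub_iff => j jn; first exact: Phi_pchub.
by apply: Phi_pchub; exact: sub_range.
Qed.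

Lemma condC6_iff : condC6 y l0 <-> both_pchub.
Proof.
apply: both_pchub_iff => j jn.
  exact: scaled_c6 (N0 jn) l0n (E1 jn _) (E2 jn _) E3 (yb jn).
rewrite pchub_compl // (mulrC (crd y j)).
exact: scaled_c6 (N0 jn) l0n (E1 jn _) (E2 jn _) E3 (ya jn).
Qed.

Lemma condC7_iff : condC7 y l0 <-> both_pchub.
Proof.
apply: both_pchub_iff => j jn.
  exact: scaled_c7 (N0 jn) l0n (E1 jn _) (E2 jn _) E3 (yb jn).
rewrite pchub_compl //.
exact: scaled_c7 (N0 jn) l0n (E1 jn _) (E2 jn _) E3 (ya jn).
Qed.

Lemma condC8_iff : condC8 y l0 <-> both_pchub.
Proof.
apply: both_pchub_iff => j jn.
  exact: scaled_c8 (N0 jn) l0n (E1 jn _) (E2 jn _) E3 (yb jn).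
rewrite pchub_compl //.
exact: scaled_c8 (N0 jn) l0n (E1 jn _) (E2 jn _) E3 (ya jn).
Qed.

Lemma condC10_iff : condC10 y l0 <-> both_pchub.
Proof.
apply: both_pchub_iff => j jn.
  exact: scaled_c10 (N0 jn) l0n (E1 jn _) (E2 jn _) E3 (yb jn).
rewrite pchub_compl //.
exact: scaled_c10 (N0 jn) l0n (E1 jn _) (E2 jn _) E3 (ya jn).
Qed.

Lemma both_pchub_q : both_pchub -> cmod (crd y n) <= cmod l0.
Proof.
move=> H; have [|h1 h2] := H 1%N; first by rewrite half_gt0.
have [/h1|/ltW/h2] := leP (cmod (crd y (n - 1))) (cmod (crd y 1)); move=> [+ _];
  by rewrite cmodM cmodV ler_pdivrMr // mul1r.
Qed.

Lemma condC9_iff : condC9 y l0 <-> both_pchub.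
Proof.
rewrite -(both_pchub_iff (P := fun j => _ /\ _) (Q := fun j => _ /\ _)
  (fun j jn => scaled_c9 (N0 jn) l0n (E1 jn _) (E2 jn _) E3)
  (fun j jn => iff_trans (scaled_c9 (N0 jn) l0n (E1 jn _) (E2 jn _) E3)
                         (iff_sym (pchub_compl jn)))).
(* C9 states the bound on [q] once, [scaled_c9] for each index; the way back uses [j = 1], available
   since [2 <= n]. *)
split=> [[ql H] j jn|H].
  have [h1 h2] := H j jn; rewrite (mulrC (crd y (n - j))).
  by split=> h; split; auto.
split=> [|j jn]; last first.
  have [h1 h2] := H j jn; split=> h; first by case: (h1 h).
  by rewrite (mulrC (crd y j)); case: (h2 h).
have [|h1 h2] := H 1%N; first by rewrite half_gt0.
by have [/h1|/ltW/h2] := leP (cmod (crd y (n - 1))) (cmod (crd y 1)); case.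
Qed.

(** [y_fst] and [y_snd] agree with [ytilde] at [j] and [n - j], but also handle the middle index of
    an even [n], where they are the two different numbers [y_j / l0] and [y_j]. *)
Definition y_fst j : C := if cmod (crd y (n - j)) <= cmod (crd y j)
  then crd y j / l0 else crd y j.
Definition y_snd j : C := if cmod (crd y (n - j)) <= cmod (crd y j)
  then crd y (n - j) else crd y (n - j) / l0.

Lemma both_pchub_betas : both_pchub -> exists b1 b2 : nat -> C,
  forall j, (1 <= j <= n./2)%N ->
  [/\ cmod (b1 j) + cmod (b2 j) <= 'C(n, j)%:R,
      y_fst j = b1 j + (b2 j)^* * (crd y n / l0)
    & y_snd j = b2 j + (b1 j)^* * (crd y n / l0)].
Proof.
move=> H.
have {H} : forall j, exists b : C * C, (1 <= j <= n./2)%N ->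
  [/\ cmod b.1 + cmod b.2 <= 'C(n, j)%:R,
      y_fst j = b.1 + b.2^* * (crd y n / l0)
    & y_snd j = b.2 + b.1^* * (crd y n / l0)].
  move=> j; case: (boolP (1 <= j <= n./2)%N) => [jn|_]; last by exists (0, 0).
  have jn' := half_range jn; have [h1 h2] := H j jn; rewrite /y_fst /y_snd.
  have sc b1 b2 y1 y2 : y1 = b1 * l0 + b2^* * crd y n ->
      y2 * l0 = b2 * l0 + b1^* * crd y n ->
      y1 / l0 = b1 + b2^* * (crd y n / l0) /\ y2 = b2 + b1^* * (crd y n / l0).
    move=> e1 e2; split; first by rewrite e1; field.
    by apply: (mulIf l0n); rewrite e2; field.
  case: ifPn => [/h1|]; last rewrite -ltNge => /ltW/h2/(pchub_compl jn').
    move/(scaled_c11 (N0 jn') l0n (E1 jn' _) (E2 jn' _) E3 (yb jn')).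
    move=> [_ [b1 [b2 [bN F1 F2]]]]; exists (b1, b2) => _.
    by have [] := sc _ _ _ _ F1 F2.
  (* Here [y_(n-j)] is the first coordinate, so the betas come out in the opposite order. *)
  move/(scaled_c11 (N0 jn') l0n (E1 jn' _) (E2 jn' _) E3 (ya jn')).
  move=> [_ [b1 [b2 [bN F1 F2]]]]; exists (b2, b1) => _.
  by have [] := sc _ _ _ _ F1 F2; split=> //=; rewrite addrC.
move=> /choice[b Hb]; exists (fun j => (b j).1), (fun j => (b j).2).
exact: Hb.
Qed.

Lemma both_pchub_C11 : both_pchub -> condC11 y l0.
Proof.
move=> H; have ql := both_pchub_q H; have [b1 [b2 Hb]] := both_pchub_betas H.
have concl j c1 c2 : (1 <= j <= n./2)%N -> c1 = b1 j -> c2 = b2 j ->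
  [/\ cmod c1 + cmod c2 <= 'C(n, j)%:R,
      cmod (crd y (n - j)) <= cmod (crd y j) ->
        crd y j = c1 * l0 + c2^* * crd y n /\
        crd y (n - j) * l0 = c2 * l0 + c1^* * crd y n
    & cmod (crd y j) < cmod (crd y (n - j)) ->
        crd y j * l0 = c1 * l0 + c2^* * crd y n /\
        crd y (n - j) = c2 * l0 + c1^* * crd y n].
  move=> jn -> ->; have := Hb j jn; rewrite /y_fst /y_snd.
  case: ifPn => le [bN F1 F2]; split=> // h.
  - split; last by rewrite F2; field.
    by apply: (mulIf (invr_neq0 l0n)); rewrite F1; field.
  - by move: h; rewrite ltNge le.
  - split; first by rewrite F1; field.
    by apply: (mulIf (invr_neq0 l0n)); rewrite F2; field.
have n0 : (0 < n)%N by exact: leq_trans n2.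
split=> // [on|en].
  pose F k := if (k <= n./2)%N then b1 k else b2 (n - k)%N.
  exists (\row_(i < n.-1) F i.+1) => j jn; have /andP[j0 jn'] := half_range jn.
  have nj : (0 < n - j <= n.-1)%N.
    by case/andP: (sub_range (half_range jn)) => -> ?; rewrite -ltnS prednK.
  have jn2 : (0 < j <= n.-1)%N by rewrite j0 -ltnS prednK.
  apply: concl => //; rewrite (crd_row F) // /F; first by case/andP: jn => _ ->.
  rewrite subKn ?(ltnW jn') // leqNgt; case: ifPn => //; rewrite -ltnNge => nh.
  exfalso; move: nh jn => /[swap] /andP[_ jh]; rewrite ltnS leq_subLR => nh.
  have := odd_double_half n; rewrite on -addnn => nE.
  by move: nh; rewrite -{1}nE add1n ltnNge leq_add2r jh.
(* The shift to [n + 1] gives the middle index two separate betas, at [n / 2] and [n / 2 + 1]. *)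
pose F k := if (k <= n./2)%N then b1 k else b2 (n.+1 - k)%N.
exists (\row_(i < n) F i.+1) => j jn; have /andP[j0 jn'] := half_range jn.
have nj : (0 < n.+1 - j <= n)%N.
  by rewrite subn_gt0 ltnS (ltnW jn') leq_subLR -add1n leq_add2r j0.
have jn2 : (0 < j <= n)%N by rewrite j0 ltnW.
apply: concl => //; rewrite (crd_row F) // /F; first by case/andP: jn => _ ->.
have -> : (n.+1 - j <= n./2)%N = false.
  apply/negbTE; rewrite -ltnNge ltn_subRL; case/andP: jn => _ jh.
  have := odd_double_half n; rewrite (negPf en) add0n -addnn => nE.
  by rewrite ltnS -[leqRHS]nE leq_add2r.
by rewrite subKn // ltnW // ltnW.
Qed.

End Point.
End Conditions.

(** * Consequences of interpolation, and C4 and C5 *)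

Section MoreConditions.
Variable R : realType.
Local Notation C := R[i].

(** An odd [N] has no middle index: [1..h] and its mirror image exhaust the coordinates below [N],
    so the betas of each pair can be prescribed freely. It serves with [N = n] or [N = n + 1],
    whichever is odd. *)
Lemma extGamma_halves N h (y : 'rV[C]_N) (c1 c2 : nat -> C) : N = (h + h).+1 ->
  cmod (crd y N) <= 1 ->
  (forall j, (1 <= j <= h)%N ->
    [/\ cmod (c1 j) + cmod (c2 j) <= 'C(N, j)%:R,
        crd y j = c1 j + (c2 j)^* * crd y N
      & crd y (N - j) = c2 j + (c1 j)^* * crd y N]) ->
  extGamma y.
Proof.
move=> NE q1 H; pose b k := if (k <= h)%N then c1 k else c2 (N - k)%N.
have big j : (1 <= j <= h)%N -> b (N - j)%N = c2 j.
  move=> jr; by rewrite /b ifN ?subKn //; lia.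
apply: (@extGamma_beta _ _ _ b) => //; first by rewrite NE.
move=> j /andP[j0 jN]; have [jh|hj] := leqP j h.
  have jr : (1 <= j <= h)%N by rewrite j0.
  by have [B F1 _] := H j jr; rewrite big // /b jh.
have kr : (1 <= N - j <= h)%N.
  rewrite subn_gt0 jN leq_subLR NE -addSn; exact: leq_add.
have [B _] := H _ kr; rewrite subKn ?(ltnW jN) // => F2.
have bj : b j = c2 (N - j)%N by rewrite -(big _ kr) subKn // ltnW.
rewrite bj /b; case/andP: (kr) => _ ->; split=> //.
by rewrite addrC -bin_sub // ltnW.
Qed.

Lemma all_pchub_interp n (y : 'rV[C]_n) l0 j : (2 <= n)%N -> disc l0 -> l0 != 0 ->
  symG y -> interpolates y l0 -> (1 <= j < n)%N -> pchub y l0 j.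
Proof.
move=> n2 l01 l0n yG [psi [dpsi psiG psi0 psil]] jn.
have [j0 jn'] := andP jn; have [nj0 njn] := andP (sub_range n2 jn).
have N0 : (0 < 'C(n, j))%N by rewrite bin_gt0 ltnW.
have NR : (0 : R) < 'C(n, j)%:R by rewrite ltr0n.
have NC : ('C(n, j)%:R : C) != 0 by rewrite pnatr_eq0 -lt0n.
have x2lt (u : 'rV[C]_n) : symG u -> cmod (crd u (n - j) / 'C(n, j)%:R) < 1.
  by move=> /symG_chub/(_ jn)[_ _ ?]; rewrite cmodM cmodV cmod_nat ltr_pdivrMr ?mul1r.
apply: mobius_chub => [|z z1]; first exact: x2lt.
pose phi l := (crd (psi l) n * z - crd (psi l) j / 'C(n, j)%:R)
              / (crd (psi l) (n - j) / 'C(n, j)%:R * z - 1).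
have den l : disc l -> crd (psi l) (n - j) / 'C(n, j)%:R * z - 1 != 0.
  by move=> l1; apply: mobius_den; [exact/x2lt/psiG|exact: disc_le1].
have dphi l : disc l -> cdiff phi l.
  move=> l1; have d k : cdiff (fun w => crd (psi w) k) l by apply/cdiff_crd/dpsi.
  apply: cdiff_div; first exact: den.
    apply: cdiffB; first by apply: cdiffM; [exact: d|exact: cdiff_cst].
    by apply: cdiffM; [exact: d|exact: cdiff_cst].
  apply: cdiffB; last exact: cdiff_cst.
  by do 2 (apply: cdiffM; last exact: cdiff_cst); exact: d.
have phi1 l : disc l -> cmod (phi l) <= 1.
  move=> l1; rewrite cmodM cmodV ler_pdivrMr ?mul1r ?cmod_gt0 ?den //.
  have [hb _ _] := symG_chub (psiG _ l1) jn.
  by apply: chub_mobius; rewrite ?disc_le1.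
have phi0 : phi 0 = 0.
  by rewrite /phi psi0 !crd0 ?mul0r ?subrr ?mul0r // (leq_trans _ n2).
have := schwarz dphi phi1 phi0 l01.
rewrite {1}/phi psil cmodM cmodV ler_pdivrMr; last by rewrite cmod_gt0 -psil den.
move=> S.
have -> : crd y n / l0 * z - crd y j / 'C(n, j)%:R / l0 =
    (crd y n * z - crd y j / 'C(n, j)%:R) / l0 by field; rewrite l0n NC.
by rewrite cmodM cmodV ler_pdivrMr ?cmod_gt0 // [leRHS]mulrC.
Qed.

Lemma interp_ratio n (y : 'rV[C]_n) l0 : (2 <= n)%N -> disc l0 ->
  symG y -> interpolates y l0 -> ratio_bound y l0.
Proof.
move=> n2 l01 yG [psi [dpsi psiG psi0 psil]]; have n0 : (0 < n)%N by exact: leq_trans n2.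
rewrite /ratio_bound /=; apply: ge_ereal_sup => _ [z z1 <-]; rewrite lee_fin.
rewrite -/(rnum y z) -/(rden y z).
pose phi l := rnum (psi l) z / rden (psi l) z.
have lt l : disc l -> cmod (rnum (psi l) z) < cmod (rden (psi l) z).
  by move=> l1; apply: ratio_lt => //; exact: psiG.
have den l : disc l -> rden (psi l) z != 0.
  by move=> /lt; rewrite -cmod_gt0; apply: le_lt_trans; exact: cmod_ge0.
have dphi l : disc l -> cdiff phi l.
  move=> l1; have d k : cdiff (fun w => crd (psi w) k) l by apply/cdiff_crd/dpsi.
  apply: cdiff_div; first exact: den.
    apply: cdiff_sum => k _; apply: cdiffM; last exact: cdiff_cst.
    by apply: cdiffM; [exact: cdiff_cst|exact: d].
  apply: cdiff_sum => k _; apply: cdiffM; last exact: cdiff_cst.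
  by apply: cdiffM; [exact: cdiff_cst|exact: d].
have phi1 l : disc l -> cmod (phi l) <= 1.
  by move=> l1; rewrite cmodM cmodV ler_pdivrMr ?mul1r ?cmod_gt0 ?den // ltW ?lt.
have phi0 : phi 0 = 0.
  rewrite /phi psi0 [X in X / _](_ : _ = 0) ?mul0r //.
  by rewrite /rnum big_nat big1 // => k /andP[k0 _]; rewrite crd0 // mulr0 mul0r.
by have := schwarz dphi phi1 phi0 l01; rewrite {1}/phi psil.
Qed.

Section Point.
Variables (n : nat) (y : 'rV[C]_n) (l0 : C).
Hypotheses (n2 : (2 <= n)%N) (yG : symG y) (l01 : disc l0) (l0n : l0 != 0).

Let n0 : (0 < n)%N. Proof. exact: leq_trans n2. Qed.

Let half_range j : (1 <= j <= n./2)%N -> (1 <= j < n)%N.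
Proof.
move=> /andP[-> jn] /=; apply: leq_ltn_trans jn _.
by rewrite -divn2 ltn_Pdiv.
Qed.

Lemma interp_both_pchub : interpolates y l0 -> both_pchub y l0.
Proof.
move=> I j /half_range jn; split=> _; first exact: all_pchub_interp.
by apply: all_pchub_interp => //; exact: sub_range.
Qed.

Lemma interp_C2 : interpolates y l0 -> condC2 y l0.
Proof.
move=> I; rewrite /condC2 big_nat.
apply: (big_ind (fun x => x <= (cmod l0)%:E)%E) => [|a b ha hb|j jn].
- exact: leNye.
- by rewrite ge_max ha.
- by apply/Phi_pchub => //; exact: all_pchub_interp.
Qed.

Lemma both_pchub_C4 : both_pchub y l0 -> condC4 y l0.
Proof.
move=> H; have ql : cmod (crd y n / l0) <= 1.
  by rewrite cmodM cmodV ler_pdivrMr ?mul1r ?cmod_gt0 // both_pchub_q.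
have [b1 [b2 Hb]] := both_pchub_betas n2 yG l0n H.
have fst_tilde j : (j <= n./2)%N -> ytilde y l0 j = y_fst y l0 j.
  by move=> jh; rewrite /ytilde jh.
have snd_tilde j : (j <= n./2)%N -> (j < n - j)%N -> ytilde y l0 (n - j) = y_snd y l0 j.
  move=> jh lt; have hj : (n - j <= n./2)%N = false by lia.
  by rewrite /ytilde hj subKn //; lia.
split=> [on|en].
  pose F k := if k == n then crd y n / l0 else ytilde y l0 k.
  have FE k : (0 < k <= n)%N -> crd (pt_tilde y l0) k = F k by exact: crd_row.
  apply: (@extGamma_halves n n./2 _ b1 b2) => [||j jn]; first by lia.
    by rewrite FE ?n0 ?leqnn // /F eqxx.
  have /andP[j0 jn'] := half_range jn; have [bN B1 B2] := Hb j jn; split=> //.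
    rewrite !FE ?j0 ?n0 ?leqnn ?(ltnW jn') // /F eqxx (ltn_eqF jn') fst_tilde //.
    by case/andP: jn.
  rewrite !FE ?n0 ?leqnn ?subn_gt0 ?jn' ?leq_subr // /F eqxx ltn_eqF; last first.
    by rewrite ltn_subrL j0.
  by rewrite snd_tilde //; lia.
have nE : n = (n./2 + n./2)%N by lia.
have h0 : (0 < n./2)%N by rewrite half_gt0.
have hn : (n - n./2)%N = n./2 by lia.
(* Since ['C(n.+1, k) = s k * 'C(n, k)], the factor [s k] turns betas for dimension [n] into betas
   for dimension [n + 1]; at [k = n / 2] it is [(n + 1) / (n / 2 + 1)]. *)
pose s k : C := n.+1%:R / (n.+1 - k)%:R.
pose F k := if k == n.+1 then crd y n / l0 else yhat y l0 k.
have FE k : (0 < k <= n.+1)%N -> crd (pt_hat y l0) k = F k by exact: crd_row.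
have sJ k : Num.conj (s k) = s k by rewrite /s rmorphM fmorphV /= !rmorph_nat.
have cs k : cmod (s k) = n.+1%:R / (n.+1 - k)%:R by rewrite cmodM cmodV !cmod_nat.
have fst_hat k : (1 <= k <= n./2)%N -> yhat y l0 k = s k * y_fst y l0 k.
  move=> /andP[k0 kh]; rewrite /yhat; case: eqP => [->|/eqP kne].
    rewrite /y_fst hn lexx /s; congr (_ / _%:R * _).
    by lia.
  have kh' : (k < n./2)%N by rewrite ltn_neqAle kne.
  by rewrite ltn_eqF ?kh' ?(ltn_trans kh') // fst_tilde.
have snd_hat k : (1 <= k <= n./2)%N -> yhat y l0 (n.+1 - k) = s k * y_snd y l0 k.
  move=> /andP[k0 kh]; have kn : (k <= n)%N by lia.
  rewrite /yhat subSn //.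
  have hk : (n./2 <= n - k)%N by lia.
  rewrite gtn_eqF ?ltnS // eqSS; case: eqP => [E|/eqP kne].
    have kE : k = n./2 by lia.
    rewrite kE /y_snd hn lexx /s; congr (_ / _%:R * _); lia.
  have kh' : (k < n./2)%N.
    by lia.
  have kk : (n.+1 - (n - k).+1)%N = k by lia.
  rewrite ltnNge ltnW ?ltnS //= kk.
  by rewrite snd_tilde //; lia.
clearbody s.
apply: (@extGamma_halves n.+1 n./2 _ (fun k => s k * b1 k) (fun k => s k * b2 k)) => [||j jn].
- by lia.
- by rewrite FE ?leqnn // /F eqxx.
have /andP[j0 jn'] := half_range jn; have [bN B1 B2] := Hb j jn.
have jn1 : (j < n.+1)%N by exact: leqW.
have sub0 : (0 : R) < (n.+1 - j)%:R by rewrite ltr0n subn_gt0.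
split.
- rewrite !cmodM -mulrDr cs mulrAC ler_pdivrMr //.
  apply: le_trans (ler_wpM2l (ler0n _ _) bN) _.
  by rewrite -!natrM ler_nat (mul_bin_down n.+1 j) mulnC.
- rewrite !FE ?j0 ?leqnn ?(ltnW jn1) // /F eqxx (ltn_eqF jn1) fst_hat //.
  by rewrite B1 rmorphM /= sJ; ring.
- rewrite !FE ?leqnn ?subn_gt0 ?jn1 ?leq_subr // /F eqxx ltn_eqF; last first.
    by rewrite ltn_subrL j0.
  by rewrite snd_hat // B2 rmorphM /= sJ; ring.
Qed.

(** The diagonal entry of larger modulus carries the factor [l], so the two cases use [F] and its
    antidiagonal reflection; the other diagonal entry vanishes at 0 by [EP]. *)
Lemma both_pchub_C5 : both_pchub y l0 -> condC5 y l0.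
Proof.
move=> H.
suff : forall j, exists F : C -> 'M[C]_2, (1 <= j <= n./2)%N ->
    [/\ schur F, [/\ F 0 0 0 = 0, F 0 1 0 = 0 & F 0 1 1 = 0], \det (F l0) = crd y n &
        crd y j = 'C(n, j)%:R * F l0 0 0 /\ crd y (n - j) = 'C(n, j)%:R * F l0 1 1].
  move=> /choice[F HF]; exists F, (fun j => F j l0) => j jn.
  by have [? ? ? ?] := HF j jn; split.
move=> j; case: (boolP (1 <= j <= n./2)%N) => [jn|_]; last by exists (fun=> 0).
have jn' := half_range jn; have [h1 h2] := H j jn.
have NC : ('C(n, j)%:R : C) != 0.
  by rewrite pnatr_eq0 -lt0n bin_gt0 ltnW //; case/andP: jn'.
have [_ ya yb] := symG_chub yG jn'.
have NR : (0 : R) < 'C(n, j)%:R by apply: le_lt_trans ya; exact: cmod_ge0.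
have d00 : disc (0 : C) by rewrite /disc /mkset cmod0.
have dv (u v : C) : cmod u <= cmod v -> cmod (u / 'C(n, j)%:R) <= cmod (v / 'C(n, j)%:R).
  by move=> uv; rewrite !cmodM ler_wpM2r ?cmod_ge0.
have lt1 (u : C) : cmod u < 'C(n, j)%:R -> cmod (u / 'C(n, j)%:R) < 1.
  by move=> u1; rewrite cmodM cmodV cmod_nat ltr_pdivrMr // mul1r.
have [le|/ltW le] := leP (cmod (crd y (n - j))) (cmod (crd y j)).
  have [b1 [b2 [rho [P [[dP P1 bb _] EP Q1 Q2 Q3]]]]] :=
    tetrablock_interpolation l01 l0n (dv _ _ le) (lt1 _ yb) (h1 le).
  have [f [g [sF _ detF _]]] := schur_interpolation dP P1 bb.
  exists (fun l => mat2 (l * (b1 + b2^* * P l)) (f l) (l * g l) (b2 + b1^* * P l)) => _.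
  split=> //; last first.
  - by rewrite !mxE /= -Q1 -Q2; split; field.
  - by rewrite detF -Q3.
  - by rewrite !mxE /= !mul0r EP // mulr0 mul0r.
have := h2 le; rewrite pchub_compl // => hb.
have [b1 [b2 [rho [P [[dP P1 bb _] EP Q1 Q2 Q3]]]]] :=
  tetrablock_interpolation l01 l0n (dv _ _ le) (lt1 _ ya) hb.
have [f [g [_ sF _ detF]]] := schur_interpolation dP P1 bb.
exists (fun l => mat2 (b2 + b1^* * P l) (f l) (l * g l) (l * (b1 + b2^* * P l))) => _.
split=> //; last first.
- by rewrite !mxE /= -Q1 -Q2; split; field.
- by rewrite detF -Q3.
- by rewrite !mxE /= !mul0r EP // mulr0 mul0r.
Qed.

End Point.

End MoreConditions.

(** * The converse for [n = 2] *)

Section DimensionTwo.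
Variable R : realType.
Local Notation C := R[i].

(** The sum is read off from [prod_expand] at 1, where the product equals [1 - e1 + e2]. *)
Lemma esym2 (z : 'rV[C]_2) :
  Defs.esym z 1 = z ord0 0 + z ord0 1 /\ Defs.esym z 2 = z ord0 0 * z ord0 1.
Proof.
have o1 : lift ord0 ord0 = 1 :> 'I_2 by apply/val_inj.
have E2 : Defs.esym z 2 = z ord0 0 * z ord0 1.
  by rewrite esym_full !big_ord_recl big_ord0 mulr1 o1.
split=> //; have := congr1 (fun p => p.[1]) (prod_expand z).
rewrite horner_prod horner_sum !big_ord_recl !big_ord0 mulr1 addr0 !horner_lin o1.
rewrite !hornerZ !hornerXn !expr1n esym0 /= /bump /= E2 => H.
have -> : Defs.esym z 1 = 1 + z ord0 0 * z ord0 1 - (1 - z ord0 0 * 1) * (1 - z ord0 1 * 1).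
  by rewrite H; ring.
by ring.
Qed.

(** If [|t| >= 1], take [z = 1 / t]: the two sides become [|x - t|] and [|x - t| / |t|], a
    contradiction. *)
Lemma mobius_root (x p t t' : C) :
  (forall z : C, cmod z <= 1 -> cmod (p * z - x) < cmod (x * z - 1)) ->
  t + t' = 2 * x -> t * t' = p -> disc t.
Proof.
move=> H ts tp; rewrite /disc /mkset ltNge; apply/negP => t1.
have t0 : 0 < cmod t by lra.
have tn : t != 0 by rewrite -cmod_gt0.
have := H t^-1; rewrite cmodV invf_le1 // => /(_ t1).
rewrite (_ : p / t - x = x - t); last first.
  by rewrite -tp (mulrC t) mulfK // -[t'](addKr t) ts; ring.
rewrite (_ : x / t - 1 = (x - t) / t); last by field.
rewrite cmodM cmodV ltr_pdivlMr // ltNge => /negP; apply.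
by rewrite ler_peMr ?cmod_ge0.
Qed.

Lemma symG2 (y : 'rV[C]_2) :
  (forall z : C, cmod z <= 1 ->
     cmod (crd y 2 * z - crd y 1 / 2) < cmod (crd y 1 / 2 * z - 1)) -> symG y.
Proof.
move=> H; pose x := crd y 1 / 2; pose w := sqrtc (x ^+ 2 - crd y 2).
have w2 : w ^+ 2 = x ^+ 2 - crd y 2 by rewrite /w sqr_sqrtc.
have P1 : (x + w) * (x - w) = crd y 2.
  by rewrite mulrC -subr_sqr w2; ring.
have d1 : disc (x + w) by apply: (mobius_root H) P1; rewrite -/x; ring.
have d2 : disc (x - w).
  by apply: (mobius_root H (t' := x + w)); [rewrite -/x; ring|rewrite mulrC].
pose z : 'rV[C]_2 := \row_i if i == 0 then x + w else x - w.
exists z; first by move=> i; rewrite /z mxE; case: ifP.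
have [e1 e2] := esym2 z.
have zE0 : z ord0 0 = x + w by rewrite mxE.
have zE1 : z ord0 1 = x - w by rewrite mxE.
apply/rowP => i; rewrite [LHS]mxE (crd_ord y); case: i => -[|[|//]] ilt.
  by rewrite -[RHS]/(crd y 1) e1 zE0 zE1 /x; field.
by rewrite -[RHS]/(crd y 2) e2 zE0 zE1.
Qed.

(** Apply the contraction to [(1 - M11 z, M10 z)]: its image is [(M00 - det M z, M10)], and
    [|M10 z| <= |M10|]. *)
Lemma contr2_mobius (M : 'M[C]_2) (z : C) : contr2 M -> cmod z <= 1 ->
  cmod (\det M * z - M 0 0) <= cmod (M 1 1 * z - 1).
Proof.
move=> cM z1; have := cM (1 - M 1 1 * z) (M 1 0 * z).
have -> : M 0 0 * (1 - M 1 1 * z) + M 0 1 * (M 1 0 * z) = M 0 0 - \det M * z.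
  by rewrite det_mx2; ring.
have -> : M 1 0 * (1 - M 1 1 * z) + M 1 1 * (M 1 0 * z) = M 1 0 by ring.
rewrite cmodC (cmodC 1) => H; apply: sqr_leE; first exact: cmod_ge0.
have : cmod (M 1 0 * z) ^+ 2 <= cmod (M 1 0) ^+ 2.
  by apply: sqr_mono; rewrite ?cmod_ge0 // cmodM ler_piMr ?cmod_ge0.
lra.
Qed.

Lemma contr2_le1 (M : 'M[C]_2) : contr2 M -> cmod (M 1 1) <= 1.
Proof.
move=> /(_ 0 1); rewrite !mulr0 !mulr1 !add0r cmod0 cmod1 expr0n expr1n /= => H.
apply: sqr_leE => //; rewrite expr1n.
by have := sqr_ge0 (cmod (M 0 1)); lra.
Qed.

Variables (y : 'rV[C]_2) (l0 : C).
Hypotheses (yG : symG y) (l01 : disc l0) (l0n : l0 != 0).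

Let y12 : cmod (crd y 1) < 2.
Proof. by have [] := @symG_chub _ _ y 1 yG isT. Qed.

Let x1lt : cmod (crd y 1 / 2) < 1.
Proof. by rewrite cmodM cmodV cmod_nat ltr_pdivrMr // mul1r. Qed.

Lemma both_pchub2 : both_pchub y l0 <-> chub (crd y 1 / 2 / l0) (crd y 1 / 2) (crd y 2 / l0).
Proof.
split=> [H|hb [|[|//]] //].
by have [h _] := H 1%N isT; exact: (h (lexx _)).
Qed.

(** With [rho = 1], put [x = b2 + b1^* P = l (b1 + b2^* P)] and [psi = (2 x, l P)]. The point
    [(b1 + b2^* P, x, P)] satisfies the weak Moebius inequality, and the additional factor [l] makes
    it strict, as [symG2] requires. *)
Lemma chub_interpolates : both_pchub y l0 -> interpolates y l0.
Proof.
move=> /both_pchub2 hb.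
have [b1 [b2 [rho [P [[dP P1 bb rho1] EP Q1 Q2 Q3]]]]] :=
  tetrablock_interpolation l01 l0n (lexx _) x1lt hb.
rewrite {}rho1 // in EP.
pose F l k : C := if k == 1%N then 2 * (b2 + b1^* * P l) else l * P l.
exists (fun l => \row_(i < 2) F l i.+1); split.
- move=> l l1; apply/derivable_entries => i j; under eq_fun do rewrite mxE.
  rewrite /F; case: eqP => _.
    apply: cdiffM; first exact: cdiff_cst.
    apply: cdiffD; first exact: cdiff_cst.
    by apply: cdiffM; [exact: cdiff_cst|exact: dP].
  by apply: cdiffM; [exact: cdiff_id|exact: dP].
- move=> l l1; apply: symG2 => z z1; rewrite !(crd_row (F l)) // /F /=.
  have -> : 2 * (b2 + b1^* * P l) / 2 = b2 + b1^* * P l by field.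
  set x := b2 + _; have xE : x = l * (b1 + b2^* * P l) by rewrite /x EP // mul1r.
  have X1 : cmod (b1 + b2^* * P l) <= 1.
    apply: le_trans bb; apply: le_trans (cmodD _ _) _; rewrite lerD2l cmodM cmodJ.
    by rewrite ler_piMr ?cmod_ge0 ?P1.
  have xl : cmod x < 1.
    by rewrite xE cmodM; apply: le_lt_trans l1; rewrite ler_piMr ?cmod_ge0.
  have M := chub_mobius (beta_chub (P1 _ l1) bb xl) z1; rewrite -/x in M.
  have x0 : 0 < cmod (x * z - 1) by rewrite cmod_gt0 mobius_den.
  rewrite {1}xE -mulrA -mulrBr cmodM.
  apply: le_lt_trans (ler_wpM2l (cmod_ge0 _) M) _.
  by rewrite gtr_pMl.
- apply/rowP => i; rewrite !mxE /F; case: eqP => _; last by rewrite mul0r.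
  by rewrite EP ?mulr0 ?mul0r ?mulr0 //; rewrite /disc /mkset cmod0.
- apply/rowP => i; rewrite mxE crd_ord; case: i => -[|[|//]] ilt.
    by rewrite -[RHS]/(crd y 1) -[LHS]/(2 * (b2 + b1^* * P l0)) -Q2; field.
  by rewrite -[RHS]/(crd y 2) -[LHS]/(l0 * P l0) -Q3.
Qed.

Lemma condC2_chub : condC2 y l0 -> both_pchub y l0.
Proof.
rewrite /condC2 big_nat1 => H; apply/both_pchub2.
exact: (Phi_pchub yG l0n (j := 1) isT).1 H.
Qed.

(** The Schwarz lemma is applied along [F] instead of [psi]: contractivity bounds the Moebius
    function, and the zeros of [F 0] make it vanish at 0. *)
Lemma condC5_chub : condC5 y l0 -> both_pchub y l0.
Proof.
move=> [F [B H]]; apply/both_pchub2; apply: mobius_chub => // z z1.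
have [[dF cF] [F00 F10 F11] FB dB [Y1 Y2]] := H 1%N isT.
rewrite -{}FB in dB Y1 Y2; move: (F 1%N) => {H B}G in dF cF F00 F10 F11 dB Y1 Y2 *.
have e1 : crd y 1 / 2 = G l0 0 0 by rewrite Y1 mulrC mulKf // pnatr_eq0.
have e2 : crd y 1 / 2 = G l0 1 1 by rewrite Y2 mulrC mulKf // pnatr_eq0.
have cG l : disc l -> contr2 (G l) by move=> /cF/contr2_opnorm.
have den l : disc l -> G l 1 1 * z - 1 != 0.
  move=> l1; have g1 := contr2_le1 (cG _ l1).
  rewrite -cmod_gt0 cmodC; apply: lt_le_trans (cmodB_ge _ _).
  rewrite cmod1 subr_gt0 cmodM; apply: le_lt_trans (z1 : cmod z < 1).
  by rewrite ler_piMl ?cmod_ge0.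
pose phi l := (\det (G l) * z - G l 0 0) / (G l 1 1 * z - 1).
have dphi l : disc l -> cdiff phi l.
  move=> l1; have d i j : cdiff (fun w => G w i j) l.
    by move: i j; apply/derivable_entries/dF.
  apply: cdiff_div; first exact: den.
    under eq_fun do rewrite det_mx2.
    apply: cdiffB; last exact: d.
    apply: cdiffM; last exact: cdiff_cst.
    by apply: cdiffB; apply: cdiffM; exact: d.
  apply: cdiffB; last exact: cdiff_cst.
  by apply: cdiffM; [exact: d|exact: cdiff_cst].
have phi1 l : disc l -> cmod (phi l) <= 1.
  move=> l1; rewrite cmodM cmodV ler_pdivrMr ?mul1r ?cmod_gt0 ?den //.
  exact: contr2_mobius (cG _ l1) (disc_le1 z1).
have phi0 : phi 0 = 0.
  by rewrite /phi det_mx2 F00 F10 !mul0r mulr0 subrr mul0r subrr mul0r.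
have := schwarz dphi phi1 phi0 l01.
rewrite {1}/phi dB -e1 -e2 cmodM cmodV ler_pdivrMr; last by rewrite cmod_gt0 e2 den.
move=> S; have -> : crd y 2 / l0 * z - crd y 1 / 2 / l0 = (crd y 2 * z - crd y 1 / 2) / l0.
  by field.
by rewrite cmodM cmodV ler_pdivrMr ?cmod_gt0 // [leRHS]mulrC.
Qed.

(** As [3 / 2 * y = 3 * (y / 2)], the first two coordinates of the point in C^3 are three times the
    normalized ones, and [extGamma3_bound] is three times C10. *)
Lemma condC4_chub : condC4 y l0 -> both_pchub y l0.
Proof.
move=> [_ /(_ isT)/extGamma3_bound H]; apply/both_pchub2.
apply/(c10_hub (tet_dataP _ _ _) x1lt); move: H.
pose G k := if k == 3%N then crd y 2 / l0 else yhat y l0 k.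
rewrite !(crd_row G) // /G /yhat /=.
have -> : 3 / 2 * (crd y 1 / l0) = 3 * (crd y 1 / 2 / l0) by field.
have -> : 3 / 2 * crd y 1 = 3 * (crd y 1 / 2) by field.
move: (crd y 1 / 2 / l0) (crd y 1 / 2) (crd y 2 / l0) => x1 x2 x3.
rewrite !rmorphM !rmorph_nat -!mulrA -!mulrBr !cmodM cmod_nat.
by rewrite -mulrDr ler_pM2l //; lra.
Qed.

Lemma condC11_chub : condC11 y l0 -> both_pchub y l0.
Proof.
move=> [ql _ /(_ isT)[b /(_ 1%N isT)[bN /(_ (lexx _))[F1 F2] _]]].
apply/both_pchub2; have e1 : crd y 1 = 2 * l0 * (crd y 1 / 2 / l0) by field.
have e2 : crd y 1 = 2 * (crd y 1 / 2) by field.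
have e3 : crd y 2 = l0 * (crd y 2 / l0) by field.
apply/(scaled_c11 (N := 2) isT l0n e1 e2 e3 y12).
by split=> //; exists (crd b 1), (crd b 2).
Qed.

End DimensionTwo.

Theorem theorem5p5 (R : realType) :
  (forall (n : nat) (s0 : 'rV[R[i]]_n) (l0 : R[i]),
     (2 <= n)%N -> symG s0 -> disc l0 -> l0 <> 0 ->
     interpolates s0 l0 ->
     ratio_bound s0 l0 /\
     (condC2 s0 l0 /\ condC3 s0 l0 /\ condC4 s0 l0 /\ condC5 s0 l0 /\
      condC6 s0 l0 /\ condC7 s0 l0 /\ condC8 s0 l0 /\ condC9 s0 l0 /\
      condC10 s0 l0 /\ condC11 s0 l0)) /\
  (forall (s0 : 'rV[R[i]]_2) (l0 : R[i]),
     symG s0 -> disc l0 -> l0 <> 0 ->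
     (condC2 s0 l0 <-> interpolates s0 l0) /\
     (condC3 s0 l0 <-> interpolates s0 l0) /\
     (condC4 s0 l0 <-> interpolates s0 l0) /\
     (condC5 s0 l0 <-> interpolates s0 l0) /\
     (condC6 s0 l0 <-> interpolates s0 l0) /\
     (condC7 s0 l0 <-> interpolates s0 l0) /\
     (condC8 s0 l0 <-> interpolates s0 l0) /\
     (condC9 s0 l0 <-> interpolates s0 l0) /\
     (condC10 s0 l0 <-> interpolates s0 l0) /\
     (condC11 s0 l0 <-> interpolates s0 l0)).
Proof.
split=> [n y l0 n2 yG l01 /eqP l0n I|y l0 yG l01 /eqP l0n].
  have H := interp_both_pchub n2 yG l01 l0n I.
  split; first exact: interp_ratio.
  split; first exact: interp_C2.
  split; first exact/condC3_iff.
  split; first exact: both_pchub_C4.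
  split; first exact: both_pchub_C5.
  split; first exact/condC6_iff.
  split; first exact/condC7_iff.
  split; first exact/condC8_iff.
  split; first exact/condC9_iff.
  split; first exact/condC10_iff.
  exact: both_pchub_C11.
have I : both_pchub y l0 <-> interpolates y l0.
  by split; [exact: chub_interpolates|exact: interp_both_pchub].
split; first by rewrite -I; split; [exact: condC2_chub|move/I; exact: interp_C2].
split; first by rewrite -I; exact: condC3_iff.
split; first by rewrite -I; split; [exact: condC4_chub|exact: both_pchub_C4].
split; first by rewrite -I; split; [exact: condC5_chub|exact: both_pchub_C5].
split; first by rewrite -I; exact: condC6_iff.
split; first by rewrite -I; exact: condC7_iff.
split; first by rewrite -I; exact: condC8_iff.
split; first by rewrite -I; exact: condC9_iff.
split; first by rewrite -I; exact: condC10_iff.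
by rewrite -I; split; [exact: condC11_chub|exact: both_pchub_C11].
Qed.
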